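(* Let $D\ge 2$ be an integer, let $k>\frac D2$ be an integer, and let $u_0\in X^k(\mathbb{R}^D)$ satisfy $E(u_0)<+\infty$. Let $u\in C(I;X^k(\mathbb{R}^D))$ be the maximal solution of the Gross-Pitaevskii equation $$iu_t+\Delta u+u(1-|u|^2)=0,\qquad u(0)=u_0,$$ where $I\ni 0$ is its open maximal interval of existence. Then the energy is conserved along the trajectory: $E(u(t))=E(u_0)$ for every $t\in I$ (in particular $E(u(t))<+\infty$).
   Context: Functions are complex-valued. For an integer $k\ge1$ the Zhidkov space is $$X^k(\mathbb{R}^D)=\{u\in L^\infty(\mathbb{R}^D)\cap UC(\mathbb{R}^D):\ \nabla u\in H^{k-1}(\mathbb{R}^D)\},$$ where $UC(\mathbb{R}^D)$ is the space of uniformly continuous functions and $H^{k-1}$ is the usual Sobolev space, with norm $\|u\|_{X^k(\mathbb{R}^D)}=\|u\|_{L^\infty(\mathbb{R}^D)}+\|\nabla u\|_{H^{k-1}(\mathbb{R}^D)}$. The energy is $$E(u)=\frac12\int_{\mathbb{R}^D}|\nabla u|^2\,dx+\frac14\int_{\mathbb{R}^D}(1-|u|^2)^2\,dx\in[0,+\infty].$$ A solution on an interval $I\ni 0$ is a function $u\in C(I;X^k(\mathbb{R}^D))$ with $u(0)=u_0$ that satisfies the equation in the sense of distributions on $I\times\mathbb{R}^D$ (equivalently, its Duhamel form). Known background (C. Gallo): for $k>\frac D2$ and $u_0\in X^k(\mathbb{R}^D)$ the initial value problem is locally well posed in $X^k(\mathbb{R}^D)$, so there is a unique maximal solution, defined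 on an open interval $I$ containing $0$; if moreover $u_0\in X^{k+2}(\mathbb{R}^D)$, then $u(t)\in X^{k+2}(\mathbb{R}^D)$ for $t\in I$. *)

(* Defs.v *)
From HB Require Import structures.
From mathcomp Require Import all_boot all_order all_algebra.
From mathcomp Require Import all_classical all_reals all_analysis.
From mathcomp Require Import complex.

Set Implicit Arguments.
Unset Strict Implicit.
Unset Printing Implicit Defensive.

Import Order.TTheory GRing.Theory Num.Theory.
Import numFieldNormedType.Exports.
Import ComplexField.Normc.

Local Open Scope classical_set_scope.
Local Open Scope ring_scope.

(* R^n is 'rV[R]_n.  Its library norm is the sup norm, which gives the usual *)
(* topology and uniformity; its sigma-algebra is generated by the            *)
(* coordinates, so it is the Borel one.                                      *)

Definition measure_rV_display : measure_display.
Proof. exact: default_measure_display. Qed.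

Section measurable_rV.
Context {R : realType} (n : nat).

Definition rV_coord (i : 'I_n) (x : 'rV[R]_n) : measurableTypeR R := x 0 i.

Let rV_set0 : g_sigma_preimage rV_coord set0.
Proof. exact: sigma_algebra0. Qed.

Let rV_setC A : g_sigma_preimage rV_coord A -> g_sigma_preimage rV_coord (~` A).
Proof. exact: sigma_algebraC. Qed.

Let rV_bigcup (F : _^nat) : (forall i, g_sigma_preimage rV_coord (F i)) ->
  g_sigma_preimage rV_coord (\bigcup_i (F i)).
Proof. exact: sigma_algebra_bigcup. Qed.

HB.instance Definition _ := @isMeasurable.Build measure_rV_display
  'rV[R]_n (g_sigma_preimage rV_coord) rV_set0 rV_setC rV_bigcup.

Lemma measurable_rV_coord i : measurable_fun setT (rV_coord i).
Proof.
move=> _ Y mY; rewrite setTI; apply: sub_sigma_algebra => /=.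
rewrite -bigcup_seq/=; exists i => /=; first by rewrite mem_index_enum.
by exists Y => //; rewrite setTI.
Qed.

Lemma measurable_fun_rV d (T : measurableType d) (f : T -> 'rV[R]_n) :
  (forall i, measurable_fun setT (rV_coord i \o f)) -> measurable_fun setT f.
Proof.
move=> mf.
suff prefS : g_sigma_preimage (fun i => rV_coord i \o f) `<=` measurable.
  move=> _ A mA; apply: prefS; rewrite g_sigma_preimage_comp.
  by exists A.
apply: smallest_sub; first exact: sigma_algebra_measurable.
move=> A; rewrite -bigcup_seq/= => -[i _ [B mB <-]].
exact: mf.
Qed.

End measurable_rV.

(* The point (t, x) of R x R^n = R^(1+n); coordinate 0 is t.                 *)
Definition rV_cons {R : realType} {n : nat} (p : measurableTypeR R * 'rV[R]_n) :
  'rV[R]_n.+1 := row_mx (const_mx p.1 : 'rV[R]_1) p.2.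

Section rV_cons_theory.
Context {R : realType} {n : nat}.

Lemma rV_cons0 (p : measurableTypeR R * 'rV[R]_n) : rV_cons p 0 ord0 = p.1.
Proof.
rewrite (_ : ord0 = lshift n (ord0 : 'I_1)); last exact: val_inj.
by rewrite [LHS]row_mxEl mxE.
Qed.

Lemma rV_consS (p : measurableTypeR R * 'rV[R]_n) (j : 'I_n) :
  rV_cons p 0 (lift ord0 j) = p.2 0 j.
Proof.
rewrite (_ : lift ord0 j = rshift 1 j); last exact: val_inj.
by rewrite [LHS]row_mxEr.
Qed.

Lemma measurable_rV_cons : measurable_fun setT (@rV_cons R n).
Proof.
apply: measurable_fun_rV => i; case: (unliftP ord0 i) => [j ->|->].
- rewrite (_ : _ \o _ = rV_coord j \o snd).
    exact: measurableT_comp (measurable_rV_coord j) measurable_snd.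
  by apply/funext => p; rewrite /= /rV_coord rV_consS.
- rewrite (_ : _ \o _ = fst); first exact: measurable_fst.
  by apply/funext => p; rewrite /= /rV_coord rV_cons0.
Qed.

Definition rV_uncons (x : 'rV[R]_n.+1) : measurableTypeR R * 'rV[R]_n :=
  (x 0 ord0, \row_j x 0 (lift ord0 j)).

Lemma rV_consK : cancel (@rV_cons R n) rV_uncons.
Proof.
move=> p; rewrite [RHS]surjective_pairing /rV_uncons rV_cons0.
by congr pair; apply/rowP => j; rewrite mxE rV_consS.
Qed.

Lemma rV_unconsK : cancel rV_uncons (@rV_cons R n).
Proof.
move=> x; apply/rowP => i; case: (unliftP ord0 i) => [j ->|->].
- by rewrite rV_consS mxE.
- by rewrite rV_cons0.
Qed.

Lemma measurable_rV_uncons : measurable_fun setT rV_uncons.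
Proof.
apply/measurable_fun_pairP; split; first exact: (measurable_rV_coord ord0).
apply: measurable_fun_rV => j.
rewrite (_ : _ \o _ = rV_coord (lift ord0 j)).
  exact: measurable_rV_coord.
by apply/funext => x; rewrite /= /rV_coord mxE.
Qed.

End rV_cons_theory.

Section lebesgue_rV_step.
Context {R : realType} (n : nat).
Variable m : {sigma_finite_measure set 'rV[R]_n -> \bar R}.

Definition lebesgue_rV_step : set 'rV[R]_n.+1 -> \bar R :=
  pushforward (@lebesgue_measure R \x m)%E (@rV_cons R n).

Let step0 : lebesgue_rV_step set0 = 0%E.
Proof. by apply: measure0; exact: measurable_rV_cons. Qed.

Let step_ge0 A : (0 <= lebesgue_rV_step A)%E.
Proof. by apply: measure_ge0; exact: measurable_rV_cons. Qed.

Let step_sigma_additive : semi_sigma_additive lebesgue_rV_step.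
Proof.
by apply: measure_semi_sigma_additive; exact: measurable_rV_cons.
Qed.

HB.instance Definition _ := isMeasure.Build _ _ _ lebesgue_rV_step
  step0 step_ge0 step_sigma_additive.

Lemma lebesgue_rV_stepE A B : measurable A -> measurable B ->
  lebesgue_rV_step (rV_uncons @^-1` (A `*` B)) =
  (@lebesgue_measure R A * m B)%E.
Proof.
move=> mA mB; rewrite -product_measure1E// /lebesgue_rV_step /pushforward.
rewrite -comp_preimage (_ : _ \o _ = id) ?preimage_id//.
by apply/funext => p; exact: rV_consK.
Qed.

Let lebesgue_rV_step_sigma_finite : sigma_finite setT lebesgue_rV_step.
Proof.
have /sigma_finiteP[F [FT Fnd Foo]] := sigma_finiteT (@lebesgue_measure R).
have /sigma_finiteP[G [GT Gnd Goo]] := sigma_finiteT m.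
exists (fun k => @rV_uncons R n @^-1` (F k `*` G k)).
  rewrite -preimage_bigcup; apply/seteqP; split => // x _ /=.
  case: (rV_uncons x) => t y.
  have [i _ Fi] : (\bigcup_i F i) t by rewrite -FT.
  have [j _ Gj] : (\bigcup_i G i) y by rewrite -GT.
  exists (maxn i j) => //; split => /=.
  - by move: t Fi; exact/subsetPset/Fnd/leq_maxl.
  - by move: y Gj; exact/subsetPset/Gnd/leq_maxr.
move=> k; have [mF Fy] := Foo k; have [mG Gy] := Goo k; split.
  rewrite -[X in measurable X]setTI.
  by apply: measurable_rV_uncons => //; exact: measurableX.
by rewrite lebesgue_rV_stepE// lte_mul_pinfty// ge0_fin_numE.
Qed.

HB.instance Definition _ := Measure_isSigmaFinite.Build _ _ _
  lebesgue_rV_step lebesgue_rV_step_sigma_finite.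

End lebesgue_rV_step.

Fixpoint lebesgue_rV {R : realType} (n : nat) :
    {sigma_finite_measure set 'rV[R]_n -> \bar R} :=
  match n with
  | 0 => \d_(0 : 'rV[R]_0)
  | n'.+1 => lebesgue_rV_step (lebesgue_rV n')
  end.

Lemma lebesgue_rV_box {R : realType} n (A : 'I_n -> set (measurableTypeR R)) :
  (forall i, measurable (A i)) ->
  lebesgue_rV n [set x | forall i, A i (x 0 i)] =
  (\prod_(i < n) @lebesgue_measure R (A i))%E.
Proof.
elim: n A => [|n IHn] A mA.
  rewrite big_ord0 /= diracE mem_set//.
  by case.
rewrite big_ord_recl -IHn// -lebesgue_rV_stepE//; last first.
  rewrite [X in measurable X](_ : _ = \bigcap_(i in [set: 'I_n])
      (rV_coord i @^-1` A (lift ord0 i))); last first.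
    by apply/seteqP; split => x /= Ax i; [move=> _|]; exact: Ax.
  apply: fin_bigcap_measurable => [|i _]; first exact: finite_finset.
  rewrite -[X in measurable X]setTI.
  exact: measurable_rV_coord.
congr (lebesgue_rV_step _ _); apply/seteqP; split => x /=.
  by move=> Ax; split => /= [|i]; rewrite ?mxE; exact: Ax.
move=> [/= A0 AS] i; case: (unliftP ord0 i) => [j ->|->//].
by have := AS j; rewrite mxE.
Qed.

Section test_functions.
Context {R : realType} {n : nat}.
Implicit Types f : 'rV[R]_n -> R.

Definition pderiv (i : 'I_n) f : 'rV[R]_n -> R :=
  fun x => 'D_(delta_mx 0 i) f x.

Definition mderiv (s : seq 'I_n) f : 'rV[R]_n -> R := foldr pderiv f s.

Definition smooth f := forall (s : seq 'I_n) x, differentiable (mderiv s f) x.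

Definition test_function (Omega : set 'rV[R]_n) f :=
  let supp := closure [set x | f x != 0] in
  [/\ smooth f, compact supp & supp `<=` Omega].

End test_functions.

Section complex_functions.
Context {R : realType} {n : nat}.
Implicit Types f g : 'rV[R]_n -> R[i].
Local Notation mu := (@lebesgue_rV R n).

(* Meaningful when the real and imaginary parts of f are integrable on D.    *)
Definition cintegral (D : set 'rV[R]_n) f : R[i] :=
  Complex (\int[mu]_(x in D) complex.Re (f x))
          (\int[mu]_(x in D) complex.Im (f x)).

Definition cmeasurable f :=
  measurable_fun setT (fun x => complex.Re (f x) : measurableTypeR R) /\
  measurable_fun setT (fun x => complex.Im (f x) : measurableTypeR R).

Definition Lpnorm (p : \bar R) f : \bar R :=
  ('N[mu]_p[EFin \o (@normc R \o f)])%E.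

Definition L2 f := cmeasurable f /\ (Lpnorm 2%:E f < +oo)%E.

Definition L1loc f := cmeasurable f /\
  forall K, compact K -> (\int[mu]_(x in K) (normc (f x))%:E < +oo)%E.

(* g is the distributional derivative of f along the word s of coordinates.  *)
Definition is_wderiv (s : seq 'I_n) f g := [/\ L1loc f, L1loc g &
  forall phi : 'rV[R]_n -> R, test_function setT phi ->
    cintegral setT (fun x => f x * (mderiv s phi x)%:C%C) =
    (-1) ^+ size s * cintegral setT (fun x => g x * (phi x)%:C%C)].

(* A representative of the weak derivative, unique up to a null set when it  *)
(* exists; 0 otherwise.                                                      *)
Definition wderiv (s : seq 'I_n) f : 'rV[R]_n -> R[i] :=
  xget (cst 0) [set g | is_wderiv s f g].

(* The multi-index alpha as the word with alpha i letters i.                 *)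
Definition word_of m (alpha : {ffun 'I_n -> 'I_m.+1}) : seq 'I_n :=
  flatten [seq nseq (alpha i) i | i <- enum 'I_n].

Definition mindex_le m (alpha : {ffun 'I_n -> 'I_m.+1}) : bool :=
  (\sum_(i < n) alpha i <= m)%N.

Definition Hspace (m : nat) f := L2 f /\
  forall alpha : {ffun 'I_n -> 'I_m.+1}, mindex_le alpha ->
    exists2 g, is_wderiv (word_of alpha) f g & L2 g.

Definition Hnorm (m : nat) f : \bar R :=
  ((\sum_(alpha : {ffun 'I_n -> 'I_m.+1} | mindex_le alpha)
      (Lpnorm 2%:E (wderiv (word_of alpha) f)) ^+ 2) `^ 2^-1)%E.

Definition wgrad f (j : 'I_n) : 'rV[R]_n -> R[i] := wderiv [:: j] f.

(* An element of L^oo \cap UC is given by its uniformly continuous           *)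
(* representative.  R[i]^o only selects the normed-space structure of C.     *)
Definition Xspace (k : nat) f :=
  [/\ (Lpnorm +oo%E f < +oo)%E, unif_continuous (f : 'rV[R]_n -> R[i]^o) &
      forall j, exists2 g, is_wderiv [:: j] f g & Hspace k.-1 g].

Definition Xnorm (k : nat) f : \bar R :=
  (Lpnorm +oo%E f + (\sum_(j < n) (Hnorm k.-1 (wgrad f j)) ^+ 2) `^ 2^-1)%E.

Definition energy f : \bar R :=
  (2^-1%:E * (\int[mu]_x (\sum_(j < n) normc (wgrad f j x) ^+ 2)%:E) +
   4^-1%:E * (\int[mu]_x ((1 - normc (f x) ^+ 2) ^+ 2)%:E))%E.

End complex_functions.

Section gross_pitaevskii.
Context {R : realType} {D : nat}.
Implicit Types (I J : set R) (u v : R -> 'rV[R]_D -> R[i]).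

Definition Xcontinuous (k : nat) I u :=
  (forall t, I t -> Xspace k (u t)) /\
  (forall t, I t ->
     Xnorm k (fun x => u s x - u t x) @[s --> within I (nbhs t)] --> 0%E).

(* i u_t + \Delta u + u (1 - |u|^2) = 0 in the distributions on the interior *)
(* of I times R^D, with (t, x) encoded as in rV_cons.                        *)
Definition GP_equation I u :=
  let Q := [set z : 'rV[R]_D.+1 | I° (z 0 ord0)] in
  forall phi : 'rV[R]_D.+1 -> R, test_function Q phi ->
    let phi_t := pderiv ord0 phi in
    let lap_phi z := \sum_(j < D)
      mderiv [:: lift ord0 j; lift ord0 j] phi z in
    cintegral Q (fun z =>
      let w := u (rV_uncons z).1 (rV_uncons z).2 in
      - ('i%C * w * (phi_t z)%:C%C) + w * (lap_phi z)%:C%C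
      + w * (1 - normc w ^+ 2)%:C%C * (phi z)%:C%C) = 0.

Definition GP_solution (k : nat) (u0 : 'rV[R]_D -> R[i]) I u :=
  [/\ is_interval I, I 0, Xcontinuous k I u, u 0 = u0 & GP_equation I u].

Definition maximal_GP_solution (k : nat) (u0 : 'rV[R]_D -> R[i]) I u :=
  GP_solution k u0 I u /\
  forall J v, GP_solution k u0 J v -> I `<=` J ->
    (forall t, I t -> v t = u t) -> J = I.

End gross_pitaevskii.

(* Main.v *)
Require Import Defs.
From mathcomp Require Import all_boot all_order all_algebra.
From mathcomp Require Import all_classical all_reals all_analysis.
From mathcomp Require Import measurable_realfun.
From mathcomp Require Import complex.
From mathcomp Require Import ring lra.

(* Write u = p + i q. As D >= 2 we have k >= 2, so on a compact time interval u is bounded    *)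
(* and uniformly continuous in space-time and its weak space derivatives of order 1 and 2 are *)
(* bounded in L^2. Mollifying u in (t, x) gives smooth P, Q that solve the equation up to a   *)
(* uniformly small error, and no regularisation of the initial datum (hence no                *)
(* well-posedness theory) is needed. With eta(x) = prod_i beta(x_i / N), the localised energy *)
(*   e(t) = int eta^2 (|grad (P, Q)|^2 / 2 + (1 - P^2 - Q^2)^2 / 4)                           *)
(* satisfies |e'| <= (C / N) (1 + e), whence 1 + e(t) <= (1 + e(s)) exp(C |t - s| / N).       *)
(* When the mollification disappears, e(s) is controlled by E(u(s)) thanks to the             *)
(* L^2-continuity of the gradient in time, while the left-hand side is lower semicontinuous.  *)
(* Letting N tend to infinity gives E(u(t)) <= E(u(s)) as soon as E(u(s)) is finite, and s    *)
(* and t can be exchanged.                                                                    *)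

Set Implicit Arguments.
Unset Strict Implicit.
Unset Printing Implicit Defensive.

Import Order.TTheory GRing.Theory Num.Theory.
Import numFieldNormedType.Exports.

Local Open Scope classical_set_scope.
Local Open Scope ring_scope.

(** * Smooth functions of one variable *)

(** The equation is Hamiltonian. For a smooth solution, differentiating the energy and integrating
    by parts leaves only the real inner product of [u_t] with [i u_t], which vanishes. Two obstacles
    prevent this computation for the given [u]: it has too few derivatives, and the energy at other
    times is not known to be finite. Mollification in space-time removes the first obstacle, a
    cutoff [eta] at scale [N] the second.

    For mollified functions, [loc_energy_is_derive] is the exact identity: the localised energy
    changes only through the residuals [rem1], [rem2] of the equation and through the gradient of
    [eta], which is of size [1/N]. The latter multiplies time derivatives. [loc_rate_bound]
    expresses them, by the equation, through second space derivatives, bounded in L^2 since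
    [k >= 2], and through the defect [1 - |u|^2], whose square is controlled by the localised energy
    itself. Gronwall's inequality [exp_bound_sym] then gives [menergy_growth], in both time
    directions.

    The mollification is removed at fixed [N]. At the starting time [s] an upper bound is needed
    ([menergy_upper]); it uses the L^2-continuity of the gradient in time, because mollifying in
    time averages over neighbouring times. At the final time [t] a lower bound suffices
    ([menergy_lower]); it is weak lower semicontinuity, proved by duality with test functions
    ([moll_j_lower]). When [N] tends to infinity the exponential factor tends to 1 and Fatou's lemma
    gives [energy_le].

    The link with the Sobolev formulation is made by [moll_equation], which tests the distributional
    equation with the mollifier, and by [solution_slab], which collects the uniform bounds on a
    compact time interval. The outcome is the one-sided inequality [solution_energy_le]. The theorem
    applies it from 0 to [t] and then, finiteness at [t] being known, from [t] to 0. *)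

Section smooth1.
Context {R : realType}.
Implicit Types f g : R -> R.

Definition smooth1 f := forall n x, derivable (derive1n n f) x 1.

(** Induction on the order keeps every derivative inside [P]. This replaces the computation of
    iterated derivatives: for products, affine changes of variable and [flat] it is enough to
    exhibit a family closed under [derive1]. *)
Lemma smooth1_coind (P : (R -> R) -> Prop) :
  (forall f, P f -> (forall x, derivable f x 1) /\ P (derive1 f)) ->
  forall f, P f -> smooth1 f.
Proof.
move=> HP f Pf n x; suff [] : (forall x, derivable (derive1n n f) x 1) /\ P (derive1n n f) by [].
elim: n => [|n [_ IH]]; first by split => //; exact: (HP _ Pf).1.
rewrite derive1nS; have [_ Pd] := HP _ IH; split => //; exact: (HP _ Pd).1.
Qed.

Lemma smooth1_derivable f x : smooth1 f -> derivable f x 1.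
Proof. by move=> /(_ 0). Qed.

Lemma smooth1_derive f : smooth1 f -> smooth1 (derive1 f).
Proof. by move=> sf n x; rewrite -derive1Sn; exact: sf. Qed.

Lemma smooth1_is_derive f (x : R) : smooth1 f -> is_derive x 1 f ((derive1 f) x).
Proof. by move=> sf; rewrite derive1E; exact/derivableP/smooth1_derivable. Qed.

Lemma smooth1_continuous f : smooth1 f -> continuous f.
Proof.
by move=> sf x; apply/differentiable_continuous/derivable1_diffP/smooth1_derivable.
Qed.

(** The derivative of a product is a sum of products, so products alone are not stable under
    [derive1]; the generated algebra is. *)
Inductive smooth1_alg : (R -> R) -> Prop :=
| smooth1_alg_base f : smooth1 f -> smooth1_alg f
| smooth1_algD f g : smooth1_alg f -> smooth1_alg g -> smooth1_alg (f \+ g)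
| smooth1_algM f g : smooth1_alg f -> smooth1_alg g -> smooth1_alg (f \* g).

Lemma smooth1_algP f : smooth1_alg f -> smooth1 f.
Proof.
apply: smooth1_coind => {}f; elim => {f}[f sf|f g _ [df af] _ [dg ag]|f g af0 [df af] ag0 [dg ag]].
- by split => [x|]; [exact: smooth1_derivable|apply/smooth1_alg_base/smooth1_derive].
- split=> [x|]; first exact: derivableD.
  suff -> : derive1 (f \+ g) = (derive1 f) \+ (derive1 g) by exact: smooth1_algD.
  by apply/funext => x; rewrite /= !derive1E deriveD.
- split=> [x|]; first exact: derivableM.
  suff -> : derive1 (f \* g) = (f \* (derive1 g)) \+ (g \* (derive1 f)).
    by apply: smooth1_algD; apply: smooth1_algM.
  by apply/funext => x; rewrite /= !derive1E deriveM.
Qed.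

Lemma smooth1M f g : smooth1 f -> smooth1 g -> smooth1 (fun x => f x * g x).
Proof.
by move=> sf sg; apply/smooth1_algP/smooth1_algM; exact: smooth1_alg_base.
Qed.

Lemma derive1_affine f (c a b x : R) : smooth1 f ->
  derive1 (fun x => c * f (a * x + b)) x = c * (a * (derive1 f) (a * x + b)).
Proof.
move=> sf; rewrite derive1E.
have h1 : is_derive x 1 (fun x => a * x + b) a.
  have -> : (fun x : R => a * x + b) = (a \*: (@id R)) \+ cst b by [].
  apply: is_derive_eq; by rewrite scaler1 addr0.
have h2 := @is_derive1_comp _ f (fun x => a * x + b) x _ _
  (smooth1_is_derive (a * x + b) sf) h1.
have -> : (fun x => c * f (a * x + b)) = c \*: (f \o (fun x => a * x + b)) by [].
by rewrite derive_val [_ * a]mulrC.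
Qed.

Lemma smooth1_affine f (c a b : R) : smooth1 f ->
  smooth1 (fun x => c * f (a * x + b)).
Proof.
move=> sf.
apply: (@smooth1_coind (fun h => exists f c, smooth1 f /\ h = (fun x => c * f (a * x + b)))).
  move=> _ [{}f [{}c [{}sf ->]]]; split.
    move=> x; have -> : (fun x => c * f (a * x + b)) = c \*: (f \o (fun x => a * x + b)) by [].
    apply: derivableZ; apply/derivable1_diffP/differentiable_comp.
      have -> : (fun x : R => a * x + b) = (a \*: (@id R)) \+ cst b by [].
      exact: ex_diff.
    exact/derivable1_diffP/smooth1_derivable.
  exists (derive1 f), (c * a); split; first exact: smooth1_derive.
  by apply/funext => x; rewrite derive1_affine// mulrA.
by exists f, c.
Qed.

End smooth1.

(** * The flat function exp(-1/x) and smooth bumps *)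

Section flat.
Context {R : realType}.
Implicit Types (p : {poly R}) (x y : R).

(* Every derivative of exp(-1/x) has the form p(1/x) exp(-1/x), so that this family is stable *)
(* under differentiation.                                                                    *)
Definition flat p x : R := if 0 < x then p.[x^-1] * expR (- x^-1) else 0.

Lemma flat_le0 p x : x <= 0 -> flat p x = 0.
Proof. by rewrite /flat ltNge => ->. Qed.

(** The exponential series gives [expR (1/x) >= (1/x)^(n+2) / (n+2)!], whence the constant and the
    factor [x^2]. *)
Lemma flat_monom_le n : exists C : R, forall x, 0 < x ->
  `|flat ('X^n) x| <= C * x ^+ 2.
Proof.
exists (n.+2)`!%:R => x x0; rewrite /flat x0 hornerXn.
have y0 : 0 < x^-1 by rewrite invr_gt0.
rewrite ger0_norm; last by rewrite mulr_ge0 ?exprn_ge0 ?expR_ge0// ltW.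
have := expR_ge1Dxn n.+1 (ltW y0); rewrite expRN => h.
have {h} h : x^-1 ^+ n.+2 / (n.+2)`!%:R <= expR x^-1 by apply: le_trans h; rewrite lerDr.
rewrite ler_pdivrMr ?expR_gt0//.
have f0 : 0 < (n.+2)`!%:R :> R by rewrite ltr0n fact_gt0.
move: h; rewrite ler_pdivrMr// => h.
rewrite (_ : x^-1 ^+ n = x^-1 ^+ n.+2 * x ^+ 2); last first.
  by rewrite -addn2 exprD -mulrA -exprMn mulVf ?gt_eqF// expr1n mulr1.
by rewrite [leRHS]mulrAC ler_wpM2r ?sqr_ge0// mulrC.
Qed.

Lemma flatD p q x : flat (p + q) x = flat p x + flat q x.
Proof. by rewrite /flat; case: ifP => _; rewrite ?addr0// hornerD mulrDl. Qed.

Lemma flatZ c p x : flat (c *: p) x = c * flat p x.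
Proof. by rewrite /flat; case: ifP => _; rewrite ?mulr0// hornerZ mulrA. Qed.

Lemma flat_le p : exists C : R, 0 <= C /\ forall x, `|flat p x| <= C * x ^+ 2.
Proof.
suff [C HC] : exists C : R, forall x, 0 < x -> `|flat p x| <= C * x ^+ 2.
  exists `|C|; split=> // x; have [x0|x0] := ltP 0 x.
    by apply: le_trans (HC _ x0) _; rewrite ler_wpM2r ?sqr_ge0 ?ler_norm.
  by rewrite flat_le0// normr0 mulr_ge0 ?sqr_ge0.
have -> : p = \sum_(i < size p) p`_i *: 'X^i by rewrite -[LHS]coefK poly_def.
elim/big_rec : _ => [|i q _ [C IH]].
  by exists 0 => x x0; rewrite /flat x0 horner0 mul0r normr0 mul0r.
have [D HD] := flat_monom_le i.
exists (`|p`_i| * D + C) => x x0; rewrite flatD flatZ.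
apply: le_trans (ler_normD _ _) _; rewrite mulrDl lerD ?IH// normrM -mulrA.
by rewrite ler_wpM2l ?HD.
Qed.

(** The quadratic bound of [flat_le] makes the difference quotient at the gluing point of order
    [h]. *)
Lemma is_derive_flat0 p : is_derive (0 : R) 1 (flat p) 0.
Proof.
have [C [C0 HC]] := flat_le p.
have h : h^-1 *: ((flat p \o shift 0) (h *: 1) - flat p 0) @[h --> (0 : R)^'] --> (0 : R).
  apply/cvgrPdist_le => e e0; near=> h.
  have hn0 : h != 0 by near: h; exact: nbhs_dnbhs_neq.
  rewrite (flat_le0 p (lexx 0)) subr0 sub0r normrN /= addr0 scaler1.
  rewrite normrZ normfV mulrC ler_pdivrMr ?normr_gt0//.
  apply: le_trans (HC _) _; rewrite -real_normK ?num_real// expr2 mulrA ler_wpM2r//.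
  have hC : `|h| <= e / (C + 1).
    near: h; apply: dnbhs0_le; by rewrite divr_gt0// ltr_wpDl.
  apply: le_trans (_ : (C + 1) * `|h| <= _); first by rewrite ler_wpM2r// lerDl.
  by rewrite mulrC -ler_pdivlMr ?ltr_wpDl.
apply: DeriveDef; first by apply/cvg_ex; exists 0.
by apply: cvg_lim.
Unshelve. all: end_near.
Qed.

(** With [y = 1/x] one has [dy/dx = - y^2], so [p(y) exp(-y)] has derivative
    [y^2 (p - p')(y) exp(-y)], again in the family. *)
Lemma derive_flat p x : is_derive x 1 (flat p) (flat ('X^2 * (p - p^`())) x).
Proof.
have [x0|x0|->] := ltgtP x 0; last 2 first.
- have h1 : is_derive x 1 (fun z => p.[z^-1] * expR (- z^-1))
     (flat ('X^2 * (p - p^`())) x).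
    have h2 : is_derive x 1 (@GRing.inv R) (- x^-2).
      have := @is_deriveV _ (@id R) x 1 1 (lt0r_neq0 x0) (is_derive_id x 1).
      by rewrite scaler1.
    have h3 := @is_derive1_comp _ (horner p) (@GRing.inv R) x _ _ (is_derive_poly p x^-1) h2.
    have h4 : is_derive x 1 (expR \o (fun z => - z^-1)) (expR (- x^-1) * - (- x^-2)).
      apply: is_derive1_comp; exact: is_deriveN.
    have h5 := is_deriveM h3 h4.
    apply: is_derive_eq.
    rewrite /flat x0 hornerM hornerXn hornerD hornerN -!exprVn /GRing.scale/=; ring.
  apply: near_eq_is_derive h1; near=> z; rewrite /flat ifT//; near: z; exact: lt_nbhsr.
- rewrite flat_le0//; exact: is_derive_flat0.
- rewrite flat_le0 ?ltW//; apply: near_eq_is_derive (is_derive_cst 0 x 1).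
  near=> z; rewrite flat_le0// ltW//; near: z; exact: lt_nbhsl.
Unshelve. all: end_near.
Qed.

Lemma flat_smooth p : smooth1 (flat p).
Proof.
apply: (@smooth1_coind _ (fun f => exists p, f = flat p)); last by exists p.
move=> _ [q ->]; split; first by move=> x; have [] := derive_flat q x.
exists ('X^2 * (q - q^`())); apply/funext => x.
by rewrite derive1E; exact/(@derive_val _ _ _ _ _ _ _ (derive_flat q x)).
Qed.

End flat.

Section bump.
Context {R : realType}.
Implicit Types (r x : R).

(** Each factor is flat at one end of []-r, r[]; the product is not normalised. *)
Definition bump r x : R := flat 1 (r + x) * flat 1 (r - x).

Lemma flat1E x : flat 1 x = if 0 < x then expR (- x^-1) else 0.
Proof. by rewrite /flat hornerE; case: ifP => // _; rewrite mul1r. Qed.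

Lemma flat1_ge0 x : 0 <= flat 1 x.
Proof. by rewrite flat1E; case: ifP => // _; exact: expR_ge0. Qed.

Lemma flat1_gt0 x : (0 < flat 1 x) = (0 < x).
Proof. by rewrite flat1E; case: ifP => // _; exact: expR_gt0. Qed.

Lemma flat1_le1 x : flat 1 x <= 1.
Proof.
rewrite flat1E; case: ifP => // x0.
by rewrite expR_le1 oppr_le0 invr_ge0 ltW.
Qed.

Lemma flat1_nd x y : x <= y -> flat 1 x <= flat 1 y.
Proof.
move=> xy; rewrite (flat1E x); case: ifP => [x0|_]; last exact: flat1_ge0.
rewrite flat1E (lt_le_trans x0 xy) ler_expR lerN2 lef_pV2//.
exact: lt_le_trans xy.
Qed.

Lemma bump_ge0 r x : 0 <= bump r x.
Proof. by rewrite mulr_ge0 ?flat1_ge0. Qed.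

Lemma bump_gt0 r x : (0 < bump r x) = (`|x| < r).
Proof.
rewrite ltr_norml; have [h|h] := ltP 0 (r - x); last first.
  by rewrite /bump (flat_le0 _ h) mulr0 ltxx; lra.
have [h'|h'] := ltP 0 (r + x).
  rewrite /bump mulr_gt0 ?flat1_gt0//; symmetry; lra.
rewrite /bump (flat_le0 _ h') mul0r ltxx; symmetry; lra.
Qed.

Lemma bump_eq0 r x : r <= `|x| -> bump r x = 0.
Proof.
move=> rx; apply/eqP; rewrite eq_le bump_ge0 andbT leNgt bump_gt0.
by rewrite -leNgt.
Qed.

Lemma bumpN r x : bump r (- x) = bump r x.
Proof. by rewrite /bump opprK mulrC. Qed.

Lemma bump_smooth r : smooth1 (bump r).
Proof.
have h1 := @smooth1_affine _ _ 1 1 r (@flat_smooth _ 1).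
have h2 := @smooth1_affine _ _ 1 (-1) r (@flat_smooth _ 1).
have := smooth1M h1 h2; congr smooth1; apply/funext => x.
by rewrite !mul1r mulN1r /bump [r + x]addrC [r - x]addrC.
Qed.

Lemma bump_ge r x : 0 < r -> `|x| <= r / 2 -> flat 1 (r / 2) ^+ 2 <= bump r x.
Proof.
move=> r0; rewrite ler_norml => /andP[h1 h2]; rewrite expr2.
apply: ler_pM; rewrite ?flat1_ge0//; apply: flat1_nd; lra.
Qed.

End bump.

(** * Smooth compactly supported functions of one variable *)

Section test1.
Context {R : realType}.
Implicit Types (f g : R -> R) (r x : R).
Local Notation leb := (@lebesgue_measure R).

(** The radius [r] may be negative, which is why absolute values of radii appear below. *)
Definition test1 f := smooth1 f /\ exists r, forall x, r <= `|x| -> f x = 0.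

Lemma test1_derive f : test1 f -> test1 (derive1 f).
Proof.
move=> [sf [r fr]]; split; first exact: smooth1_derive.
exists (r + 1) => x rx; rewrite derive1E.
rewrite (@near_eq_derive _ _ _ f (cst 0)) ?derive_cst//.
near=> z; apply: fr.
suff : `|x - z| < 1 by move=> h; have := ler_normD (x - z) z; rewrite subrK; lra.
by near: z; exact: nbhsx_ballx.
Unshelve. all: end_near. Qed.

Lemma test1M f g : test1 f -> smooth1 g -> test1 (fun x => f x * g x).
Proof.
move=> [sf [r fr]] sg; split; first exact: smooth1M.
by exists r => x rx; rewrite fr ?mul0r.
Qed.

Lemma test1_affine f (c a b : R) : a != 0 -> test1 f ->
  test1 (fun x => c * f (a * x + b)).
Proof.
move=> a0 [sf [r fr]]; split; first exact: smooth1_affine.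
exists ((`|r| + `|b|) / `|a|) => x; rewrite ler_pdivrMr ?normr_gt0// => h.
rewrite fr ?mulr0//; have := ler_normB (a * x + b) b.
rewrite addrK normrM mulrC; have := ler_norm r; lra.
Qed.

Lemma test1Z f (c : R) : test1 f -> test1 (fun x => c * f x).
Proof.
move=> /(@test1_affine _ c 1 0 (oner_neq0 _)); congr test1.
by apply/funext => x; rewrite mul1r addr0.
Qed.

Lemma test1_shift f (b : R) : test1 f -> test1 (fun x => f (b - x)).
Proof.
move=> /(@test1_affine _ 1 (-1) b (_ : -1 != 0)) => /(_ _)/wrap[]; first by rewrite oppr_eq0 oner_neq0.
by congr test1; apply/funext => x; rewrite mul1r mulN1r addrC.
Qed.

Lemma test1_bounded f : test1 f -> exists M, 0 <= M /\ forall x, `|f x| <= M.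
Proof.
move=> [sf [r fr]].
have r0 : - `|r| <= `|r| by rewrite ge0_cp.
have cf : {within `[- `|r|, `|r|], continuous (fun x => `|f x|)}.
  apply: continuous_subspaceT => x; apply: continuous_comp; first exact: smooth1_continuous.
  exact: norm_continuous.
have [c _ cM] := EVT_max r0 cf.
exists `|f c|; split => // x; have [h|h] := leP r `|x|; first by rewrite fr ?normr0.
apply: cM; rewrite in_itv/= -ler_norml; apply: ltW; apply: lt_le_trans h (ler_norm _).
Qed.

Lemma smooth1_measurable f : smooth1 f -> measurable_fun [set: measurableTypeR R] f.
Proof. by move=> sf; apply: continuous_measurable_fun; exact: smooth1_continuous. Qed.

Lemma test1_le_indic f : test1 f -> exists M r, [/\ 0 <= M, 0 <= r &
  forall x, `|f x| <= M * \1_(`[- r, r]) x].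
Proof.
move=> tf; have [M [M0 fM]] := test1_bounded tf; have [_ [r fr]] := tf.
exists M, `|r|; split=> // x; rewrite indicE.
have [h|h] := boolP (x \in _); first by rewrite mulr1.
rewrite fr ?normr0 ?mulr0//; move: h; rewrite notin_setE/= in_itv/= -ler_norml => /negP.
by rewrite -ltNge => h; apply: ltW; apply: le_lt_trans h; exact: ler_norm.
Qed.

Lemma test1_integrable f : test1 f -> leb.-integrable setT (EFin \o f).
Proof.
move=> tf; have [M [r [M0 r0 fM]]] := test1_le_indic tf.
have h := integrableZl measurableT M (@integrable_indic_itv _ (-r) r true false).
apply: le_integrable h => //.
  by apply/measurable_EFinP; apply: smooth1_measurable; exact: tf.1.
move=> x _ /=; rewrite lee_fin; apply: le_trans (fM x) _.
by rewrite ler_norm.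
Qed.

End test1.

(** * Lebesgue measure on R^n and tensor products *)

Section lebesgue_translation.
Context {R : realType}.
Local Notation leb := (@lebesgue_measure R).

Lemma measurable_addr (a : R) :
  measurable_fun [set: measurableTypeR R] (fun x => x + a : measurableTypeR R).
Proof. by apply: measurable_funD. Qed.

(** Both measures agree on half-open intervals, and this determines Lebesgue measure. *)
Lemma lebesgue_measureD (a : R) (A : set (measurableTypeR R)) : measurable A ->
  pushforward leb (fun x => x + a : measurableTypeR R) A = leb A.
Proof.
move=> mA; apply/esym/(@lebesgue_measure_unique _ (pushforward leb _)) => //=.
  exact: measurable_addr.
move=> _ _ [[u v]] _ <-; rewrite /pushforward.
rewrite (_ : _ @^-1` _ = `]u - a, v - a]%classic); last first.
  by apply/seteqP; split => x /=; rewrite !in_itv/=; lra.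
rewrite !lebesgue_measure_itv/= !lte_fin ltrD2r; case: ifP => // _.
by rewrite -!EFinB; congr EFin; ring.
Qed.

Lemma ge0_integral_shift (f : measurableTypeR R -> \bar R) (a : R) :
  measurable_fun [set: measurableTypeR R] f -> (forall x, (0 <= f x)%E) ->
  (\int[leb]_x f (x + a)%R = \int[leb]_x f x)%E.
Proof.
move=> mf f0.
have := @ge0_integral_pushforward _ _ _ _ _ _ (measurable_addr a) leb setT f measurableT mf (fun x _ => f0 x).
rewrite preimage_setT => <-; apply: eq_measure_integral => [|? A mA _]; [exact: measurable_addr|exact: lebesgue_measureD].
Qed.

End lebesgue_translation.

Section lebesgue_rV_theory.
Context {R : realType}.
Local Notation leb := (@lebesgue_measure R).
Local Notation mu n := (@lebesgue_rV R n).

Lemma integral_rV_cons n (f : 'rV[R]_n.+1 -> \bar R) :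
  measurable_fun setT f -> (forall x, (0 <= f x)%E) ->
  (\int[mu n.+1]_x f x = \int[leb \x mu n]_p f (rV_cons p))%E.
Proof.
move=> mf f0.
have := @ge0_integral_pushforward _ _ _ _ _ _ (@measurable_rV_cons R n) (leb \x mu n)%E setT f measurableT mf (fun x _ => f0 x).
rewrite preimage_setT => <-; apply: eq_measure_integral => //; exact: measurable_rV_cons.
Qed.

Lemma integral_rV_iter n (f : 'rV[R]_n.+1 -> \bar R) :
  measurable_fun setT f -> (forall x, (0 <= f x)%E) ->
  (\int[mu n.+1]_x f x = \int[leb]_t \int[mu n]_y f (rV_cons (t, y)))%E.
Proof.
move=> mf f0; rewrite integral_rV_cons// fubini_tonelli1//.
by apply: measurableT_comp mf _; exact: measurable_rV_cons.
Qed.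

Lemma integral_rV0 (f : 'rV[R]_0 -> \bar R) : measurable_fun setT f ->
  (\int[mu 0]_x f x = f 0%R)%E.
Proof. by move=> mf; rewrite integral_dirac// diracT mul1e. Qed.

Definition tensor n (b : 'I_n -> R -> R) (x : 'rV[R]_n) : R := \prod_(i < n) b i (x 0 i).

Lemma measurable_coordf n (i : 'I_n) (b : R -> R) :
  measurable_fun [set: measurableTypeR R] b ->
  measurable_fun [set: 'rV[R]_n] (fun x : 'rV[R]_n => b (x 0 i)).
Proof. by move=> mb; exact: (measurableT_comp mb (measurable_rV_coord i)). Qed.

Lemma measurable_tensor n (b : 'I_n -> R -> R) :
  (forall i, measurable_fun [set: measurableTypeR R] (b i)) ->
  measurable_fun setT (tensor b).
Proof.
move=> mb; apply: measurable_prod => i _; exact: measurable_coordf.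
Qed.

Lemma tensor_cons n (b : 'I_n.+1 -> R -> R) t (y : 'rV[R]_n) :
  tensor b (rV_cons (t, y)) = b ord0 t * tensor (fun i => b (lift ord0 i)) y.
Proof.
rewrite /tensor big_ord_recl rV_cons0; congr (_ * _).
by apply: eq_bigr => i _; rewrite rV_consS.
Qed.

Lemma integral_tensor n (b : 'I_n -> R -> R) :
  (forall i, measurable_fun [set: measurableTypeR R] (b i)) ->
  (forall i x, 0 <= b i x) ->
  (\int[mu n]_x (tensor b x)%:E = \prod_(i < n) \int[leb]_t (b i t)%:E)%E.
Proof.
elim: n b => [|n IH] b mb b0.
  rewrite big_ord0 integral_rV0; first by rewrite /tensor big_ord0.
  by apply/measurable_EFinP; apply: measurable_tensor.
have t0 k (c : 'I_k -> R -> R) : (forall i x, 0 <= c i x) -> forall y, 0 <= tensor c y.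
  by move=> c0 y; exact: prodr_ge0.
rewrite integral_rV_iter; last 2 first.
- by apply/measurable_EFinP; apply: measurable_tensor.
- by move=> x; rewrite lee_fin t0.
rewrite big_ord_recl -IH//.
under eq_integral => t _.
  under eq_integral do rewrite tensor_cons EFinM.
  rewrite ge0_integralZl//; last 3 first.
  - by apply/measurable_EFinP; apply: measurable_tensor.
  - by move=> y _; rewrite lee_fin t0.
  - by rewrite lee_fin.
  over.
rewrite ge0_integralZr//.
- exact/measurable_EFinP.
- by move=> x _; rewrite lee_fin.
- by apply: integral_ge0 => y _; rewrite lee_fin t0.
Qed.

Definition ebase n (i : 'I_n) : 'rV[R]_n := delta_mx 0 i.

Lemma measurable_shift_rV n (v : 'rV[R]_n) :
  measurable_fun setT (fun x : 'rV[R]_n => x + v).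
Proof.
apply: measurable_fun_rV => i.
rewrite (_ : _ \o _ = (fun t => t + v 0 i) \o rV_coord i); last first.
  by apply/funext => x; rewrite /= /rV_coord mxE.
apply: measurableT_comp (measurable_rV_coord i); exact: measurable_addr.
Qed.

(** Tonelli separates coordinate 0; translation invariance on the line and the induction hypothesis
    then treat the two iterated integrals. *)
Lemma ge0_integral_shift_rV n (f : 'rV[R]_n -> \bar R) (v : 'rV[R]_n) :
  measurable_fun setT f -> (forall x, (0 <= f x)%E) ->
  (\int[mu n]_x f (x + v)%R = \int[mu n]_x f x)%E.
Proof.
elim: n f v => [|n IH] f v mf f0.
  congr integral; apply/funext => x; congr f; apply/rowP; by case.
have mfv : measurable_fun setT (fun x : 'rV[R]_n.+1 => f (x + v)).
  by apply: measurableT_comp mf _; exact: measurable_shift_rV.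
rewrite (integral_rV_iter mfv); last by move=> x; exact: f0.
rewrite (integral_rV_iter mf); last exact: f0.
have mfc : measurable_fun setT (f \o @rV_cons R n).
  by apply: measurableT_comp mf _; exact: measurable_rV_cons.
have mF : measurable_fun setT (fubini_F (mu n) (f \o @rV_cons R n)).
  by apply: measurable_fun_fubini_tonelli_F => // x; exact: f0.
rewrite -[RHS](ge0_integral_shift (v 0 ord0) mF); last first.
  by move=> x; apply: integral_ge0 => y _; exact: f0.
apply: eq_integral => t _.
rewrite -[RHS](IH (fun y => f (rV_cons (t + v 0 ord0, y))) (\row_j v 0 (lift ord0 j)))//; last first.
  exact: (@measurable_fun_pair2 _ _ _ _ _ _ (f \o @rV_cons R n)).
apply: eq_integral => y _; congr f; apply/rowP => i.
case: (unliftP ord0 i) => [j ->|->]; first by rewrite mxE !rV_consS !mxE.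
by rewrite mxE !rV_cons0.
Qed.

Lemma lebesgue_rV_shift n (v : 'rV[R]_n) A : measurable A ->
  pushforward (mu n) (fun x => x + v) A = mu n A.
Proof.
move=> mA.
have m1 : measurable_fun setT (EFin \o (\1_A : 'rV[R]_n -> R)) by exact/measurable_EFinP.
transitivity (\int[mu n]_x (\1_A x)%:E)%E; last by rewrite integral_indic// setIT.
rewrite -(ge0_integral_shift_rV v m1); last by move=> x; rewrite lee_fin.
rewrite /pushforward -[in LHS](setIT (_ @^-1` A)) -integral_indic//.
by rewrite -[X in measurable X]setTI; exact: (@measurable_shift_rV n v).
Qed.

Lemma integrable_shift_rV n (f : 'rV[R]_n -> R) (v : 'rV[R]_n) :
  (mu n).-integrable setT (EFin \o f) ->
  (mu n).-integrable setT (EFin \o (fun x => f (x + v))).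
Proof.
move=> /integrableP[mf fi]; apply/integrableP; split.
  by apply: measurableT_comp mf _; exact: measurable_shift_rV.
have := @ge0_integral_shift_rV n (abse \o (EFin \o f)) v _ _.
by move=> /= -> //; exact: measurableT_comp.
Qed.

Lemma Rintegral_shift_rV n (f : 'rV[R]_n -> R) (v : 'rV[R]_n) :
  (mu n).-integrable setT (EFin \o f) ->
  \int[mu n]_x f (x + v) = \int[mu n]_x f x.
Proof.
move=> fi; congr fine.
have mf := measurable_int _ fi; have fvi := integrable_shift_rV v fi.
have := @integral_pushforward _ _ _ _ _ _ (measurable_shift_rV v) (mu n) setT _ mf.
rewrite preimage_setT => /(_ fvi measurableT) <-; apply: eq_measure_integral => [|? A mA _]; [exact: measurable_shift_rV|exact: lebesgue_rV_shift].
Qed.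

End lebesgue_rV_theory.

(** * Partial derivatives of tensor products *)

Section line_derivative.
Context {R : realType} {n : nat}.
Implicit Types (f g : 'rV[R]_n -> R) (x : 'rV[R]_n).

Lemma is_derive_line f j x (d : R) :
  is_derive x (ebase j) f d <-> is_derive (0 : R) 1 (fun h => f (x + h *: ebase j)) d.
Proof.
have E : (fun h => h^-1 *: ((f \o shift x) (h *: ebase j) - f x)) =
   (fun h : R => h^-1 *: (((fun h => f (x + h *: ebase j)) \o shift 0) (h *: 1) -
      f (x + 0 *: ebase j))).
  apply/funext => h /=; rewrite scale0r !addr0 [h *: 1]mulr1; congr (_ *: (f _ - _)).
  by rewrite addrC.
split => -[h1 h2]; apply: DeriveDef.
- by rewrite /derivable -E.
- by rewrite -h2 /derive E.
- by rewrite /derivable E.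
- by rewrite -h2 /derive E.
Qed.

Lemma is_derive_line_at f j x (t d : R) :
  is_derive (x + t *: ebase j) (ebase j) f d ->
  is_derive t 1 (fun h => f (x + h *: ebase j)) d.
Proof.
move=> /is_derive_line H.
have -> : (fun h => f (x + h *: ebase j)) =
   (fun h => f (x + t *: ebase j + h *: ebase j)) \o (fun h => h - t).
  by apply/funext => h /=; rewrite -addrA -scalerDl [t + _]addrC subrK.
have h1 : is_derive t 1 (fun h : R => h - t) 1.
  have -> : (fun h : R => h - t) = id \- cst t by [].
  by apply: is_derive_eq; rewrite subr0.
rewrite -[d]mulr1; apply: is_derive1_comp => //.
by rewrite subrr.
Qed.

End line_derivative.

Section tensor_smooth.
Context {R : realType} {n : nat}.
Implicit Types (b : 'I_n -> R -> R) (x : 'rV[R]_n).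

(** A partial derivative of a tensor product is the same product with one factor replaced; all
    derivatives of kernels below have this form. *)
Definition upd b j (g : R -> R) : 'I_n -> R -> R := fun i => if i == j then g else b i.

Lemma tensor_upd b j g x :
  tensor (upd b j g) x = g (x 0 j) * \prod_(i < n | i != j) b i (x 0 i).
Proof.
rewrite /tensor (bigD1 j)//= /upd eqxx; congr (_ * _).
by apply: eq_bigr => i /negPf ->.
Qed.

Lemma upd_id b j : upd b j (b j) = b.
Proof. by apply/funext => i; rewrite /upd; case: eqP => // ->. Qed.

Lemma tensor_is_derive b j x : smooth1 (b j) ->
  is_derive x (ebase j) (tensor b) (tensor (upd b j (derive1 (b j))) x).
Proof.
move=> sb; apply/is_derive_line; rewrite tensor_upd.
have -> : (fun h => tensor b (x + h *: ebase j)) =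
    (\prod_(i < n | i != j) b i (x 0 i)) \*: (b j \o (fun h : R => h + x 0 j)).
  apply/funext => h; rewrite -[in LHS](upd_id b j) tensor_upd /= mulrC !mxE !eqxx mulr1.
  rewrite [x 0 j + h]addrC; congr (_ * _); apply: eq_bigr => i ij.
  by rewrite !mxE eqxx (negPf ij) mulr0 addr0.
have h1 : is_derive (0 : R) 1 (fun h : R => h + x 0 j) 1.
  have -> : (fun h : R => h + x 0 j) = id \+ cst (x 0 j) by [].
  by apply: is_derive_eq; rewrite addr0.
have h2 := @is_derive1_comp _ (b j) _ 0 _ _ (smooth1_is_derive (0 + x 0 j) sb) h1.
by apply: is_derive_eq; rewrite mulr1 add0r mulrC.
Qed.

Lemma tensor_differentiable b x : (forall i, smooth1 (b i)) ->
  differentiable (tensor b) x.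
Proof.
move=> sb; rewrite /tensor; elim: (index_enum _) => [|i s IH].
  rewrite (_ : (fun _ => _) = cst 1); last by apply/funext => y; rewrite big_nil.
  exact: differentiable_cst.
rewrite (_ : (fun _ => _) = (fun y : 'rV[R]_n => b i (y 0 i)) *
    (fun y => \prod_(k <- s) b k (y 0 k))); last first.
  by apply/funext => y; rewrite big_cons.
apply: differentiableM => //.
apply: (@differentiable_comp _ _ _ _ (fun y : 'rV[R]_n => y 0 i)).
  exact: differentiable_coord.
exact/derivable1_diffP/smooth1_derivable.
Qed.

Lemma smooth1_derivn (f : R -> R) m : smooth1 f -> smooth1 (derive1n m f).
Proof. by move=> sf; elim: m => [//|m IH]; rewrite derive1nS; exact: (smooth1_derive IH). Qed.

Lemma pderiv_tensor b j : smooth1 (b j) ->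
  pderiv j (tensor b) = tensor (upd b j (derive1 (b j))).
Proof.
move=> sb; apply/funext => x; rewrite /pderiv.
exact/(@derive_val _ _ _ _ _ _ _ (tensor_is_derive x sb)).
Qed.

(** Derivatives in different coordinates act on different factors, so only the number of occurrences
    of each coordinate in the word matters. *)
Lemma mderiv_tensor b (s : seq 'I_n) : (forall i, smooth1 (b i)) ->
  mderiv s (tensor b) = tensor (fun i => derive1n (count_mem i s) (b i)).
Proof.
move=> sb; elim: s => [|j s /= ->].
  by congr tensor; apply/funext => i.
rewrite pderiv_tensor; last exact: smooth1_derivn.
congr tensor; apply/funext => i; rewrite /upd -derive1nS.
by case: eqVneq => [->|ij]; rewrite ?eqxx //= eq_sym (negPf ij).
Qed.

Lemma tensor_smooth b : (forall i, smooth1 (b i)) -> smooth (tensor b).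
Proof.
move=> sb s x; rewrite mderiv_tensor//; apply: tensor_differentiable => i.
exact: smooth1_derivn.
Qed.

Lemma compact_closed_box (l h : 'I_n -> R) :
  compact [set x : 'rV[R]_n | forall i, l i <= x 0 i <= h i].
Proof.
have := @rV_compact _ n (fun i => `[l i, h i]%classic : set R) (fun i => @segment_compact _ _ _).
by congr compact; apply/seteqP; split => x /= hx i; have := hx i; rewrite in_itv.
Qed.

Lemma tensor_test_function b (l h : 'I_n -> R) (Omega : set 'rV[R]_n) :
  (forall i, smooth1 (b i)) -> (forall i (t : R), b i t != 0 -> l i <= t <= h i) ->
  [set x : 'rV[R]_n | forall i, l i <= x 0 i <= h i] `<=` Omega ->
  test_function Omega (tensor b).
Proof.
move=> sb bs sO; have cB : compact [set x : 'rV[R]_n | forall i, l i <= x 0 i <= h i] by exact: compact_closed_box.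
have clB := compact_closed (@norm_hausdorff _ _) cB.
have sB : closure [set x | tensor b x != 0] `<=`
    [set x : 'rV[R]_n | forall i, l i <= x 0 i <= h i].
  rewrite [X in _ `<=` X](closure_id _).1//; apply: closure_subset => x /= + i.
  rewrite /tensor => /prodf_neq0 /(_ i isT); exact: bs.
split; [exact: tensor_smooth| |exact: subset_trans sO].
by apply: subclosed_compact cB sB; exact: closed_closure.
Qed.

End tensor_smooth.

Section box.
Context {R : realType} {n : nat}.
Local Notation mu := (@lebesgue_rV R n).
Implicit Types (f g : 'rV[R]_n -> R) (x : 'rV[R]_n) (r : R).

Definition box r : set 'rV[R]_n := [set x | forall i, `|x 0 i| <= r].

Lemma measurable_box r : measurable (box r).
Proof.
rewrite (_ : box r = \bigcap_(i in [set: 'I_n]) (rV_coord i @^-1` `[- r, r]%classic)).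
  apply: fin_bigcap_measurable => [|i _]; first exact: finite_finset.
  by rewrite -[X in measurable X]setTI; exact: measurable_rV_coord.
apply/seteqP; split => x /= h i; first by move=> _; rewrite /= in_itv/= -ler_norml; exact: h.
by have := h i I; rewrite /= in_itv/= -ler_norml.
Qed.

Lemma box_lty r : (mu (box r) < +oo)%E.
Proof.
rewrite (_ : box r = [set x | forall i, `[- r, r]%classic (x 0 i)]); last first.
  by apply/seteqP; split => x /= h i; have := h i; rewrite in_itv/= -ler_norml.
rewrite (@lebesgue_rV_box R n (fun=> `[- r, r]%classic))//.
rewrite (eq_bigr (fun=> (fine (lebesgue_measure (`[- r, r]%classic : set R)))%:E)).
  by rewrite prodEFin ltry.
by move=> i _; rewrite lebesgue_measure_itv/=; case: ifP.
Qed.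

Lemma integrable_box r : mu.-integrable setT (EFin \o \1_(box r)).
Proof.
apply/integrableP; split; first by apply/measurable_EFinP; apply: measurable_indic; exact: measurable_box.
under eq_integral do rewrite /= ger0_norm//.
by rewrite integral_indic ?setIT//; [exact: box_lty|exact: measurable_box].
Qed.

Definition boxed r f := forall x, ~ box r x -> f x = 0.

Lemma boxed_le_indic r f M : boxed r f -> (forall x, `|f x| <= M) ->
  forall x, `|f x| <= M * \1_(box r) x.
Proof.
move=> bf fM x; rewrite indicE; case: (boolP (x \in box r)) => h; first by rewrite mulr1.
by rewrite bf ?normr0 ?mulr0//; move: h; rewrite notin_setE.
Qed.

Lemma boxed_integrable r f M : measurable_fun setT f -> boxed r f ->
  (forall x, `|f x| <= M) -> mu.-integrable setT (EFin \o f).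
Proof.
move=> mf bf fM; have h := integrableZl measurableT M (integrable_box r).
apply: le_integrable h => //; first exact/measurable_EFinP.
move=> x _ /=; rewrite lee_fin; apply: le_trans (boxed_le_indic bf fM x) _.
by rewrite ler_norm.
Qed.

Lemma boxed_leW r r' f : r <= r' -> boxed r f -> boxed r' f.
Proof. by move=> rr bf x nb; apply: bf => bx; apply: nb => i; apply: le_trans rr. Qed.

Lemma boxedM r f g : boxed r f -> boxed r (fun x => f x * g x).
Proof. by move=> bf x nb; rewrite bf// mul0r. Qed.

End box.

(** * Differentiation under the integral and integration by parts *)

Section under.
Context {R : realType} d {Y : measurableType d} (mu : {measure set Y -> \bar R}).

(** Domination is asked only at parameters at distance less than 1 from [a], so that [G] can be a
    multiple of the indicator of a slightly enlarged box. *)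
Lemma Rintegral_is_derive (f f' : R -> Y -> R) (a : R) (G : Y -> R) :
  (forall x, mu.-integrable setT (EFin \o f x)) ->
  (forall (x : R) y, is_derive x 1 (f ^~ y) (f' x y)) ->
  mu.-integrable setT (EFin \o G) ->
  (forall x y, `|x - a| < 1 -> `|f' x y| <= G y) ->
  is_derive a 1 (fun x => \int[mu]_y f x y) (\int[mu]_y f' a y).
Proof.
move=> fi fd Gi fG.
have G0 y : 0 <= G y by apply: le_trans (fG a y _); rewrite ?subrr ?normr0.
have Ia : [set` `]a - 1, a + 1[] a by rewrite /= in_itv/=; lra.
have d1E x y : partial1of2 f x y = f' x y.
  by rewrite partial1of2E; exact/(@derive_val _ _ _ _ _ _ _ (fd x y)).
have GU x y : [set` `]a - 1, a + 1[] x -> setT y -> `|partial1of2 f x y| <= G y.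
  by rewrite d1E /= in_itv/= => h _; apply: fG; rewrite ltr_norml; lra.
have D1 x y : [set` `]a - 1, a + 1[] x -> setT y -> derivable (f ^~ y) x 1.
  by move=> _ _; have [] := fd x y.
have h1 := @derivable_under_integral _ _ _ mu f setT measurableT a (a - 1) (a + 1) Ia
  (fun x _ => fi x) D1 G G0 Gi GU.
have h2 := @differentiation_under_integral _ _ _ mu f setT measurableT a (a - 1) (a + 1) Ia
  (fun x _ => fi x) D1 G G0 Gi GU.
apply: DeriveDef => //; rewrite -derive1E h2.
by apply: eq_Rintegral => y _; rewrite d1E.
Qed.

End under.

Section integration_by_parts_rV.
Context {R : realType} {n : nat}.
Local Notation mu := (@lebesgue_rV R n).

(** By translation invariance the integral of [f (x + h e_j)] does not depend on [h];
    differentiating it under the integral at [h = 0] gives the integral of [f']. The integrations by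
    parts below are this lemma applied to a product. *)
Lemma integral_pderiv_eq0 (f f' : 'rV[R]_n -> R) j r M M' :
  measurable_fun setT f -> measurable_fun setT f' ->
  (forall x, is_derive x (ebase j) f (f' x)) ->
  boxed r f -> boxed r f' -> (forall x, `|f x| <= M) -> (forall x, `|f' x| <= M') ->
  \int[mu]_x f' x = 0.
Proof.
move=> mf mf' df bf bf' fM fM'.
have fi := boxed_integrable mf bf fM.
have M0 : 0 <= M' by apply: le_trans (fM' 0).
have h : is_derive (0 : R) 1 (fun h => \int[mu]_x f (x + h *: ebase j))
    (\int[mu]_x f' (x + 0 *: ebase j)).
  (* A translate by [|h| < 1] of a function supported in [box r] is supported in [box (r + 1)]. *)
  apply: (@Rintegral_is_derive _ _ _ mu (fun h x => f (x + h *: ebase j))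
     (fun h x => f' (x + h *: ebase j)) 0 (fun x => M' * \1_(box (r + 1)) x)).
  - by move=> h; exact: integrable_shift_rV.
  - by move=> h x; exact: is_derive_line_at.
  - by have := integrableZl measurableT M' (@integrable_box _ n (r + 1)).
  - move=> h x; rewrite subr0 => h1.
    apply: le_trans (boxed_le_indic bf' fM' _) _.
    rewrite ler_wpM2l// !indicE; case: (boolP (_ \in box r)) => // /set_mem hb.
    rewrite mem_set//= => i; have := hb i; rewrite !mxE => h2.
    have := ler_normB (x 0 i + h * (true && (i == j))%:R) (h * (true && (i == j))%:R).
    rewrite addrK => /le_trans; apply; apply: lerD => //.
    rewrite normrM; apply: le_trans (_ : 1 * 1 <= _); last by rewrite mulr1.
    by apply: ler_pM => //; [exact: ltW|case: (_ && _); rewrite ?normr1 ?normr0].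
have E : (fun h => \int[mu]_x f (x + h *: ebase j)) = cst (\int[mu]_x f x).
  by apply/funext => t; rewrite Rintegral_shift_rV.
move: h; rewrite E => h.
have := @derive_val _ _ _ _ _ _ _ h; rewrite derive_cst.
under eq_Rintegral do rewrite scale0r addr0.
by move=> <-.
Qed.

End integration_by_parts_rV.

(** * From almost everywhere to everywhere for continuous functions *)

Section ae_continuous.
Context {R : realType} {n : nat}.
Local Notation mu := (@lebesgue_rV R n).

Lemma open_box_gt0 (x : 'rV[R]_n) (e : R) : 0 < e ->
  (0 < mu [set y | forall i, `](x 0%R i - e)%R, (x 0%R i + e)%R[%classic (y 0%R i)])%E.
Proof.
move=> e0; rewrite (@lebesgue_rV_box R n (fun i => `](x 0 i - e), (x 0 i + e)[%classic))//.
rewrite (eq_bigr (fun=> (e + e)%:E)).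
  by rewrite prodEFin lte_fin prodr_gt0// => i _; rewrite addr_gt0.
move=> i _; rewrite lebesgue_measure_itv/= lte_fin ifT; last by lra.
by rewrite -EFinB; congr EFin; ring.
Qed.

(** If [f] exceeded [M] at one point it would do so on an open box around it, and such a box has
    positive measure. *)
Lemma ae_le_continuous (f : 'rV[R]_n -> R) M : continuous f ->
  {ae mu, forall x, f x <= M} -> forall x, f x <= M.
Proof.
move=> cf [N [mN N0 sN]] x; rewrite leNgt; apply/negP => Mf.
have /nbhs_ballP[e /= e0 he] : nbhs x [set y | M < f y].
  exact: (cvgr_gt (f x) (cf x) M Mf).
have := open_box_gt0 x e0; rewrite lt_neqAle => /andP[/negP + _]; apply.
rewrite eq_sym; apply/eqP; apply: (subset_measure0 _ mN _ N0).
- rewrite [X in measurable X](_ : _ = \bigcap_(i in [set: 'I_n])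
      (rV_coord i @^-1` `]x 0 i - e, x 0 i + e[%classic)).
    apply: fin_bigcap_measurable => [|i _]; first exact: finite_finset.
    by rewrite -[X in measurable X]setTI; exact: measurable_rV_coord.
  by apply/seteqP; split => y /= h i; [move=> _|]; exact: h.
- move=> y /= hy; apply: sN => /=; apply/negP; rewrite -ltNge; apply: he.
  split => // i j; rewrite ord1; have := hy j; rewrite /ball/= in_itv/= ltr_norml; lra.
Qed.

End ae_continuous.

(** * Mollification in space-time *)

Section mollifier.
Context {R : realType}.
Local Notation leb := (@lebesgue_measure R).
Implicit Types (e x w : R).

Lemma bump_test1 e : test1 (bump e).
Proof. by split; [exact: bump_smooth|exists e => x; exact: bump_eq0]. Qed.

Definition bump_mass e : R := \int[leb]_x bump e x.

Lemma bump_mass_gt0 e : 0 < e -> 0 < bump_mass e.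
Proof.
move=> e0; have c0 : 0 < flat 1 (e / 2) ^+ 2 by rewrite exprn_gt0// flat1_gt0 divr_gt0.
have i1 := @integrable_indic_itv R (- (e / 2)) (e / 2) true false.
have : \int[leb]_x (flat 1 (e / 2) ^+ 2 * \1_(`[- (e / 2), e / 2]%classic) x) <= bump_mass e.
  apply: le_Rintegral => //.
  - by have := integrableZl measurableT (flat 1 (e / 2) ^+ 2) i1.
  - exact/test1_integrable/bump_test1.
  - move=> x _; rewrite indicE; case: (boolP (_ \in _)) => h.
      by rewrite mulr1 bump_ge//; move: h; rewrite inE/= in_itv/= -ler_norml.
    by rewrite mulr0 bump_ge0.
apply: lt_le_trans; rewrite RintegralZl// mulr_gt0// /Rintegral integral_indic// setIT.
rewrite (_ : fine _ = e)//; transitivity (fine e%:E) => //; congr fine.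
apply: (eq_trans (lebesgue_measure_itv `[- (e / 2), e / 2])) => /=.
by rewrite lte_fin ifT; [rewrite -EFinB; congr EFin; lra|lra].
Qed.

(** For [e > 0] this is a mollifier of mass 1 supported in [[-e, e]]. Evenness turns [kap e (x - w)]
    into a translate of [kap e] in the variable [w]. *)
Definition kap e x := (bump_mass e)^-1 * bump e x.

Lemma kap_ge0 e x : 0 < e -> 0 <= kap e x.
Proof. by move=> e0; rewrite mulr_ge0 ?bump_ge0// invr_ge0 ltW// bump_mass_gt0. Qed.

Lemma kapN e x : kap e (- x) = kap e x.
Proof. by rewrite /kap bumpN. Qed.

Lemma kap_eq0 e x : e <= `|x| -> kap e x = 0.
Proof. by move=> h; rewrite /kap bump_eq0 ?mulr0. Qed.

Lemma kap_test1 e : test1 (kap e).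
Proof. exact/test1Z/bump_test1. Qed.

Lemma kap_measurable e : measurable_fun [set: measurableTypeR R] (kap e).
Proof. by apply: smooth1_measurable; case: (kap_test1 e). Qed.

Lemma integral_kap e : 0 < e -> (\int[leb]_x (kap e x)%:E = 1)%E.
Proof.
move=> e0; have h := test1_integrable (bump_test1 e).
rewrite -[LHS]fineK; last first.
  exact/integrable_fin_num/test1_integrable/kap_test1.
rewrite -[fine _]/(Rintegral leb setT (kap e)) /kap RintegralZl//.
by rewrite mulVf// gt_eqF// bump_mass_gt0.
Qed.

Lemma integral_kapBr e x : 0 < e -> (\int[leb]_w (kap e (x - w))%:E = 1)%E.
Proof.
move=> e0; rewrite -[RHS](integral_kap e0).
rewrite -(ge0_integral_shift (- x) (f := EFin \o kap e)); last 2 first.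
- by apply/measurable_EFinP; exact: kap_measurable.
- by move=> w; rewrite lee_fin kap_ge0.
by apply: eq_integral => w _ /=; rewrite -kapN opprB.
Qed.

End mollifier.

(** * Jensen's inequality and measurability of parameter integrals *)

Section Jensen.
Context {R : realType} d {T : measurableType d} (m : {measure set T -> \bar R}).
Implicit Types f k : T -> R.

Lemma le_intg f (g : T -> R) : measurable_fun setT f ->
  m.-integrable setT (EFin \o g) -> (forall x, `|f x| <= g x) ->
  m.-integrable setT (EFin \o f).
Proof.
move=> mf gi fg; apply: le_integrable gi => //; first exact/measurable_EFinP.
by move=> x _ /=; rewrite lee_fin (le_trans (fg x))// ler_norm.
Qed.

Lemma intgZ (c : R) f : m.-integrable setT (EFin \o f) ->
  m.-integrable setT (EFin \o (fun x => c * f x)).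
Proof. by move=> fi; have := integrableZl measurableT c fi. Qed.

Lemma intgD f g : m.-integrable setT (EFin \o f) -> m.-integrable setT (EFin \o g) ->
  m.-integrable setT (EFin \o (fun x => f x + g x)).
Proof. by move=> fi gi; have := integrableD measurableT fi gi. Qed.

Lemma intgB f g : m.-integrable setT (EFin \o f) -> m.-integrable setT (EFin \o g) ->
  m.-integrable setT (EFin \o (fun x => f x - g x)).
Proof. by move=> fi gi; have := integrableB measurableT fi gi. Qed.

Lemma intg_sum (I : Type) (s : seq I) (f : I -> T -> R) :
  (forall i, m.-integrable setT (EFin \o f i)) ->
  m.-integrable setT (EFin \o (fun x => \sum_(i <- s) f i x)).
Proof.
move=> fi; elim: s => [|i s IH].
  rewrite (_ : _ \o _ = cst 0%E); last by apply/funext => x /=; rewrite big_nil.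
  exact: integrable0.
rewrite (_ : _ \o _ = EFin \o (fun x => f i x + \sum_(k <- s) f k x)); last first.
  by apply/funext => x /=; rewrite big_cons.
exact: intgD.
Qed.

Lemma EFin_Rintegral f : m.-integrable setT (EFin \o f) ->
  ((\int[m]_x f x)%:E = \int[m]_x (f x)%:E)%E.
Proof. by move=> fi; rewrite fineK//; exact: integrable_fin_num. Qed.

(** With [c] the mean of [f] for the probability density [k], expand the nonnegative integral of
    [(f - c)^2 k]. *)
Lemma Jensen_sqr f k : measurable_fun setT f -> measurable_fun setT k ->
  (forall x, 0 <= k x) -> (\int[m]_x (k x)%:E = 1)%E ->
  (((\int[m]_x (f x * k x)) ^+ 2)%:E <= \int[m]_x (f x ^+ 2 * k x)%:E)%E.
Proof.
move=> mf mk k0 k1.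
have ki : m.-integrable setT (EFin \o k).
  apply/integrableP; split; first exact/measurable_EFinP.
  by under eq_integral do rewrite /= ger0_norm//; rewrite k1 ltry.
(* Nothing is to be proved when the right-hand side is infinite; otherwise [|f| <= 1 + f^2] makes
   [f k] integrable. *)
have [oo|fin] := eqVneq (\int[m]_x (f x ^+ 2 * k x)%:E)%E +oo%E.
  by rewrite oo leey.
have f2k0 x : 0 <= f x ^+ 2 * k x by rewrite mulr_ge0 ?sqr_ge0.
have mf2k : measurable_fun setT (fun x => f x ^+ 2 * k x).
  by apply: measurable_funM => //; exact: measurable_funX.
have f2i : m.-integrable setT (EFin \o (fun x => f x ^+ 2 * k x)).
  apply/integrableP; split; first exact/measurable_EFinP.
  by under eq_integral do rewrite /= ger0_norm//; rewrite ltey.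
have fki : m.-integrable setT (EFin \o (fun x => f x * k x)).
  apply: (@le_intg _ (fun x => k x + f x ^+ 2 * k x)); last 2 first.
  - exact: intgD.
  - move=> x; rewrite normrM (ger0_norm (k0 x)) -[X in X + _]mul1r -mulrDl.
    rewrite ler_wpM2r// ler_norml; have := sqr_ge0 (f x - 1); have := sqr_ge0 (f x + 1).
    rewrite !expr2; nra.
  - exact: measurable_funM.
rewrite -EFin_Rintegral// lee_fin; set c := \int[m]_x (f x * k x).
have : 0 <= \int[m]_x ((f x ^+ 2 * k x - (2 * c) * (f x * k x)) + c ^+ 2 * k x).
  apply: Rintegral_ge0 => x _.
  rewrite (_ : _ + _ = (f x - c) ^+ 2 * k x); last by ring.
  by rewrite mulr_ge0 ?sqr_ge0.
have i1 := intgZ (2 * c) fki; have i2 := intgZ (c ^+ 2) ki.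
rewrite RintegralD//; last exact: intgB.
rewrite RintegralB// !RintegralZl// -/c.
have -> : \int[m]_x k x = 1 by rewrite /Rintegral k1.
by rewrite !expr2; lra.
Qed.

End Jensen.

Lemma measurable_Rintegral_param {R : realType} d1 d2 {X : measurableType d1}
    {Y : measurableType d2} (m : {sigma_finite_measure set Y -> \bar R})
    (f : X * Y -> R) : measurable_fun setT f ->
  measurable_fun setT (fun x => \int[m]_y f (x, y)).
Proof.
move=> mf; have mEf : measurable_fun setT (EFin \o f) by exact/measurable_EFinP.
have mp := @measurable_fun_fubini_tonelli_F _ _ X Y R m ((EFin \o f)^\+)%E
  (measurable_funepos mEf) (fun=> funepos_ge0 _ _).
have mn := @measurable_fun_fubini_tonelli_F _ _ X Y R m ((EFin \o f)^\-)%E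
  (measurable_funeneg mEf) (fun=> funeneg_ge0 _ _).
have := emeasurable_funB mp mn => h.
apply: (eq_measurable_fun (fine \o (fubini_F m (EFin \o f)^\+ \- fubini_F m (EFin \o f)^\-)%E)).
  move=> x _; rewrite /Rintegral [in RHS]integralE /= /fubini_F.
  by congr (fine (_ - _)); apply: eq_integral => y _; rewrite ?funeposE ?funenegE.
by apply: measurableT_comp h; exact: fine_measurable.
Qed.

(** * Convolution with tensor kernels in space-time *)

Section convolution.
Context {R : realType} {n : nat}.
Local Notation leb := (@lebesgue_measure R).
Local Notation mu := (@lebesgue_rV R n).
Local Notation RV := (measurableTypeR R * 'rV[R]_n)%type.
Implicit Types (F : R -> 'rV[R]_n -> R) (a : R -> R) (B : 'I_n -> R -> R)
  (t : R) (x : 'rV[R]_n) (z : RV).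

Lemma measurable_rVB d (T : measurableType d) (f g : T -> 'rV[R]_n) :
  measurable_fun setT f -> measurable_fun setT g ->
  measurable_fun setT (fun p => f p - g p).
Proof.
move=> mf mg; apply: measurable_fun_rV => i.
rewrite (_ : _ \o _ = (fun p => (rV_coord i \o f) p - (rV_coord i \o g) p)); last first.
  by apply/funext => p; rewrite /= /rV_coord !mxE.
by apply: measurable_funB; [exact: measurableT_comp (measurable_rV_coord i) mf|
  exact: measurableT_comp (measurable_rV_coord i) mg].
Qed.

Definition cker a B t x z := a (t - z.1) * tensor B (x - z.2).

(** The kernel acts through [a] in time and [tensor B] in space. With both as parameters, every
    derivative of a mollification is again a [conv]. *)
Definition conv F a B t x : R := \int[(leb \x mu)%E]_z (F z.1 z.2 * cker a B t x z).

Lemma measurable_cker d (T : measurableType d) a B (f : T -> measurableTypeR R)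
    (g : T -> 'rV[R]_n) (h : T -> RV) :
  (measurable_fun [set: measurableTypeR R] a) ->
  (forall i, measurable_fun [set: measurableTypeR R] (B i)) ->
  measurable_fun setT f -> measurable_fun setT g -> measurable_fun setT h ->
  measurable_fun setT (fun p => cker a B (f p) (g p) (h p)).
Proof.
move=> ma mB mf mg mh; apply: measurable_funM.
  apply: (measurableT_comp ma); apply: measurable_funB => //.
  exact: (measurableT_comp measurable_fst mh).
apply: (measurableT_comp (measurable_tensor mB)); apply: measurable_rVB => //.
exact: (measurableT_comp measurable_snd mh).
Qed.

Definition cylinder r : set RV := `[- r, r]%classic `*` box r.

Lemma measurable_cylinder r : measurable (cylinder r).
Proof. by apply: measurableX; [|exact: measurable_box]. Qed.

Lemma integrable_cylinder r :
  (leb \x mu)%E.-integrable setT (EFin \o \1_(cylinder r)).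
Proof.
apply/integrableP; split.
  by apply/measurable_EFinP; apply: measurable_indic; exact: measurable_cylinder.
under eq_integral do rewrite /= ger0_norm//.
rewrite integral_indic ?setIT//; last exact: measurable_cylinder.
have E : (leb \x mu)%E (cylinder r) = (leb `[(- r)%R, r]%classic * mu (box r))%E.
  by rewrite /cylinder product_measure1E//; exact: measurable_box.
rewrite [X in (X < _)%E]E {E}.
have h := @box_lty R n r; have h' : (leb `[(- r)%R, r]%classic < +oo)%E.
  apply: (@le_lt_trans _ _ (lebesgue_measure (`[(- r)%R, r]%classic : set R))) => //.
  by rewrite lebesgue_measure_itv/=; case: ifP => // _; rewrite -EFinB ltry.
by rewrite lte_mul_pinfty// ge0_fin_numE.
Qed.

Definition testB B := forall i, test1 (B i).

Lemma testB_upd B j g : testB B -> test1 g -> testB (upd B j g).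
Proof. by move=> tB tg i; rewrite /upd; case: ifP. Qed.

Lemma testB_updd B j : testB B -> testB (upd B j (derive1 (B j))).
Proof. by move=> tB; apply: testB_upd => //; apply: test1_derive. Qed.

Lemma testB_smooth B : testB B -> forall i, smooth1 (B i).
Proof. by move=> tB i; case: (tB i). Qed.

Lemma testB_measurable B : testB B -> forall i, measurable_fun [set: measurableTypeR R] (B i).
Proof. by move=> tB i; apply: smooth1_measurable; exact: testB_smooth. Qed.

Lemma testB_le B : testB B -> exists C r : R, [/\ 0 <= C, 0 <= r &
  forall x, `|tensor B x| <= C * \1_(box r) x].
Proof.
move=> tB; have /choice[M HM] i : exists M : R, 0 <= M /\ forall t : R, `|B i t| <= M.
  exact: test1_bounded.
have /choice[r Hr] i : exists r : R, 0 <= r /\ forall t : R, r < `|t| -> B i t = 0.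
  have [_ [r fr]] := tB i; exists `|r|; split => // x rx; apply: fr.
  exact: ltW (le_lt_trans (ler_norm _) rx).
exists (\prod_i M i), (\sum_i r i); split.
- by apply: prodr_ge0 => i _; have [] := HM i.
- by apply: sumr_ge0 => i _; have [] := Hr i.
- move=> x; rewrite indicE; case: (boolP (_ \in _)) => h.
    rewrite mulr1 /tensor normr_prod ler_prod// => i _; rewrite normr_ge0/=.
    by have [_] := HM i.
  rewrite mulr0; move: h; rewrite notin_setE => /existsNP[i /negP].
  rewrite -ltNge => h; rewrite /tensor (bigD1 i)//= (Hr i).2 ?mul0r ?normr0//.
  apply: le_lt_trans h; rewrite (bigD1 i)//= lerDl.
  by apply: sumr_ge0 => k _; have [] := Hr k.
Qed.

Lemma boxed_tensor B : testB B -> exists r : R, boxed r (tensor B : 'rV[R]_n -> R).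
Proof.
move=> tB; have [c [r [_ _ H]]] := testB_le tB; exists r => x nx.
by have := H x; rewrite indicE memNset// mulr0 normr_le0 => /eqP.
Qed.

Lemma box_shift_sub r s x y : (forall i, `|x 0 i| <= s) -> box r (x - y) -> box (r + s) y.
Proof.
move=> xs b i; have := b i; have := xs i; rewrite !mxE.
have := ler_normD (y 0 i - x 0 i) (x 0 i); rewrite subrK distrC; lra.
Qed.

(** The bound is uniform for [(t, x)] in a bounded set, hence a dominating function when [conv] is
    differentiated in [t] or in [x]. *)
Lemma cker_le a B : test1 a -> testB B -> exists C r : R, [/\ 0 <= C, 0 <= r &
  forall (s : R) t x z, `|t| <= s -> (forall i, `|x 0 i| <= s) ->
  `|cker a B t x z| <= C * \1_(cylinder (r + s)) z].
Proof.
move=> ta tB; have [C [r [C0 r0 HB]]] := testB_le tB.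
have [M [q [M0 q0 Ha]]] := test1_le_indic ta.
exists (M * C), (q + r); split; [exact: mulr_ge0|exact: addr_ge0|].
move=> s t x z ts xs; rewrite normrM.
apply: le_trans (ler_pM _ _ (Ha _) (HB _)) _ => //.
rewrite mulrACA ler_wpM2l ?mulr_ge0// !indicE -natrM mulnb ler_nat.
case: andP => // -[/set_mem h1 /set_mem h2]; rewrite mem_set//=; split => /=.
  move: h1; rewrite /= !in_itv/= -!ler_norml => h1.
  have := ler_normD (z.1 - t) t; rewrite subrK distrC; lra.
by move=> i; have := box_shift_sub xs h2 i; lra.
Qed.

Section fixed_function.
Variables (F : R -> 'rV[R]_n -> R) (M : R).
Hypothesis mF : measurable_fun setT (fun z : RV => F z.1 z.2).
Hypothesis FM : forall t x, `|F t x| <= M.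

Let M0 : 0 <= M. Proof. exact: le_trans (FM 0 0). Qed.

Lemma rV_bound (x : 'rV[R]_n) : exists s, 0 <= s /\ forall i, `|x 0 i| <= s.
Proof.
exists (\sum_i `|x 0 i|); split; first exact: sumr_ge0.
by move=> i; rewrite (bigD1 i)//= lerDl sumr_ge0.
Qed.

Lemma measurable_conv_integrand a B t x : test1 a -> testB B ->
  measurable_fun setT (fun z : RV => F z.1 z.2 * cker a B t x z).
Proof.
move=> ta tB; apply: measurable_funM => //.
apply: (@measurable_cker _ _ a B (cst t) (cst x) id) => //.
  by apply: smooth1_measurable; case: ta.
by move=> i; exact: testB_measurable.
Qed.

Lemma conv_integrand_le a B : test1 a -> testB B -> exists C r : R, [/\ 0 <= C, 0 <= r &
  forall (s : R) t x z, `|t| <= s -> (forall i, `|x 0 i| <= s) ->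
  `|F z.1 z.2 * cker a B t x z| <= C * \1_(cylinder (r + s)) z].
Proof.
move=> ta tB; have [C [r [C0 r0 H]]] := cker_le ta tB.
exists (M * C), r; split => //; first exact: mulr_ge0.
move=> s t x z ts xs; rewrite normrM -mulrA; apply: ler_pM => //; exact: H.
Qed.

Lemma integrable_conv a B t x : test1 a -> testB B ->
  (leb \x mu)%E.-integrable setT (EFin \o (fun z => F z.1 z.2 * cker a B t x z)).
Proof.
move=> ta tB; have [C [r [C0 r0 H]]] := conv_integrand_le ta tB.
have [s [s0 xs]] := rV_bound x.
apply: (le_intg _ (intgZ C (integrable_cylinder (r + (s + `|t|))))).
  exact: measurable_conv_integrand.
move=> z; apply: H; first by rewrite lerDr.
by move=> i; apply: le_trans (xs i) _; rewrite lerDl.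
Qed.

Lemma conv_is_derive_t a B t x : test1 a -> testB B ->
  is_derive t 1 (fun t => conv F a B t x) (conv F (derive1 a) B t x).
Proof.
move=> ta tB; have tda := test1_derive ta.
have [C [r [C0 r0 H]]] := conv_integrand_le tda tB.
have [s [s0 xs]] := rV_bound x.
apply: (@Rintegral_is_derive _ _ _ _ (fun t z => F z.1 z.2 * cker a B t x z)
  (fun t z => F z.1 z.2 * cker (derive1 a) B t x z) t
  (fun z => C * \1_(cylinder (r + (s + (`|t| + 1)))) z)).
- by move=> t'; exact: integrable_conv.
- move=> t' z.
  have h1 : is_derive t' 1 (fun u : R => u - z.1) 1.
    have -> : (fun u : R => u - z.1) = id \- cst z.1 by [].
    by apply: is_derive_eq; rewrite subr0.
  have h2 := @is_derive1_comp _ a _ t' _ _ (smooth1_is_derive (t' - z.1) ta.1) h1.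
  have -> : (fun u : R => F z.1 z.2 * cker a B u x z) =
    (F z.1 z.2 * tensor B (x - z.2)) \*: (a \o (fun u : R => u - z.1)).
    by apply/funext => u; rewrite /cker mulrCA mulrC.
  by apply: is_derive_eq; rewrite mulr1 /cker /GRing.scale/=; ring.
- exact/intgZ/integrable_cylinder.
- move=> t' z tt'; apply: H.
    have := ler_normD (t' - t) t; rewrite subrK; lra.
  by move=> i; apply: le_trans (xs i) _; rewrite lerDl addr_ge0.
Qed.

Lemma conv_is_derive_x a B t x j : test1 a -> testB B ->
  is_derive x (ebase j) (conv F a B t) (conv F a (upd B j (derive1 (B j))) t x).
Proof.
move=> ta tB; have tdB := testB_updd j tB.
have [C [r [C0 r0 H]]] := conv_integrand_le ta tdB.
have [s [s0 xs]] := rV_bound x.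
apply/is_derive_line; rewrite -[X in conv _ _ _ _ X]addr0 -(scale0r (ebase j)).
apply: (@Rintegral_is_derive _ _ _ _ (fun h z => F z.1 z.2 * cker a B t (x + h *: ebase j) z)
  (fun h z => F z.1 z.2 * cker a (upd B j (derive1 (B j))) t (x + h *: ebase j) z) 0
  (fun z => C * \1_(cylinder (r + (`|t| + (s + 1)))) z)).
- by move=> h; exact: integrable_conv.
- move=> h z.
  have h1 := tensor_is_derive (x - z.2 + h *: ebase j) (@testB_smooth B tB j).
  have h2 := is_derive_line_at h1.
  have -> : (fun u : R => F z.1 z.2 * cker a B t (x + u *: ebase j) z) =
    (F z.1 z.2 * a (t - z.1)) \*: (fun u => tensor B (x - z.2 + u *: ebase j)).
    by apply/funext => u; rewrite /= /cker mulrA; congr (_ * tensor B _); rewrite addrAC.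
  by apply: is_derive_eq; rewrite /cker /GRing.scale/= mulrA; congr (_ * tensor _ _); rewrite addrAC.
- exact/intgZ/integrable_cylinder.
- move=> h z; rewrite subr0 => h1; apply: H; first by rewrite lerDl addr_ge0.
  move=> i; rewrite !mxE; apply: le_trans (ler_normD _ _) _.
  rewrite addrA [_ + s]addrC -addrA; apply: lerD => //.
  rewrite normrM; apply: le_trans (_ : 1 * 1 <= _); last by rewrite mulr1 lerDr.
  by apply: ler_pM => //; [exact: ltW|case: (_ && _); rewrite ?normr1 ?normr0].
Qed.

(** Convolution in space alone. By [conv_sconv] the space-time convolution is an average of it in
    time, so that estimates at each time pass to [conv]. *)
Definition sconv B t x := \int[mu]_y (F t y * tensor B (x - y)).

Lemma measurable_sconv B : testB B ->
  measurable_fun setT (fun p : RV => sconv B p.1 p.2).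
Proof.
move=> tB.
have mI : measurable_fun setT
    (fun p : RV * 'rV[R]_n => F p.1.1 p.2 * tensor B (p.1.2 - p.2)).
  apply: measurable_funM.
    apply: (measurableT_comp mF (g := fun p : RV * 'rV[R]_n => (p.1.1, p.2))).
    apply/measurable_fun_pairP; split; last exact: measurable_snd.
    exact: (measurableT_comp measurable_fst measurable_fst).
  apply: (measurableT_comp (measurable_tensor (testB_measurable tB))).
  apply: measurable_rVB; last exact: measurable_snd.
  exact: (measurableT_comp measurable_snd measurable_fst).
exact: (measurable_Rintegral_param mu mI).
Qed.

Lemma integrable_sconv B t x : testB B ->
  mu.-integrable setT (EFin \o (fun y => F t y * tensor B (x - y))).
Proof.
move=> tB; have [C [r [C0 r0 H]]] := testB_le tB.
have [s [s0 xs]] := rV_bound x.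
apply: (le_intg _ (intgZ (M * C) (integrable_box (r + s)))).
  apply: measurable_funM.
    exact: (@measurable_fun_pair2 _ _ _ _ _ _ (fun z : RV => F z.1 z.2) t mF).
  apply: (measurableT_comp (measurable_tensor (testB_measurable tB))).
  exact: measurable_rVB.
move=> y; rewrite normrM -mulrA; apply: ler_pM => //.
apply: le_trans (H _) _; rewrite ler_wpM2l// !indicE ler_nat.
case: (boolP (_ \in box r)) => // /set_mem h; rewrite mem_set//.
exact: box_shift_sub h.
Qed.

Lemma conv_sconv a B t x : test1 a -> testB B ->
  conv F a B t x = \int[leb]_s (sconv B s x * a (t - s)).
Proof.
move=> ta tB; rewrite /conv {1}/Rintegral.
have I1 := integrable_conv t x ta tB.
rewrite -(integral12_prod_meas1 I1); congr fine; apply: eq_integral => s _.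
have I2 := integrable_sconv s x tB.
transitivity ((a (t - s) * sconv B s x)%:E); last by rewrite mulrC.
rewrite /sconv -RintegralZl// EFin_Rintegral; last exact: intgZ.
by apply: eq_integral => y _ /=; rewrite /cker mulrCA.
Qed.

Lemma measurable_conv a B t : test1 a -> testB B -> measurable_fun setT (conv F a B t).
Proof.
move=> ta tB.
have mI : measurable_fun setT
    (fun p : 'rV[R]_n * measurableTypeR R => sconv B p.2 p.1 * a (t - p.2)).
  apply: measurable_funM.
    apply: (measurableT_comp (measurable_sconv tB) (g := fun p : 'rV[R]_n * measurableTypeR R => (p.2, p.1))).
    by apply/measurable_fun_pairP; split; [exact: measurable_snd|exact: measurable_fst].
  apply: (measurableT_comp (smooth1_measurable ta.1)).
  by apply: measurable_funB => //; exact: measurable_snd.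
have := measurable_Rintegral_param leb mI; congr measurable_fun.
by apply/funext => x; rewrite conv_sconv.
Qed.

End fixed_function.

End convolution.

(** * Uniform and square-integral estimates for mollifications *)

Section convolution_estimates.
Context {R : realType} {n : nat}.
Local Notation leb := (@lebesgue_measure R).
Local Notation mu := (@lebesgue_rV R n).
Local Notation RV := (measurableTypeR R * 'rV[R]_n)%type.
Implicit Types (F : R -> 'rV[R]_n -> R) (a : R -> R) (B : 'I_n -> R -> R)
  (t : R) (x : 'rV[R]_n) (z : RV).

Definition kaps (e : R) : 'I_n -> R -> R := fun=> kap e.

Lemma kaps_testB e : testB (kaps e).
Proof. by move=> i; exact: kap_test1. Qed.

Lemma tensor_subE B (x y : 'rV[R]_n) :
  tensor B (x - y) = tensor (fun i s => B i (x 0 i - s)) y.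
Proof. by apply: eq_bigr => i _; rewrite !mxE. Qed.

Lemma tensor_kaps_ge0 e x : 0 < e -> 0 <= tensor (kaps e) x.
Proof. by move=> e0; apply: prodr_ge0 => i _; exact: kap_ge0. Qed.

Lemma tensor_kapsB e (x y : 'rV[R]_n) : tensor (kaps e) (x - y) = tensor (kaps e) (y - x).
Proof. by apply: eq_bigr => i _; rewrite !mxE /kaps -kapN opprB. Qed.

Lemma integral_tensor_kaps e x : 0 < e ->
  (\int[mu]_y (tensor (kaps e) (x - y))%:E = 1)%E.
Proof.
move=> e0; under eq_integral do rewrite tensor_subE.
rewrite integral_tensor.
- by rewrite big1// => i _; exact: integral_kapBr.
- move=> i; apply: (measurableT_comp (@kap_measurable R e)).
  by apply: measurable_funB.
- by move=> i s; exact: kap_ge0.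
Qed.

Lemma measurable_tensor_sub B x : testB B ->
  measurable_fun setT (fun y : 'rV[R]_n => tensor B (x - y)).
Proof.
move=> tB; apply: (measurableT_comp (measurable_tensor (testB_measurable tB))).
exact: measurable_rVB.
Qed.

Lemma measurable_tensor_subr B x : testB B ->
  measurable_fun setT (fun y : 'rV[R]_n => tensor B (y - x)).
Proof.
move=> tB; apply: (measurableT_comp (measurable_tensor (testB_measurable tB))).
exact: measurable_rVB.
Qed.

Lemma integral_cker_kap e t x : 0 < e ->
  (\int[(leb \x mu)]_z (cker (kap e) (kaps e) t x z)%:E = 1)%E.
Proof.
move=> e0; have c0 z : 0 <= cker (kap e) (kaps e) t x z.
  by rewrite mulr_ge0 ?kap_ge0 ?tensor_kaps_ge0.
rewrite fubini_tonelli1; last 2 first.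
- apply/measurable_EFinP.
  apply: (@measurable_cker _ _ _ _ (kap e) (kaps e) (cst t) (cst x) id) => //.
    exact: kap_measurable.
  by move=> i; exact: kap_measurable.
- by move=> z; rewrite lee_fin.
rewrite -[RHS](integral_kapBr t e0); apply: eq_integral => s _.
rewrite /fubini_F /cker/=; under eq_integral do rewrite EFinM.
rewrite ge0_integralZl//; last 3 first.
- by apply/measurable_EFinP; apply: measurable_tensor_sub; exact: kaps_testB.
- by move=> y _; rewrite lee_fin tensor_kaps_ge0.
- by rewrite lee_fin kap_ge0.
by rewrite integral_tensor_kaps// mule1.
Qed.

(** Young's inequality for a kernel of mass 1: Jensen in [y] for each [x], then Tonelli and the unit
    mass in [x]. *)
Lemma sqr_sconv_le (g : 'rV[R]_n -> R) e : measurable_fun setT g -> 0 < e ->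
  (\int[mu]_x ((\int[mu]_y (g y * tensor (kaps e) (x - y))) ^+ 2)%:E <=
   \int[mu]_x ((g x) ^+ 2)%:E)%E.
Proof.
move=> mg e0.
have mk : measurable_fun setT (fun p : 'rV[R]_n * 'rV[R]_n => tensor (kaps e) (p.1 - p.2)).
  apply: (measurableT_comp (measurable_tensor (testB_measurable (kaps_testB e)))).
  by apply: measurable_rVB.
have mgk : measurable_fun setT
    (fun p : 'rV[R]_n * 'rV[R]_n => g p.2 * tensor (kaps e) (p.1 - p.2)).
  by apply: measurable_funM => //; exact: (measurableT_comp mg measurable_snd).
have mG : measurable_fun setT
    (fun p : 'rV[R]_n * 'rV[R]_n => (g p.2 ^+ 2 * tensor (kaps e) (p.1 - p.2))%:E).
  apply/measurable_EFinP; apply: measurable_funM => //.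
  by apply: measurable_funX; exact: (measurableT_comp mg measurable_snd).
have G0 (p : 'rV[R]_n * 'rV[R]_n) :
    (0 <= (g p.2 ^+ 2 * tensor (kaps e) (p.1 - p.2))%:E)%E.
  by rewrite lee_fin mulr_ge0 ?sqr_ge0 ?tensor_kaps_ge0.
apply: (@le_trans _ _ (\int[mu]_x \int[mu]_y (g y ^+ 2 * tensor (kaps e) (x - y))%:E)%E).
  apply: ge0_le_integral => //.
  - by move=> x _; rewrite lee_fin sqr_ge0.
  - apply/measurable_EFinP; apply: measurable_funX.
    exact: (measurable_Rintegral_param mu mgk).
  - exact: (@measurable_fun_fubini_tonelli_F _ _ _ _ _ mu _ mG G0).
  - move=> x _; apply: Jensen_sqr => //.
    + by apply: measurable_tensor_sub; exact: kaps_testB.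
    + by move=> y; exact: tensor_kaps_ge0.
    + exact: integral_tensor_kaps.
rewrite (@fubini_tonelli _ _ _ _ _ mu mu _ mG G0).
apply: ge0_le_integral => //.
- by move=> y _; apply: integral_ge0 => x _; exact: (G0 (x, y)).
- exact: (@measurable_fun_fubini_tonelli_G _ _ _ _ _ mu _ mG G0).
- by apply/measurable_EFinP; exact: measurable_funX.
move=> y _ /=; under eq_integral do rewrite EFinM.
rewrite ge0_integralZl//; last 3 first.
- by apply/measurable_EFinP; apply: measurable_tensor_subr; exact: kaps_testB.
- by move=> x _; rewrite lee_fin tensor_kaps_ge0.
- by rewrite lee_fin sqr_ge0.
under eq_integral do rewrite tensor_kapsB.
by rewrite integral_tensor_kaps// mule1.
Qed.

Section fixed_function.
Variables (F : R -> 'rV[R]_n -> R) (M : R).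
Hypothesis mF : measurable_fun setT (fun z : RV => F z.1 z.2).
Hypothesis FM : forall t x, `|F t x| <= M.

(** A mollification is an average over an [e]-neighbourhood. The value [c] is free so as to cover
    both the bound on [moll] ([c = 0]) and its convergence ([c = F t x]). *)
Lemma conv_approx (e : R) t x (c w : R) : 0 < e ->
  (forall s (y : 'rV[R]_n), `|s - t| < e -> (forall i, `|y 0 i - x 0 i| < e) -> `|F s y - c| <= w) ->
  `|conv F (kap e) (kaps e) t x - c| <= w.
Proof.
move=> e0 Fw; have I1 := integrable_conv mF FM t x (kap_test1 e) (kaps_testB e).
have M1 t' (x' : 'rV[R]_n) : `|(fun _ _ => 1 : R) t' x'| <= 1 by rewrite normr1.
have I2 := integrable_conv (F := fun _ _ => 1) (M := 1) (measurable_cst _) M1 t x (kap_test1 e) (kaps_testB e).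
have I3 : (leb \x mu)%E.-integrable setT (EFin \o cker (kap e) (kaps e) t x).
  by apply: eq_integrable I2 => // z _; rewrite /= mul1r.
have c0 z : 0 <= cker (kap e) (kaps e) t x z.
  by rewrite mulr_ge0 ?kap_ge0 ?tensor_kaps_ge0.
have one : \int[(leb \x mu)%E]_z cker (kap e) (kaps e) t x z = 1.
  by rewrite /Rintegral integral_cker_kap.
rewrite -[X in _ - X](mulr1 c) -one -RintegralZl// /conv -RintegralB//; last exact: intgZ.
have I4 := intgB I1 (intgZ c I3).
apply: le_trans (le_normr_Rintegral _ I4) _ => //.
rewrite -[leRHS](mulr1 w) -one -RintegralZl//; apply: le_Rintegral => //.
- by apply: integrable_norm.
- exact: intgZ.
move=> z _; rewrite -mulrBl normrM (ger0_norm (c0 z)).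
have [[h1 h2]|] := pselect (`|z.1 - t| < e /\ forall i, `|z.2 0 i - x 0 i| < e).
  by rewrite ler_wpM2r// Fw.
move=> h; suff -> : cker (kap e) (kaps e) t x z = 0 by rewrite !mulr0.
rewrite /cker; case/not_andP: h => [/negP|/existsNP[i /negP]]; rewrite -leNgt => h.
  by rewrite kap_eq0 ?mul0r// distrC.
rewrite (_ : tensor _ _ = 0) ?mulr0// /tensor (bigD1 i)//= /kaps !mxE kap_eq0 ?mul0r//.
by rewrite distrC.
Qed.

(** Jensen in time. Only the times at distance less than [e] from [t] enter, which later allows the
    continuity of the gradient in time to be used. *)
Lemma sqr_conv_le e B t (K : \bar R) : 0 < e -> testB B -> (0 <= K)%E ->
  (forall s, `|s - t| < e -> (\int[mu]_x ((sconv F B s x) ^+ 2)%:E <= K)%E) ->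
  (\int[mu]_x ((conv F (kap e) B t x) ^+ 2)%:E <= K)%E.
Proof.
move=> e0 tB K0 HK.
have mV := measurable_sconv mF tB.
have mk : measurable_fun [set: measurableTypeR R] (fun s => kap e (t - s)).
  by apply: (measurableT_comp (@kap_measurable R e)); apply: measurable_funB.
have mVk : measurable_fun setT (fun p : 'rV[R]_n * measurableTypeR R => (sconv F B p.2 p.1 ^+ 2 * kap e (t - p.2))%:E).
  apply/measurable_EFinP; apply: measurable_funM.
    apply: measurable_funX.
    apply: (measurableT_comp mV (g := fun p : 'rV[R]_n * measurableTypeR R => (p.2, p.1))).
    by apply/measurable_fun_pairP; split; [exact: measurable_snd|exact: measurable_fst].
  exact: (measurableT_comp mk measurable_snd).
have Vk0 p : (0 <= (sconv F B p.2 p.1 ^+ 2 * kap e (t - p.2))%:E)%E.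
  by rewrite lee_fin mulr_ge0 ?sqr_ge0 ?kap_ge0.
apply: (@le_trans _ _ (\int[mu]_x \int[leb]_s (sconv F B s x ^+ 2 * kap e (t - s))%:E)%E).
  apply: ge0_le_integral => //.
  - by move=> x _; rewrite lee_fin sqr_ge0.
  - apply/measurable_EFinP; apply: measurable_funX.
    exact: (measurable_conv mF FM t (kap_test1 e) tB).
  - exact: (@measurable_fun_fubini_tonelli_F _ _ _ _ _ leb _ mVk Vk0).
  - move=> x _; rewrite (conv_sconv mF FM _ _ (kap_test1 e) tB); apply: Jensen_sqr => //.
    + exact: (@measurable_fun_pair1 _ _ _ _ _ _ (fun p : RV => sconv F B p.1 p.2) x mV).
    + by move=> s; exact: kap_ge0.
    + exact: integral_kapBr.
rewrite (@fubini_tonelli _ _ _ _ _ mu leb _ mVk Vk0).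
apply: (@le_trans _ _ (\int[leb]_s (K * (kap e (t - s))%:E))%E); last first.
  rewrite ge0_integralZl ?integral_kapBr ?mule1//.
  - exact/measurable_EFinP.
  - by move=> s _; rewrite lee_fin kap_ge0.
apply: ge0_le_integral => //.
- by move=> s _; apply: integral_ge0 => x _; exact: (Vk0 (x, s)).
- exact: (@measurable_fun_fubini_tonelli_G _ _ _ _ _ mu _ mVk Vk0).
- by apply: measurable_funeM; exact/measurable_EFinP.
move=> s _ /=; have [st|st] := ltP `|s - t| e; last first.
  rewrite kap_eq0; last by rewrite distrC.
  by rewrite mule0; under eq_integral do rewrite mulr0; rewrite integral0.
under eq_integral do rewrite EFinM.
rewrite ge0_integralZr//.
- by rewrite lee_wpmul2r ?HK// lee_fin kap_ge0.
- apply/measurable_EFinP; apply: measurable_funX.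
  exact: (@measurable_fun_pair2 _ _ _ _ _ _ (fun p : RV => sconv F B p.1 p.2) s mV).
- by move=> x _; rewrite lee_fin sqr_ge0.
- by rewrite lee_fin kap_ge0.
Qed.

Lemma sconv_bounded B : testB B -> exists C : R, 0 <= C /\
  forall t x, `|sconv F B t x| <= C.
Proof.
move=> tB; have [C [r [C0 r0 H]]] := testB_le tB.
have M0 : 0 <= M := le_trans (normr_ge0 _) (FM 0 0).
pose c := \int[mu]_y (M * C * \1_(box r) y).
have I1 := intgZ (M * C) (@integrable_box R n r).
exists c; split; first by apply: Rintegral_ge0 => y _; rewrite !mulr_ge0.
move=> t x; have I2 := integrable_sconv mF FM t x tB.
apply: le_trans (le_normr_Rintegral _ I2) _ => //.
rewrite /c -(Rintegral_shift_rV (- x) I1); apply: le_Rintegral => //.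
- exact: integrable_norm.
- exact: (integrable_shift_rV (- x) I1).
move=> y _; rewrite normrM -mulrA; apply: ler_pM => //.
apply: le_trans (H _) _; rewrite ler_wpM2l// !indicE ler_nat.
case: (boolP (_ \in box r)) => // /set_mem h; rewrite mem_set//= => i.
by have := h i; rewrite !mxE distrC.
Qed.

Lemma conv_bounded a B : test1 a -> testB B -> exists C : R, 0 <= C /\
  forall t x, `|conv F a B t x| <= C.
Proof.
move=> ta tB; have [C [C0 HC]] := sconv_bounded tB.
have [A [q [A0 q0 HA]]] := test1_le_indic ta.
exists (C * A * (q + q)); split; first by rewrite !mulr_ge0// addr_ge0.
move=> t x; rewrite (conv_sconv mF FM _ _ ta tB).
have mV := measurable_sconv mF tB.
have ms : measurable_fun [set: measurableTypeR R] (fun s => sconv F B s x * a (t - s)).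
  apply: measurable_funM.
    exact: (@measurable_fun_pair1 _ _ _ _ _ _ (fun p : RV => sconv F B p.1 p.2) x mV).
  apply: (measurableT_comp (smooth1_measurable ta.1)); exact: measurable_funB.
have le1 s : `|sconv F B s x * a (t - s)| <= C * A * \1_(`[t - q, t + q]%classic) s.
  rewrite normrM -mulrA; apply: ler_pM => //; apply: le_trans (HA _) _.
  rewrite ler_wpM2l// !indicE ler_nat; case: (boolP (_ \in _)) => // /set_mem.
  rewrite /= in_itv/= => h; rewrite mem_set//= in_itv/=; lra.
have I1 := @integrable_indic_itv R (t - q) (t + q) true false.
have I2 : leb.-integrable setT (EFin \o (fun s => C * A * \1_(`[t - q, t + q]%classic) s)).
  exact: intgZ.
have I3 := le_intg ms I2 le1.
apply: le_trans (le_normr_Rintegral _ I3) _ => //.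
apply: le_trans (le_Rintegral measurableT (integrable_norm I3) I2 (fun s _ => le1 s)) _.
rewrite RintegralZl// ler_wpM2l ?mulr_ge0// /Rintegral integral_indic// setIT.
rewrite (_ : fine _ = q + q)//; transitivity (fine (q + q)%:E) => //; congr fine.
apply: (eq_trans (lebesgue_measure_itv `[t - q, t + q])) => /=.
rewrite lte_fin; case: ifPn => [_|]; first by rewrite -EFinB; congr EFin; lra.
by rewrite -leNgt => h; congr EFin; lra.
Qed.

End fixed_function.

End convolution_estimates.

(** * The localised energy of smooth functions *)

Section bounded_measurable.
Context {R : realType} {n : nat}.
Local Notation mu := (@lebesgue_rV R n).
Implicit Types f g : R -> 'rV[R]_n -> R.

(** A class stable under sums and products whose boxed members are integrable; it settles the
    integrability conditions of the energy identity. *)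
Definition ubm f := (forall t, measurable_fun setT (f t)) /\
  exists C : R, forall t x, `|f t x| <= C.

Lemma ubm_cst (c : R) : ubm (fun _ _ => c).
Proof. by split; [move=> t; exact: measurable_cst|exists `|c|]. Qed.

Lemma ubmD f g : ubm f -> ubm g -> ubm (fun t x => f t x + g t x).
Proof.
move=> [mf [C fC]] [mg [E gE]]; split; first by move=> t; exact: measurable_funD.
by exists (C + E) => t x; apply: le_trans (ler_normD _ _) _; exact: lerD.
Qed.

Lemma ubmN f : ubm f -> ubm (fun t x => - f t x).
Proof.
move=> [mf [C fC]]; split; first by move=> t; exact: measurable_funN.
by exists C => t x; rewrite normrN.
Qed.

Lemma ubmB f g : ubm f -> ubm g -> ubm (fun t x => f t x - g t x).
Proof. by move=> bf bg; apply: ubmD => //; exact: ubmN. Qed.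

Lemma ubmM f g : ubm f -> ubm g -> ubm (fun t x => f t x * g t x).
Proof.
move=> [mf [C fC]] [mg [E gE]]; split; first by move=> t; exact: measurable_funM.
by exists (C * E) => t x; rewrite normrM ler_pM.
Qed.

Lemma ubm_sum m (f : 'I_m -> R -> 'rV[R]_n -> R) :
  (forall i, ubm (f i)) -> ubm (fun t x => \sum_(i < m) f i t x).
Proof.
move=> bf; elim: (index_enum _) => [|i s IH].
  rewrite (_ : (fun _ _ => _) = (fun _ _ => 0)); first exact: ubm_cst.
  by apply/funext => t; apply/funext => x; rewrite big_nil.
rewrite (_ : (fun _ _ => _) = (fun t x => f i t x + \sum_(j <- s) f j t x)).
  exact: ubmD.
by apply/funext => t; apply/funext => x; rewrite big_cons.
Qed.

Lemma ubm_integrable r f t : ubm f -> boxed r (f t) ->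
  mu.-integrable setT (EFin \o f t).
Proof. by move=> [mf [C fC]] bf; exact: (boxed_integrable (mf t) bf (fC t)). Qed.

End bounded_measurable.

Lemma Rintegral_sumf {R : realType} d {T : measurableType d} (m : {measure set T -> \bar R})
    k (f : 'I_k -> T -> R) : (forall i, m.-integrable setT (EFin \o f i)) ->
  \int[m]_x (\sum_(i < k) f i x) = \sum_(i < k) \int[m]_x f i x.
Proof.
move=> fi; elim: (index_enum _) => [|i s IH].
  by under eq_Rintegral do rewrite big_nil; rewrite big_nil /Rintegral integral0.
under eq_Rintegral do rewrite big_cons.
by rewrite big_cons RintegralD// ?IH//; exact: intg_sum.
Qed.

(** Cauchy-Schwarz; it bounds the squared Laplacian by the squares of the pure second
    derivatives. *)
Lemma sqr_sum_le {R : realDomainType} m (x : 'I_m -> R) :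
  (\sum_(i < m) x i) ^+ 2 <= m%:R * \sum_(i < m) x i ^+ 2.
Proof.
elim: m x => [|m IH] x; first by rewrite !big_ord0 expr0n mulr0.
rewrite !big_ord_recr/= -natr1; have := IH (fun i => x (widen_ord (leqnSn m) i)).
set S := \sum_(i < m) _; set T := \sum_(i < m) _; set b := x ord_max => h.
have : 2 * S * b <= T + m%:R * b ^+ 2.
  have -> : m%:R * b ^+ 2 = \sum_(i < m) b ^+ 2 by rewrite sumr_const card_ord mulr_natl.
  rewrite -big_split/= -mulrA mulr_suml mulr_sumr.
  by apply: ler_sum => i _; have := sqr_ge0 (x (widen_ord (leqnSn m) i) - b); rewrite !expr2; nra.
move: h; rewrite !expr2; nra.
Qed.

Lemma is_derive_sumf {R : realType} {V : normedModType R} m (h : 'I_m -> V -> R)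
    (dh : 'I_m -> R) (x v : V) : (forall i, is_derive x v (h i) (dh i)) ->
  is_derive x v (fun y => \sum_(i < m) h i y) (\sum_(i < m) dh i).
Proof.
move=> hd; rewrite (_ : (fun y => _) = \sum_(i < m) h i); first exact: is_derive_sum.
by apply/funext => y; rewrite fct_sumE.
Qed.

Section jets.
Context {R : realType} {n : nat}.
Implicit Types f : R -> 'rV[R]_n -> R.

(** The derivatives that the energy identity involves. [ftj] is at once the time derivative of [fj]
    and the space derivative of [ft], so that mixed derivatives commute. *)
Record jet f (ft : R -> 'rV[R]_n -> R) (fj fjj ftj : 'I_n -> R -> 'rV[R]_n -> R) : Prop := Jet {
  jet_b : ubm f; jet_tb : ubm ft; jet_jb : forall j, ubm (fj j);
  jet_jjb : forall j, ubm (fjj j); jet_tjb : forall j, ubm (ftj j);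
  jet_t : forall (t : R) x, is_derive t 1 (f ^~ x) (ft t x);
  jet_jt : forall j (t : R) x, is_derive t 1 (fj j ^~ x) (ftj j t x);
  jet_j : forall j t x, is_derive x (ebase j) (f t) (fj j t x);
  jet_jj : forall j t x, is_derive x (ebase j) (fj j t) (fjj j t x);
  jet_tj : forall j t x, is_derive x (ebase j) (ft t) (ftj j t x) }.

End jets.

(** * The localised energy identity and the bound on its right-hand side *)

Section energy_identity.
Context {R : realType} {n : nat}.
Local Notation mu := (@lebesgue_rV R n).
Variables (P Pt Q Qt : R -> 'rV[R]_n -> R) (Pj Pjj Ptj Qj Qjj Qtj : 'I_n -> R -> 'rV[R]_n -> R).
Hypotheses (jP : jet P Pt Pj Pjj Ptj) (jQ : jet Q Qt Qj Qjj Qtj).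
Variables (eta : 'rV[R]_n -> R) (etaj : 'I_n -> 'rV[R]_n -> R) (r : R).
Hypotheses (eta_b : ubm (fun=> eta)) (etaj_b : forall j, ubm (fun=> etaj j))
  (eta_box : boxed r eta)
  (eta_d : forall j x, is_derive x (ebase j) eta (etaj j x)).

Definition defect t x := 1 - P t x * P t x - Q t x * Q t x.

Definition loc_density t x :=
  2^-1 * \sum_(j < n) (Pj j t x * Pj j t x + Qj j t x * Qj j t x) +
  4^-1 * (defect t x * defect t x).

Definition loc_energy t := \int[mu]_x (eta x * eta x * loc_density t x).

(** For [u = P + iQ], [rem1] and [rem2] are the opposites of the real and imaginary parts of
    [i u_t + Delta u + u (1 - |u|^2)]. *)
Definition rem1 t x := Qt t x - \sum_(j < n) Pjj j t x - P t x * defect t x.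
Definition rem2 t x := - Pt t x - \sum_(j < n) Qjj j t x - Q t x * defect t x.

Definition loc_rate t x :=
  eta x * eta x * (rem1 t x * Pt t x + rem2 t x * Qt t x) -
  2 * eta x * \sum_(j < n) etaj j x * (Pj j t x * Pt t x + Qj j t x * Qt t x).

(** The time derivative of the integrand, before any integration by parts. *)
Let rate0 t x := eta x * eta x *
  (\sum_(j < n) (Pj j t x * Ptj j t x + Qj j t x * Qtj j t x) -
   defect t x * (P t x * Pt t x + Q t x * Qt t x)).

Let ubm_defect : ubm defect.
Proof.
have bP := jet_b jP; have bQ := jet_b jQ.
by do !apply: ubmB; [exact: ubm_cst|exact: ubmM|exact: ubmM].
Qed.

Let ubm_density : ubm loc_density.
Proof.
apply: ubmD; apply: ubmM; [exact: ubm_cst| |exact: ubm_cst|exact: ubmM].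
apply: ubm_sum => j; have bP := jet_jb jP j; have bQ := jet_jb jQ j.
by apply: ubmD; exact: ubmM.
Qed.

Let ubm_rate0 : ubm rate0.
Proof.
apply: (@ubmM _ _ (fun t x => eta x * eta x)); first exact: (ubmM eta_b eta_b).
have bP := jet_b jP; have bQ := jet_b jQ; have bPt := jet_tb jP; have bQt := jet_tb jQ.
apply: ubmB.
  apply: ubm_sum => j; have := jet_jb jP j; have := jet_jb jQ j.
  have := jet_tjb jP j; have := jet_tjb jQ j => *.
  by apply: ubmD; exact: ubmM.
by apply: ubmM => //; apply: ubmD; exact: ubmM.
Qed.

Let defect_dt (t : R) x : is_derive t 1 (defect ^~ x) (- 2 * (P t x * Pt t x + Q t x * Qt t x)).
Proof.
have dP := jet_t jP t x; have dQ := jet_t jQ t x.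
have -> : defect ^~ x = cst 1 \- (P ^~ x \* P ^~ x) \- (Q ^~ x \* Q ^~ x) by [].
by apply: is_derive_eq; rewrite /GRing.scale/=; ring.
Qed.

Let density_dt (t : R) x : is_derive t 1 (fun t => eta x * eta x * loc_density t x) (rate0 t x).
Proof.
have dW := defect_dt t x.
have dS : is_derive t 1
   (fun t => \sum_(j < n) (Pj j t x * Pj j t x + Qj j t x * Qj j t x))
   (2 * \sum_(j < n) (Pj j t x * Ptj j t x + Qj j t x * Qtj j t x)).
  rewrite mulr_sumr; apply: is_derive_sumf => j.
  have dP := jet_jt jP j t x; have dQ := jet_jt jQ j t x.
  have -> : (fun t => Pj j t x * Pj j t x + Qj j t x * Qj j t x) =
    (Pj j ^~ x \* Pj j ^~ x) \+ (Qj j ^~ x \* Qj j ^~ x) by [].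
  by apply: is_derive_eq; rewrite /GRing.scale/=; ring.
have -> : (fun t => eta x * eta x * loc_density t x) = (eta x * eta x) \*:
   ((2^-1 \*: (fun t => \sum_(j < n) (Pj j t x * Pj j t x + Qj j t x * Qj j t x))) \+
    (4^-1 \*: (defect ^~ x \* defect ^~ x))) by [].
by apply: is_derive_eq; rewrite /rate0 /GRing.scale/=; field.
Qed.

Let loc_energy_dt0 (t : R) : is_derive t 1 loc_energy (\int[mu]_x rate0 t x).
Proof.
have [_ [C HC]] := ubm_rate0.
apply: (@Rintegral_is_derive _ _ _ mu (fun t x => eta x * eta x * loc_density t x) rate0 t
  (fun x => C * \1_(box r) x)).
- move=> t'; apply: (@ubm_integrable _ _ r (fun t x => eta x * eta x * loc_density t x)).
    by apply: (@ubmM _ _ (fun t x => eta x * eta x)) => //; exact: (ubmM eta_b eta_b).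
  by do 2 apply: boxedM.
- by move=> t' x; exact: density_dt.
- exact/intgZ/integrable_box.
- move=> t' x _; apply: (boxed_le_indic _ (HC t')).
  by do 2 apply: boxedM.
Qed.

(** The energy flux in direction [j]. Its divergence has integral 0 and moves the space derivative
    off [Ptj] and [Qtj]. *)
Let flux j t x := eta x * eta x * (Pj j t x * Pt t x + Qj j t x * Qt t x).

Let dflux j t x := 2 * eta x * (etaj j x * (Pj j t x * Pt t x + Qj j t x * Qt t x)) +
  eta x * eta x * (Pjj j t x * Pt t x + Pj j t x * Ptj j t x +
    (Qjj j t x * Qt t x + Qj j t x * Qtj j t x)).

Let flux_d j t x : is_derive x (ebase j) (flux j t) (dflux j t x).
Proof.
have d1 := jet_jj jP j t x; have d2 := jet_jj jQ j t x.
have d3 := jet_tj jP j t x; have d4 := jet_tj jQ j t x; have d5 := eta_d j x.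
have -> : flux j t = (eta \* eta) \* ((Pj j t \* Pt t) \+ (Qj j t \* Qt t)) by [].
by apply: is_derive_eq; rewrite /dflux /GRing.scale/=; ring.
Qed.

Let ubm_flux j : ubm (flux j) /\ ubm (dflux j).
Proof.
have bPt := jet_tb jP; have bQt := jet_tb jQ.
have bPj := jet_jb jP j; have bQj := jet_jb jQ j.
have bPjj := jet_jjb jP j; have bQjj := jet_jjb jQ j.
have bPtj := jet_tjb jP j; have bQtj := jet_tjb jQ j.
have bee : ubm (fun (t : R) x => eta x * eta x) by exact: (ubmM eta_b eta_b).
have bfl : ubm (fun t x => Pj j t x * Pt t x + Qj j t x * Qt t x).
  by apply: ubmD; exact: ubmM.
split; first exact: ubmM.
apply: ubmD.
  apply: (@ubmM _ _ (fun t x => 2 * eta x)); first exact: (ubmM (ubm_cst 2) eta_b).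
  exact: (ubmM (etaj_b j)).
by apply: ubmM => //; do 2 (apply: ubmD); exact: ubmM.
Qed.

Let boxed_dflux j t : boxed r (dflux j t).
Proof. by move=> x nx; rewrite /dflux eta_box// !(mulr0, mul0r) addr0. Qed.

Let integral_dflux j t : \int[mu]_x dflux j t x = 0.
Proof.
have [[mf [C fC]] [mdf [C' fC']]] := ubm_flux j.
apply: (integral_pderiv_eq0 (r := r) (mf t) (mdf t) (fun x => flux_d j t x) _ _ (fC t) (fC' t)).
  by do 2 apply: boxedM.
exact: boxed_dflux.
Qed.

(** [loc_rate] is [rate0] minus the divergence of [flux]. When the Laplacians are expressed by the
    residuals, the products [Pt * Qt] from the two components of the equation cancel: this is the
    cancellation behind the conservation law. *)
Lemma loc_energy_is_derive (t : R) : is_derive t 1 loc_energy (\int[mu]_x loc_rate t x).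
Proof.
suff -> : \int[mu]_x loc_rate t x = \int[mu]_x rate0 t x by exact: loc_energy_dt0.
have E x : loc_rate t x = rate0 t x - \sum_(j < n) dflux j t x.
  have -> : \sum_(j < n) dflux j t x =
    2 * eta x * (\sum_(j < n) etaj j x * (Pj j t x * Pt t x + Qj j t x * Qt t x)) +
    eta x * eta x * ((\sum_(j < n) Pjj j t x) * Pt t x + (\sum_(j < n) Qjj j t x) * Qt t x +
      \sum_(j < n) (Pj j t x * Ptj j t x + Qj j t x * Qtj j t x)).
    rewrite !mulr_suml -!big_split/= !mulr_sumr -big_split/=.
    by apply: eq_bigr => j _; rewrite /dflux; ring.
  by rewrite /loc_rate /rate0 /rem1 /rem2; ring.
have bdf j : mu.-integrable setT (EFin \o dflux j t).
  by apply: (ubm_integrable (ubm_flux j).2); exact: boxed_dflux.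
have i0 : mu.-integrable setT (EFin \o rate0 t).
  by apply: (ubm_integrable (r := r) ubm_rate0); do 2 apply: boxedM.
under eq_Rintegral => x _ do rewrite E.
rewrite RintegralB//; last exact: intg_sum.
by rewrite Rintegral_sumf// big1 ?subr0// => j _; exact: integral_dflux.
Qed.

Lemma loc_density_ge0 t x : 0 <= loc_density t x.
Proof.
by rewrite addr_ge0// mulr_ge0// ?sumr_ge0// -?expr2 ?sqr_ge0// => j _; rewrite addr_ge0// -expr2 sqr_ge0.
Qed.

Lemma loc_energy_ge0 t : 0 <= loc_energy t.
Proof.
by apply: Rintegral_ge0 => x _; rewrite mulr_ge0 ?loc_density_ge0// -expr2 sqr_ge0.
Qed.

Lemma integrable_loc_energy t :
  mu.-integrable setT (EFin \o (fun x => eta x * eta x * loc_density t x)).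
Proof.
apply: (@ubm_integrable _ _ r (fun t x => eta x * eta x * loc_density t x)).
  by apply: (@ubmM _ _ (fun t x => eta x * eta x)) => //; exact: (ubmM eta_b eta_b).
by do 2 apply: boxedM.
Qed.

Let ubm_rate : ubm loc_rate.
Proof.
have bP := jet_b jP; have bQ := jet_b jQ; have bPt := jet_tb jP; have bQt := jet_tb jQ.
have bW := ubm_defect.
have b1 : ubm rem1.
  by apply: ubmB; [apply: ubmB => //; apply: ubm_sum => j; exact: (jet_jjb jP)|exact: ubmM].
have b2 : ubm rem2.
  apply: ubmB; [apply: ubmB; [exact: ubmN|]|exact: ubmM].
  by apply: ubm_sum => j; exact: (jet_jjb jQ).
apply: ubmB.
  apply: (@ubmM _ _ (fun t x => eta x * eta x)); first exact: (ubmM eta_b eta_b).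
  by apply: ubmD; exact: ubmM.
apply: (@ubmM _ _ (fun t x => 2 * eta x)); first exact: (ubmM (ubm_cst 2) eta_b).
apply: ubm_sum => j; apply: (ubmM (etaj_b j)); have := jet_jb jP j; have := jet_jb jQ j => *.
by apply: ubmD; exact: ubmM.
Qed.

Section rate_bound.
Variables (t c w M K : R).
Hypotheses (eta01 : forall x, 0 <= eta x <= 1) (etajc : forall j x, `|etaj j x| <= c)
  (PM : forall x, `|P t x| <= M) (QM : forall x, `|Q t x| <= M)
  (r1w : forall x, `|rem1 t x| <= w) (r2w : forall x, `|rem2 t x| <= w)
  (wc : w <= c) (c1 : c <= 1) (wV : w * (\int[mu]_x (eta x * eta x)) <= c)
  (PjK : forall j, (\int[mu]_x (Pj j t x ^+ 2)%:E <= K%:E)%E)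
  (QjK : forall j, (\int[mu]_x (Qj j t x ^+ 2)%:E <= K%:E)%E)
  (PjjK : forall j, (\int[mu]_x (Pjj j t x ^+ 2)%:E <= K%:E)%E)
  (QjjK : forall j, (\int[mu]_x (Qjj j t x ^+ 2)%:E <= K%:E)%E).

(** Besides the leading 1 from the residuals, [6 n^2 K] comes from the second derivatives, [24 M^2]
    from the cubic term (the squared defect being at most four times the energy density), 6 from the
    squared residuals and [2 n K] from the gradients. *)
Definition rate_const : R :=
  1 + n.+1%:R * (6 * n%:R ^+ 2 * K + 24 * M ^+ 2 + 6) + 2 * n%:R * K.

Let w0 : 0 <= w. Proof. exact: le_trans (r1w 0). Qed.
Let c0 : 0 <= c. Proof. exact: le_trans wc. Qed.

(** The equation eliminates the time derivatives: up to sign each is a Laplacian plus a cubic term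
    plus a residual, and the square of three terms is at most three times the sum of their squares.
    One factor of the cubic term is bounded by [M]; the defect is kept, since the energy controls
    it. *)
Let time_sqr_le x : eta x * eta x * (Pt t x ^+ 2 + Qt t x ^+ 2) <=
  3 * n%:R * (\sum_(j < n) (Pjj j t x ^+ 2 + Qjj j t x ^+ 2)) +
  6 * M ^+ 2 * (eta x * eta x * (defect t x * defect t x)) + 6 * w ^+ 2 * (eta x * eta x).
Proof.
have key (y S V W rr : R) : y = - (S + V * W + rr) -> `|V| <= M -> `|rr| <= w ->
   y ^+ 2 <= 3 * S ^+ 2 + 3 * M ^+ 2 * (W * W) + 3 * w ^+ 2.
  move=> -> VM rw.
  have h1 : V ^+ 2 <= M ^+ 2 by rewrite -(real_normK (num_real V)) ler_sqr ?nnegrE// (le_trans _ VM).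
  have h2 : rr ^+ 2 <= w ^+ 2 by rewrite -(real_normK (num_real rr)) ler_sqr ?nnegrE.
  have h3 : V ^+ 2 * (W * W) <= M ^+ 2 * (W * W) by rewrite ler_wpM2r// -expr2 sqr_ge0.
  have h4 := sqr_ge0 (S - V * W); have h5 := sqr_ge0 (S - rr); have h6 := sqr_ge0 (V * W - rr).
  move: h1 h2 h3 h4 h5 h6; rewrite !expr2; nra.
have kP := key (Pt t x) (\sum_(j < n) Qjj j t x) (Q t x) (defect t x) (rem2 t x) _ (QM x) (r2w x).
have kQ := key (- Qt t x) (\sum_(j < n) Pjj j t x) (P t x) (defect t x) (rem1 t x) _ (PM x) (r1w x).
have {}kP := kP ltac:(rewrite /rem2; ring); have {kQ} := kQ ltac:(rewrite /rem1; ring).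
rewrite sqrrN => kQ.
have sP := sqr_sum_le (fun j => Pjj j t x); have sQ := sqr_sum_le (fun j => Qjj j t x).
have /andP[e0 e1] := eta01 x; have ee0 : 0 <= eta x * eta x by rewrite mulr_ge0.
have ee1 : eta x * eta x <= 1 by rewrite mulr_ile1.
have s1 : 0 <= \sum_(j < n) Pjj j t x ^+ 2 by apply: sumr_ge0 => j _; exact: sqr_ge0.
have s2 : 0 <= \sum_(j < n) Qjj j t x ^+ 2 by apply: sumr_ge0 => j _; exact: sqr_ge0.
have := ler_wpM2l ee0 (lerD kP kQ).
have h1 : eta x * eta x * (n%:R * (\sum_(j < n) Pjj j t x ^+ 2) + n%:R * (\sum_(j < n) Qjj j t x ^+ 2)) <=
  n%:R * (\sum_(j < n) Pjj j t x ^+ 2) + n%:R * (\sum_(j < n) Qjj j t x ^+ 2).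
  by rewrite ler_piMl// addr_ge0// mulr_ge0.
have h2 := ler_wpM2l ee0 (lerD sP sQ).
rewrite big_split/=; move: h1 h2; nra.
Qed.

Let rate_le x : `|loc_rate t x| <=
  (w + n.+1%:R * c * (6 * w ^+ 2)) * (eta x * eta x) +
  n.+1%:R * c * (6 * M ^+ 2) * (eta x * eta x * (defect t x * defect t x)) +
  n.+1%:R * c * (3 * n%:R) * (\sum_(j < n) (Pjj j t x ^+ 2 + Qjj j t x ^+ 2)) +
  c * (\sum_(j < n) (Pj j t x ^+ 2 + Qj j t x ^+ 2)).
Proof.
have /andP[e0 e1] := eta01 x; have ee0 : 0 <= eta x * eta x by rewrite mulr_ge0.
have Y := time_sqr_le x.
have h1 : `|eta x * eta x * (rem1 t x * Pt t x + rem2 t x * Qt t x)| <=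
   w * (eta x * eta x) + w * (eta x * eta x * (Pt t x ^+ 2 + Qt t x ^+ 2)).
  rewrite normrM ger0_norm//.
  have -> : w * (eta x * eta x) + w * (eta x * eta x * (Pt t x ^+ 2 + Qt t x ^+ 2)) =
     eta x * eta x * (w * (1 + Pt t x ^+ 2 + Qt t x ^+ 2)) by ring.
  rewrite ler_wpM2l//; apply: le_trans (ler_normD _ _) _; rewrite !normrM.
  apply: le_trans (lerD (ler_wpM2r (normr_ge0 _) (r1w x)) (ler_wpM2r (normr_ge0 _) (r2w x))) _.
  rewrite -mulrDr ler_wpM2l// -!(real_normK (num_real (_ t x))).
  have := sqr_ge0 (`|Pt t x| - 1); have := sqr_ge0 (`|Qt t x| - 1).
  have := normr_ge0 (Pt t x); have := normr_ge0 (Qt t x); rewrite !expr2; nra.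
have h2 : `|2 * eta x * \sum_(j < n) etaj j x * (Pj j t x * Pt t x + Qj j t x * Qt t x)| <=
   c * (\sum_(j < n) (Pj j t x ^+ 2 + Qj j t x ^+ 2)) +
   n%:R * c * (eta x * eta x * (Pt t x ^+ 2 + Qt t x ^+ 2)).
  have -> : n%:R * c * (eta x * eta x * (Pt t x ^+ 2 + Qt t x ^+ 2)) =
     \sum_(j < n) (c * (eta x * eta x * (Pt t x ^+ 2 + Qt t x ^+ 2))).
    by rewrite sumr_const card_ord -mulrA mulr_natl.
  rewrite !mulr_sumr -big_split/=; apply: le_trans (ler_norm_sum _ _ _) _.
  apply: ler_sum => j _; rewrite mulrCA normrM -mulrDr.
  apply: ler_pM => //; rewrite mulrDr; apply: le_trans (ler_normD _ _) _.
  (* The weight is split unevenly: the gradient, globally square integrable, carries none, and the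
     time derivative carries [eta^2], as [time_sqr_le] requires. *)
  have kk (a b : R) : `|2 * eta x * (a * b)| <= a ^+ 2 + eta x * eta x * b ^+ 2.
    by rewrite ler_norml; have := sqr_ge0 (a - eta x * b); have := sqr_ge0 (a + eta x * b);
       rewrite !expr2; nra.
  by have := kk (Pj j t x) (Pt t x); have := kk (Qj j t x) (Qt t x); lra.
apply: le_trans (ler_normB _ _) _; apply: le_trans (lerD h1 h2) _.
set T := eta x * eta x * (Pt t x ^+ 2 + _) in Y *.
have T0 : 0 <= T by rewrite mulr_ge0// addr_ge0 ?sqr_ge0.
(* As [w <= c], the residual term is absorbed as the extra unit in [n.+1]. *)
have h3 : w * T + n%:R * c * T <= n.+1%:R * c * T.
  by rewrite -natr1 mulrDl mul1r mulrDl; have := ler_wpM2r T0 wc; lra.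
have h4 := ler_wpM2l (mulr_ge0 (ler0n R n.+1) c0) Y.
set S := \sum_(j < n) (Pj j t x ^+ 2 + _); set S2 := \sum_(j < n) (Pjj j t x ^+ 2 + _) in h4 *.
move: h3 h4; set ND := n.+1%:R; lra.
Qed.

Let sqr_intg (f : 'rV[R]_n -> R) : measurable_fun setT f ->
  (\int[mu]_x (f x ^+ 2)%:E <= K%:E)%E ->
  mu.-integrable setT (EFin \o (fun x => f x ^+ 2)) /\ \int[mu]_x (f x ^+ 2) <= K.
Proof.
move=> mf fK; have fi : mu.-integrable setT (EFin \o (fun x => f x ^+ 2)).
  apply/integrableP; split; first by apply/measurable_EFinP; exact: measurable_funX.
  under eq_integral do rewrite /= ger0_norm ?sqr_ge0//.
  exact: le_lt_trans fK (ltry _).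
by split => //; rewrite -lee_fin EFin_Rintegral.
Qed.

Let sum_sqr_intg (f g : 'I_n -> 'rV[R]_n -> R) :
  (forall j, measurable_fun setT (f j)) -> (forall j, measurable_fun setT (g j)) ->
  (forall j, (\int[mu]_x (f j x ^+ 2)%:E <= K%:E)%E) ->
  (forall j, (\int[mu]_x (g j x ^+ 2)%:E <= K%:E)%E) ->
  mu.-integrable setT (EFin \o (fun x => \sum_(j < n) (f j x ^+ 2 + g j x ^+ 2))) /\
  \int[mu]_x (\sum_(j < n) (f j x ^+ 2 + g j x ^+ 2)) <= 2 * n%:R * K.
Proof.
move=> mf mg fK gK.
have fi j := sqr_intg (mf j) (fK j); have gi j := sqr_intg (mg j) (gK j).
have ii j : mu.-integrable setT (EFin \o (fun x => f j x ^+ 2 + g j x ^+ 2)).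
  by apply: intgD; [exact: (fi j).1|exact: (gi j).1].
split; first exact: intg_sum.
rewrite Rintegral_sumf//; apply: (@le_trans _ _ (\sum_(j < n) (K + K))).
  apply: ler_sum => j _; rewrite RintegralD//; [|exact: (fi j).1|exact: (gi j).1].
  by apply: lerD; [exact: (fi j).2|exact: (gi j).2].
by rewrite sumr_const card_ord -mulr_natl; lra.
Qed.

(** Integration of [rate_le]. Each term is a constant times [c], except the defect term, which is
    [c] times the localised energy; the common factor [c] is later of order [1/N]. *)
Lemma loc_rate_bound : `|\int[mu]_x loc_rate t x| <= c * rate_const * (1 + loc_energy t).
Proof.
have mPj j : measurable_fun setT (Pj j t) by case: (jet_jb jP j).
have mQj j : measurable_fun setT (Qj j t) by case: (jet_jb jQ j).
have mPjj j : measurable_fun setT (Pjj j t) by case: (jet_jjb jP j).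
have mQjj j : measurable_fun setT (Qjj j t) by case: (jet_jjb jQ j).
have [i4 b4] := sum_sqr_intg mPj mQj PjK QjK.
have [i3 b3] := sum_sqr_intg mPjj mQjj PjjK QjjK.
have bee : ubm (fun (t : R) x => eta x * eta x) by exact: (ubmM eta_b eta_b).
have i1 : mu.-integrable setT (EFin \o (fun x => eta x * eta x)).
  by apply: (@ubm_integrable _ _ r (fun=> (fun x => eta x * eta x)) 0 bee); exact: boxedM.
have i2 : mu.-integrable setT (EFin \o (fun x => eta x * eta x * (defect t x * defect t x))).
  apply: (@ubm_integrable _ _ r (fun t x => eta x * eta x * (defect t x * defect t x))).
    by apply: ubmM => //; exact: ubmM.
  by do 2 apply: boxedM.
have b2 : \int[mu]_x (eta x * eta x * (defect t x * defect t x)) <= 4 * loc_energy t.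
  rewrite /loc_energy -RintegralZl//; last exact: integrable_loc_energy.
  apply: le_Rintegral => //; first by apply: intgZ; exact: integrable_loc_energy.
  move=> x _; rewrite [leRHS]mulrCA ler_wpM2l -?expr2 ?sqr_ge0// /loc_density.
  have : 0 <= \sum_(j < n) (Pj j t x * Pj j t x + Qj j t x * Qj j t x).
    by apply: sumr_ge0 => j _; rewrite addr_ge0// -expr2 sqr_ge0.
  rewrite !expr2; lra.
have K0 : 0 <= 2 * n%:R * K.
  by apply: le_trans b4; apply: Rintegral_ge0 => x _; apply: sumr_ge0 => j _; rewrite addr_ge0 ?sqr_ge0.
have iR : mu.-integrable setT (EFin \o loc_rate t).
  apply: (le_intg _ _ rate_le); last first.
    by do 3 (apply: intgD; last exact: intgZ); exact: intgZ.
  by have [mR _] := ubm_rate; exact: mR.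
apply: le_trans (le_normr_Rintegral measurableT iR) _.
apply: le_trans (le_Rintegral measurableT (integrable_norm iR) _ (fun x _ => rate_le x)) _.
  by do 3 (apply: intgD; last exact: intgZ); exact: intgZ.
rewrite !RintegralD// ?RintegralZl//.
have e0 := loc_energy_ge0 t.
move: b2 b3 b4 wV.
set I1 := \int[mu]_x (eta x * eta x); set I2 := \int[mu]_x _; set I3 := \int[mu]_x _.
set I4 := \int[mu]_x _; set e := loc_energy t in e0 * => b2 b3 b4 wV'.
have ND0 : 0 <= n.+1%:R * c by rewrite mulr_ge0.
have h2 : n.+1%:R * c * (6 * w ^+ 2) * I1 <= n.+1%:R * c * 6.
  rewrite -mulrA ler_wpM2l// -mulrA -[leRHS]mulr1 ler_wpM2l// expr2 -mulrA.
  apply: le_trans (ler_wpM2l w0 wV') _; rewrite mulr_ile1//; exact: le_trans c1.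
have h3 := ler_wpM2l (mulr_ge0 ND0 (mulr_ge0 (ler0n R 6) (sqr_ge0 M))) b2.
have h4 := ler_wpM2l (mulr_ge0 ND0 (mulr_ge0 (ler0n R 3) (ler0n R n))) b3.
have h5 := ler_wpM2l c0 b4.
have n2K : 0 <= n%:R ^+ 2 * K.
  by have := mulr_ge0 (ler0n R n) K0; rewrite expr2; lra.
have p1 : 0 <= c * e * (1 + n.+1%:R * (6 * (n%:R ^+ 2 * K) + 6) + 2 * n%:R * K).
  rewrite mulr_ge0 ?mulr_ge0// addr_ge0// addr_ge0// mulr_ge0// addr_ge0// mulr_ge0//.
have p2 : 0 <= n.+1%:R * c * (24 * M ^+ 2) by rewrite mulr_ge0// mulr_ge0// sqr_ge0.
move: h2 h3 h4 h5 p1 p2 wV'; rewrite /rate_const; set ND := n.+1%:R; set nn := n%:R.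
move=> h2 h3 h4 h5 p1 p2 wV'.
(* The right-hand side splits into the bounds already obtained and two nonnegative leftovers, [p1]
   and [p2]. *)
rewrite (_ : c * _ * (1 + e) = c + ND * c * 6 + ND * c * (6 * M ^+ 2) * (4 * e) +
   ND * c * (3 * nn) * (2 * nn * K) + c * (2 * nn * K) +
   c * e * (1 + ND * (6 * (nn ^+ 2 * K) + 6) + 2 * nn * K) + ND * c * (24 * M ^+ 2)); last by ring.
by rewrite mulrDl; lra.
all: try by do 3 (apply: intgD; last exact: intgZ); exact: intgZ.
all: try by do 2 (apply: intgD; last exact: intgZ); exact: intgZ.
all: try by (apply: intgD; last exact: intgZ); exact: intgZ.
all: exact: intgZ.
Qed.

End rate_bound.

End energy_identity.

(** * Gronwall's inequality in both time directions *)

Section gronwall.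
Context {R : realType}.

(** The function [f u * exp(- b u)] has nonpositive derivative on [[s, t]]. *)
Lemma exp_bound (f f' : R -> R) (b s t : R) : s <= t -> 0 <= b ->
  (forall u : R, is_derive u 1 f (f' u)) -> (forall u, s <= u <= t -> f' u <= b * f u) ->
  f t <= f s * expR (b * (t - s)).
Proof.
move=> st b0 df fb; pose g u := f u * expR (- b * u).
have dg (u : R) : is_derive u 1 g ((f' u - b * f u) * expR (- b * u)).
  have d0 := df u.
  have d1 : is_derive u 1 (fun u => - b * u) (- b).
    have -> : (fun u : R => - b * u) = - b \*: id by [].
    by apply: is_derive_eq; rewrite /GRing.scale/= mulr1.
  have d2 : is_derive u 1 (expR \o (fun u => - b * u)) (expR (- b * u) * - b).
    exact: is_derive1_comp.
  have -> : g = f \* (expR \o (fun u => - b * u)) by [].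
  by apply: is_derive_eq; rewrite /GRing.scale/=; ring.
have cg u : {for u, continuous g}.
  by apply/differentiable_continuous/derivable1_diffP; have [] := dg u.
have : g t <= g s.
  apply: (@ler0_derive1_le_cc _ g s t) => //.
  - move=> u; rewrite in_itv/= => /andP[su ut].
    rewrite derive1E (@derive_val _ _ _ _ _ _ _ (dg u)).
    by rewrite mulr_le0_ge0 ?expR_ge0// subr_le0 fb// (ltW su) ltW.
  - by apply: continuous_subspaceT => u; exact: cg.
  - by rewrite in_itv/= lexx andbT.
  - by rewrite in_itv/= lexx.
rewrite /g; have E : expR (- b * t) * expR (b * t) = 1 by rewrite -expRD mulNr addNr expR0.
move=> /(ler_wpM2r (expR_ge0 (b * t))); rewrite -mulrA E mulr1 => /le_trans; apply.
by rewrite -mulrA -expRD (_ : - b * s + b * t = b * (t - s)) ?lexx//; ring.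
Qed.

(** As the absolute value of the derivative is bounded, the backward estimate is the forward one for
    [f (- u)]. *)
Lemma exp_bound_sym (f f' : R -> R) (b s t : R) : 0 <= b ->
  (forall u : R, is_derive u 1 f (f' u)) ->
  (forall u, Num.min s t <= u <= Num.max s t -> `|f' u| <= b * f u) ->
  f t <= f s * expR (b * `|t - s|).
Proof.
move=> b0 df fb; have [st|/ltW ts] := leP s t.
  rewrite ger0_norm ?subr_ge0//; apply: (exp_bound st b0 df) => u su.
  by apply: le_trans (ler_norm _) (fb u _); rewrite min_l// max_r.
rewrite distrC ger0_norm ?subr_ge0//.
have dN (u : R) : is_derive u 1 (fun u => f (- u)) (- f' (- u)).
  have d0 := df (- u).
  have h : is_derive u 1 (f \o -%R) (f' (- u) * - 1) by exact: is_derive1_comp.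
  by rewrite -[- f' _]mulrN1.
have := @exp_bound (fun u => f (- u)) (fun u => - f' (- u)) b (- s) (- t) _ b0 dN _.
rewrite !opprK [- t + s]addrC; apply; first by rewrite lerN2.
move=> u su; apply: le_trans (ler_norm _) _; rewrite normrN; apply: fb.
by rewrite min_r// max_l//; lra.
Qed.

End gronwall.

(** * Density of tensor products *)

Section dominated.
Context {R : realType} d {T : measurableType d} (m : {measure set T -> \bar R}).

Lemma Rintegral_dominated_cvg (f_ : nat -> T -> R) (f g : T -> R) :
  (forall k, measurable_fun setT (f_ k)) -> m.-integrable setT (EFin \o g) ->
  (forall x, f_ ^~ x @ \oo --> f x) -> (forall k x, `|f_ k x| <= g x) ->
  (fun k => \int[m]_x f_ k x) @ \oo --> \int[m]_x f x.
Proof.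
move=> mf_ gi ff fg.
have mf : measurable_fun setT f by apply: (measurable_fun_cvg mf_) => x _; exact: ff.
have [] := @dominated_convergence _ _ _ m setT measurableT (fun k => EFin \o f_ k) (EFin \o f) (EFin \o g).
- by move=> k; exact/measurable_EFinP.
- exact/measurable_EFinP.
- apply: nearW => x _; apply: cvg_EFin; first exact: nearW.
  exact: ff.
- exact: gi.
- by apply: nearW => x k _ /=; rewrite lee_fin.
move=> fi _ h; apply: fine_cvg; rewrite fineK//.
exact: integrable_fin_num.
Qed.

End dominated.

Section span.
Context {R : realType} {n : nat}.
Implicit Types (f g : 'rV[R]_n -> R) (B : 'I_n -> R -> R).
Local Notation mu := (@lebesgue_rV R n).

(** By [spanM] this is an algebra, so it contains every polynomial without constant term in one of
    its elements; indicators of boxes are approximated in this way. *)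
Inductive span : ('rV[R]_n -> R) -> Prop :=
| span_tensor B : testB B -> span (tensor B)
| span0 : span (fun=> 0)
| spanD f g : span f -> span g -> span (fun x => f x + g x)
| spanZ (c : R) f : span f -> span (fun x => c * f x).

Lemma spanM f g : span f -> span g -> span (fun x => f x * g x).
Proof.
move=> sf; elim: sf g => {f} [B tB|g _|f1 f2 _ IH1 _ IH2 g sg|c f _ IH g sg].
- move=> g; elim => {g} [C tC||f1 f2 _ IH1 _ IH2|c f _ IH].
  + have -> : (fun x => tensor B x * tensor C x) =
      tensor (fun i t => B i t * C i t).
      by apply/funext => x; rewrite /tensor big_split.
    by apply: span_tensor => i; apply: test1M => //; case: (tC i).
  + by under eq_fun do rewrite mulr0; exact: span0.
  + by under eq_fun do rewrite mulrDr; exact: spanD.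
  + by under eq_fun do rewrite mulrCA; exact: spanZ.
- by under eq_fun do rewrite mul0r; exact: span0.
- by under eq_fun do rewrite mulrDl; apply: spanD; [exact: IH1|exact: IH2].
- by under eq_fun do rewrite -mulrA; apply: spanZ; exact: IH.
Qed.

Lemma spanB f g : span f -> span g -> span (fun x => f x - g x).
Proof.
move=> sf sg; have := spanD sf (spanZ (-1) sg); congr span.
by apply/funext => x; rewrite mulN1r.
Qed.

Definition bmf f := measurable_fun setT f /\ exists C : R, forall x, `|f x| <= C.

Lemma bmfD f g : bmf f -> bmf g -> bmf (fun x => f x + g x).
Proof.
move=> [mf [C fC]] [mg [E gE]]; split; first exact: measurable_funD.
by exists (C + E) => x; apply: le_trans (ler_normD _ _) _; exact: lerD.
Qed.

Lemma bmfM f g : bmf f -> bmf g -> bmf (fun x => f x * g x).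
Proof.
move=> [mf [C fC]] [mg [E gE]]; split; first exact: measurable_funM.
by exists (C * E) => x; rewrite normrM ler_pM.
Qed.

Lemma bmf_sqr f : bmf f -> bmf (fun x => f x ^+ 2).
Proof. by move=> bf; under eq_fun do rewrite expr2; exact: bmfM. Qed.

Lemma bmf_cst (c : R) : bmf (fun=> c).
Proof. by split; [exact: measurable_cst|exists `|c|]. Qed.

Lemma bmfZ (c : R) f : bmf f -> bmf (fun x => c * f x).
Proof. by move=> bf; exact: (bmfM (bmf_cst c)). Qed.

Lemma bmfB f g : bmf f -> bmf g -> bmf (fun x => f x - g x).
Proof.
move=> bf bg; have := bmfD bf (bmfZ (-1) bg); congr bmf.
by apply/funext => x; rewrite mulN1r.
Qed.

Lemma bmf_tensor B : testB B -> bmf (tensor B).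
Proof.
move=> tB; split; first by apply: measurable_tensor; exact: testB_measurable.
have [C [r [C0 _ H]]] := testB_le tB; exists C => x; apply: le_trans (H x) _.
by rewrite indicE -[leRHS]mulr1 ler_wpM2l// lern1; case: (_ \in _).
Qed.

Lemma bmf_span f : span f -> bmf f.
Proof.
elim => {f} [B tB||f g _ bf _ bg|c f _ bf]; [exact: bmf_tensor|exact: bmf_cst|exact: bmfD|exact: bmfZ].
Qed.

Lemma bmf_indic (A : set 'rV[R]_n) : measurable A -> bmf (\1_A).
Proof.
move=> mA; split; first exact: measurable_indic.
by exists 1 => x; rewrite indicE normr_nat lern1; case: (_ \in _).
Qed.

End span.

Section density.
Import HBNNSimple.
Context {R : realType} {n : nat}.
Local Notation mu := (@lebesgue_rV R n).
Variable m : 'rV[R]_n -> R.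
Hypotheses (m0 : forall x, 0 <= m x) (mi : mu.-integrable setT (EFin \o m)).
Implicit Types (f g : 'rV[R]_n -> R) (A : set 'rV[R]_n).

Let mm : measurable_fun setT m.
Proof. by apply/measurable_EFinP; exact: measurable_int mi. Qed.

Lemma bmf_weight_integrable f : bmf f -> mu.-integrable setT (EFin \o (fun x => f x * m x)).
Proof.
move=> [mf [C fC]]; apply: (le_intg _ (intgZ C mi)); first exact: measurable_funM.
by move=> x; rewrite normrM (ger0_norm (m0 x)) ler_wpM2r.
Qed.

(** Membership in the closure of the span in the weighted space L^2(m). *)
Definition approximable f := forall e : R, 0 < e ->
  exists2 psi, span psi & \int[mu]_x ((f x - psi x) ^+ 2 * m x) <= e.

Lemma dist2D f g h : bmf f -> bmf g -> bmf h ->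
  \int[mu]_x ((f x - h x) ^+ 2 * m x) <=
  2 * \int[mu]_x ((f x - g x) ^+ 2 * m x) + 2 * \int[mu]_x ((g x - h x) ^+ 2 * m x).
Proof.
move=> bf bg bh.
have i1 := bmf_weight_integrable (bmf_sqr (bmfB bf bg)).
have i2 := bmf_weight_integrable (bmf_sqr (bmfB bg bh)).
have i3 := bmf_weight_integrable (bmf_sqr (bmfB bf bh)).
rewrite -!RintegralZl// -RintegralD//; [|exact: intgZ..].
apply: le_Rintegral => //; first by apply: intgD; exact: intgZ.
move=> x _; rewrite !mulrA -mulrDl ler_wpM2r//.
by have := sqr_ge0 ((f x - g x) - (g x - h x)); rewrite !expr2; nra.
Qed.

Lemma approximable_lim f : bmf f ->
  (forall e : R, 0 < e -> exists g, [/\ bmf g, approximable g &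
     \int[mu]_x ((f x - g x) ^+ 2 * m x) <= e]) -> approximable f.
Proof.
move=> bf H e e0; have e4 : 0 < e / 4 by lra.
have [g [bg ag fg]] := H _ e4; have [psi sp gp] := ag _ e4.
by exists psi => //; have := dist2D bf bg (bmf_span sp); lra.
Qed.

Lemma approximableD f g : bmf f -> bmf g -> approximable f -> approximable g ->
  approximable (fun x => f x + g x).
Proof.
move=> bf bg af ag e e0; have e4 : 0 < e / 4 by lra.
have [p sp fp] := af _ e4; have [q sq gq] := ag _ e4.
exists (fun x => p x + q x); first exact: spanD.
have h := dist2D (bmfD bf bg) (bmfD (bmf_span sp) bg) (bmfD (bmf_span sp) (bmf_span sq)).
apply: le_trans h _.
under eq_Rintegral => x _ do rewrite opprD addrACA subrr addr0.
under [X in _ + 2 * X]eq_Rintegral => x _ do rewrite opprD addrACA subrr add0r.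
lra.
Qed.

Lemma approximableZ (c : R) f : bmf f -> approximable f -> approximable (fun x => c * f x).
Proof.
move=> bf af e e0; have c0 : 0 < c ^+ 2 + 1 by rewrite ltr_wpDl ?sqr_ge0.
have [p sp fp] := af _ (divr_gt0 e0 c0); exists (fun x => c * p x); first exact: spanZ.
under eq_Rintegral => x _ do rewrite -mulrBr exprMn -mulrA.
rewrite RintegralZl//; last exact: (bmf_weight_integrable (bmf_sqr (bmfB bf (bmf_span sp)))).
move: fp; rewrite ler_pdivlMr// => fp.
have : 0 <= \int[mu]_x ((f x - p x) ^+ 2 * m x).
  by apply: Rintegral_ge0 => x _; rewrite mulr_ge0 ?sqr_ge0.
lra.
Qed.

(** Dominated convergence, the weight [m] being integrable, keeps bounded pointwise limits in the
    closure. *)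
Lemma approximable_dominated (f_ : nat -> 'rV[R]_n -> R) f (C : R) :
  (forall k, measurable_fun setT (f_ k)) -> (forall k x, `|f_ k x| <= C) ->
  (forall x, f_ ^~ x @ \oo --> f x) -> (forall k, approximable (f_ k)) ->
  bmf f /\ approximable f.
Proof.
move=> mf fC ff af.
have bf : bmf f.
  split; first by apply: (measurable_fun_cvg mf) => x _; exact: ff.
  exists C => x; have h : (fun k => `|f_ k x|) @ \oo --> `|f x| by apply: cvg_norm; exact: ff.
  rewrite -(cvg_lim _ h)//; apply: limr_le; first by apply/cvg_ex; exists `|f x|.
  by apply: nearW.
split => //; apply: approximable_lim => // e e0.
have bf_ k : bmf (f_ k) by split => //; exists C.
have [_ [C' fC']] := bf.
have h : (fun k => \int[mu]_x ((f x - f_ k x) ^+ 2 * m x)) @ \oo --> \int[mu]_x ((f x - f x) ^+ 2 * m x).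
  apply: (@Rintegral_dominated_cvg _ _ _ _ _ (fun x => (f x - f x) ^+ 2 * m x) (fun x => (C' + C) ^+ 2 * m x)).
  - move=> k; apply: measurable_funM => //; exact: (bmf_sqr (bmfB bf (bf_ k))).1.
  - exact: intgZ.
  - move=> x; apply: cvgMl; under eq_fun do rewrite expr2; rewrite expr2.
    by apply: cvgM; apply: cvgB; [exact: cvg_cst|exact: ff|exact: cvg_cst|exact: ff].
  - move=> k x; rewrite normrM normrX (ger0_norm (m0 x)) ler_wpM2r// ler_sqr ?nnegrE//.
      by apply: le_trans (ler_normB _ _) _; apply: lerD.
    by rewrite addr_ge0// ?(le_trans _ (fC' 0))// (le_trans _ (fC 0%N 0)).
move: h; under eq_Rintegral do rewrite subrr expr0n mul0r.
rewrite /Rintegral integral0 /= => h.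
have [k _ Hk] := (cvgr_lt 0 h _ e0).
exists (f_ k); split => //; exact/ltW/(Hk k)/leqnn.
Qed.

Definition open_box (l h : 'I_n -> R) : set 'rV[R]_n :=
  [set x | forall i, l i < x 0 i < h i].

Lemma measurable_open_box (l h : 'I_n -> R) : measurable (open_box l h).
Proof.
rewrite (_ : open_box l h = \bigcap_(i in [set: 'I_n]) (rV_coord i @^-1` `]l i, h i[%classic)).
  apply: fin_bigcap_measurable => [|i _]; first exact: finite_finset.
  by rewrite -[X in measurable X]setTI; exact: measurable_rV_coord.
by apply/seteqP; split => x /= H i; have := H i; rewrite /= in_itv/=; [move=> + _|apply].
Qed.

Let bump_box (l h : 'I_n -> R) : 'I_n -> R -> R :=
  fun i t => flat 1 (t - l i) * flat 1 (h i - t).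

Let bump_box_testB l h : testB (bump_box l h).
Proof.
move=> i; split.
  have h1 := @smooth1_affine _ _ 1 1 (- l i) (@flat_smooth _ 1).
  have h2 := @smooth1_affine _ _ 1 (-1) (h i) (@flat_smooth _ 1).
  have := smooth1M h1 h2; congr smooth1; apply/funext => t.
  by rewrite !mul1r mulN1r /bump_box [- t + _]addrC.
exists (`|l i| + `|h i|) => t lt; rewrite /bump_box.
have [t0|t0] := leP 0 t.
  rewrite [X in _ * X]flat_le0 ?mulr0//; move: lt; rewrite (ger0_norm t0).
  by have := ler_norm (h i); have := normr_ge0 (l i); lra.
rewrite flat_le0 ?mul0r//; move: lt; rewrite (ltr0_norm t0).
by have := ler_norm (- l i); rewrite normrN; have := normr_ge0 (h i); lra.
Qed.

(** The product [G] of flat functions is positive exactly on the box and at most 1, so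
    [1 - (1 - G)^k] tends to the indicator of the box. *)
Lemma approximable_open_box l h : approximable (\1_(open_box l h)).
Proof.
set G := tensor (bump_box l h); have sG : span G by exact/span_tensor/bump_box_testB.
have f01 (t : R) : 0 <= flat 1 t <= 1 by rewrite flat1_ge0 flat1_le1.
have G01 x : 0 <= G x <= 1.
  have b01 i : 0 <= bump_box l h i (x 0 i) <= 1.
    by rewrite /bump_box mulr_ge0 ?flat1_ge0//= mulr_ile1 ?flat1_ge0 ?flat1_le1.
  rewrite /G /tensor prodr_ge0 /= ?prodr_ile1// => i _; by case/andP: (b01 i).
pose f k x := 1 - (1 - G x) ^+ k.
have sf k : span (f k).
  elim: k => [|k IH].
    by rewrite /f; under eq_fun do rewrite expr0 subrr; exact: span0.
  (* The recursion [f_(k+1) = f_k + G - G f_k] avoids the constant 1, which is not at hand in the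
     span. *)
  have := spanB (spanD IH sG) (spanM sG IH); congr span.
  by apply/funext => x; rewrite /f exprS; ring.
have G1 x : `|1 - G x| <= 1 by have := G01 x; rewrite ler_norml; lra.
apply: (@approximable_dominated f _ 2 _ _ _ _).2.
- by move=> k; case: (bmf_span (sf k)).
- move=> k x; apply: le_trans (ler_normB _ _) _.
  by rewrite normr1 normrX (_ : 2 = 1 + 1)// lerD// exprn_ile1.
- move=> x; rewrite indicE /f; case: (boolP (_ \in _)) => [/set_mem xb|/negP xb].
    rewrite [X in _ --> X](_ : _ = 1 - 0); last by rewrite subr0.
    apply: cvgB; first exact: cvg_cst.
    apply: cvg_expr; rewrite ltr_norml; have /andP[_ G2] := G01 x.
    suff : 0 < G x by lra.
    apply: prodr_gt0 => i _; rewrite /bump_box mulr_gt0// flat1_gt0 subr_gt0; by case/andP: (xb i).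
  suff -> : G x = 0 by rewrite subr0; under eq_fun do rewrite expr1n subrr; exact: cvg_cst.
  have /existsNP[i /negP/nandP xi] : ~ open_box l h x by move=> xb'; apply: xb; rewrite inE.
  rewrite /G /tensor (bigD1 i)//= /bump_box; case: xi; rewrite -leNgt => xi.
    by rewrite flat_le0 ?mul0r// subr_le0.
  by rewrite (@flat_le0 _ 1 (h i - _)) ?mulr0 ?mul0r// subr_le0.
- by move=> k e e0; exists (f k) => //; under eq_Rintegral do rewrite subrr expr0n mul0r; rewrite /Rintegral integral0 ltW.
Qed.

Let boxes : set (set 'rV[R]_n) := [set A | exists l h, A = open_box l h].

Let box_N (N : nat) := open_box (fun=> - N%:R) (fun=> N%:R).

Let archi_rV (x : 'rV[R]_n) : exists N : nat, forall i, `|x 0 i| < N%:R.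
Proof.
have [s [s0 xs]] := rV_bound x; exists (Num.truncn s).+1 => i.
exact: le_lt_trans (xs i) (truncnS_gt _).
Qed.

Lemma measurable_rV_open_boxes : @measurable _ 'rV[R]_n = <<s boxes >>.
Proof.
apply/seteqP; split; last first.
  apply: smallest_sub; first exact: sigma_algebra_measurable.
  move=> _ [l [h ->]].
  exact: measurable_open_box.
have sB : sigma_algebra setT <<s boxes >> by exact: smallest_sigma_algebra.
apply: smallest_sub; first exact: sB.
move=> A; rewrite -bigcup_seq/= => -[i _ [Y mY <-]].
have := sigma_algebra_image (@rV_coord R n i) sB => sI.
suff : (measurable : set (set (measurableTypeR R))) `<=` image_set_system setT (rV_coord i) <<s boxes >>.
  by apply.
rewrite RGenOpens.measurableE; apply: smallest_sub => // _ [a [b ->]].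
rewrite /image_set_system/= setTI.
pose l N k : R := if k == i then a else - (N%:R).
pose h N k : R := if k == i then b else N%:R.
rewrite (_ : _ @^-1` _ = \bigcup_N open_box (l N) (h N)).
  case: sB => _ _; apply => N; apply: sub_sigma_algebra; by exists (l N), (h N).
apply/seteqP; split => x /=; rewrite /rV_coord/= in_itv/=.
  move=> xab; have [N HN] := archi_rV x; exists N => // k; rewrite /l /h.
  case: eqVneq => [->//|_]; by have := HN k; rewrite ltr_norml.
by move=> [N _ /(_ i)]; rewrite /l /h eqxx.
Qed.

Let approximable_cst1 : approximable (fun=> 1).
Proof.
apply: (@approximable_dominated (fun N => \1_(box_N N)) _ 1 _ _ _ _).2.
- move=> N; apply: measurable_indic; rewrite measurable_rV_open_boxes.
  by apply: sub_sigma_algebra; exists (fun=> - N%:R), (fun=> N%:R).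
- by move=> N x; rewrite indicE normr_nat lern1; case: (_ \in _).
- move=> x; have [N HN] := archi_rV x; apply: cvg_near_cst; exists N => // k /= Nk.
  rewrite indicE mem_set// => i; rewrite -ltr_norml; apply: lt_le_trans (HN i) _.
  by rewrite ler_nat.
- by move=> N; exact: approximable_open_box.
Qed.

(** Open boxes are a generating pi-system and the sets with approximable indicator form a Dynkin
    class. *)
Lemma approximable_indic A : measurable A -> approximable (\1_A).
Proof.
move=> mA; apply: (dynkin_induction (G := boxes) (P := [set A | approximable (\1_A)])).
- exact: measurable_rV_open_boxes.
- move=> _ _ [l [h ->]] [l' [h' ->]].
  exists (fun i => Num.max (l i) (l' i)), (fun i => Num.min (h i) (h' i)).
  apply/seteqP; split => x /=.
    by move=> [h1 h2] i; have := h1 i; have := h2 i; rewrite gt_max lt_min => /andP[-> ->] /andP[-> ->].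
  by move=> H; split => i; have := H i; rewrite gt_max lt_min; case/andP => /andP[h1 h2] /andP[h3 h4]; rewrite ?h1 ?h2 ?h3 ?h4.
- by rewrite /= indicT.
- by move=> _ [l [h ->]]; exact: approximable_open_box.
- move=> S mS /= aS.
  have bS := bmfZ (-1) (bmf_indic mS).
  have := approximableD (bmf_cst 1) bS approximable_cst1 (approximableZ (-1) (bmf_indic mS) aS).
  congr approximable; apply/funext => x; rewrite !indicE in_setC.
  by case: (x \in S); rewrite /= ?mulr1 ?subrr ?mulr0 ?addr0// mulN1r subrr.
- move=> F mF tF aF /=.
  have mG k : measurable (\big[setU/set0]_(i < k) F i) by apply: bigsetU_measurable.
  apply: (@approximable_dominated (fun k => \1_(\big[setU/set0]_(i < k) F i)) _ 1 _ _ _ _).2.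
  + by move=> k; exact: measurable_indic.
  + by move=> k x; rewrite indicE normr_nat lern1; case: (_ \in _).
  + move=> x; rewrite indicE; case: (boolP (_ \in _)) => [/set_mem [j _ Fj]|xn].
      apply: cvg_near_cst; exists j.+1 => // k /= jk; rewrite indicE mem_set// -bigcup_mkord.
      by exists j.
    apply: cvg_near_cst; apply: nearW => k; rewrite indicE memNset// -bigcup_mkord => -[j _ Fj].
    by move: xn; rewrite notin_setE; apply; exists j.
  + elim=> [|k IH].
      rewrite big_ord0 indic0 => e e0; exists (fun=> 0); first exact: span0.
      by under eq_Rintegral do rewrite subrr expr0n mul0r; rewrite /Rintegral integral0 ltW.
    have := approximableD (bmf_indic (mG k)) (bmf_indic (mF k)) IH (aF k).
    congr approximable; apply/funext => x; rewrite big_ord_recr/= !indicE in_setU.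
    case: (boolP (x \in F k)) => [/set_mem Fk|]; last by rewrite orbF addr0.
    rewrite memNset ?add0r// -bigcup_mkord => -[j /= jk Fj].
    have := tF j k I I; move/(_ (ex_intro _ x (conj Fj Fk))) => jk'.
    by move: jk; rewrite jk' ltnn.
- by rewrite -measurable_rV_open_boxes.
Qed.

Lemma approximable_sum k (h : 'I_k -> 'rV[R]_n -> R) :
  (forall i, bmf (h i)) -> (forall i, approximable (h i)) ->
  approximable (fun x => \sum_(i < k) h i x).
Proof.
move=> bh ah; suff [] : bmf (fun x => \sum_(i < k) h i x) /\
  approximable (fun x => \sum_(i < k) h i x) by [].
elim: (index_enum _) => [|i s [bs IH]].
  under eq_fun do rewrite big_nil; split; first exact: bmf_cst.
  move=> e e0; exists (fun=> 0); first exact: span0.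
  by under eq_Rintegral do rewrite subrr expr0n mul0r; rewrite /Rintegral integral0 ltW.
by under eq_fun do rewrite big_cons; split; [exact: bmfD|exact: approximableD].
Qed.

(** The positive and negative parts are bounded limits of simple functions, which are combinations
    of approximable indicators. *)
Lemma approximable_bmf f : bmf f -> approximable f.
Proof.
move=> bf; have [mf [C fC]] := bf.
suff pos g : bmf g -> (forall x, 0 <= g x) -> approximable g.
  have mx g : bmf g -> bmf (fun x => Num.max (g x) 0).
    move=> [mg [E gE]]; split; first exact: measurable_maxr.
    exists E => x; have := gE x; case: (leP (g x) 0) => // _ _.
    by rewrite normr0; apply: le_trans (gE x).
  have mp := mx _ bf; have mn := mx _ (bmfZ (-1) bf).
  have gp g x : 0 <= Num.max (g x) 0 :> R by rewrite le_max lexx orbT.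
  have := approximableD mp (bmfZ (-1) mn) (pos _ mp (gp f))
    (approximableZ (-1) mn (pos _ mn (gp (fun x => -1 * f x)))).
  congr approximable; apply/funext => x; rewrite !mulN1r.
  by case: (leP (f x) 0) => h; case: leP => h'; lra.
move=> [mg [E gE]] g0.
have mEg : measurable_fun setT (EFin \o g) by exact/measurable_EFinP.
pose s := nnsfun_approx measurableT mEg.
have gE0 x : setT x -> (0 <= (EFin \o g) x)%E by rewrite /= lee_fin.
suff [] : bmf g /\ approximable g by [].
pose sf (k : nat) (x : 'rV[R]_n) : R := s k x.
apply: (@approximable_dominated sf g E).
- by move=> k; exact: measurable_funP.
- move=> k x; rewrite ger0_norm//; apply: le_trans (le_trans (ler_norm _) (gE x)).
  by rewrite -lee_fin /sf /s nnsfun_approxE; exact: (le_approx k gE0).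
- by move=> x; apply: fine_cvg (cvg_nnsfun_approx measurableT mEg gE0 _).
- move=> k; have := @fimfunEord _ _ (s k); set fs0 := fset_set _ => sE; pose fs := finmap.enum_fset fs0.
  rewrite (_ : sf k = fun x => \sum_(i < size fs) (fs`_i * \1_(s k @^-1` [set fs`_i]) x)); last first.
    by apply/funext => x; exact: sE.
  have mI i : measurable (s k @^-1` [set fs`_i]).
    by rewrite -[X in measurable X]setTI; apply: (measurable_funP (s k)).
  apply: approximable_sum => i; first exact/bmfZ/bmf_indic.
  by apply: approximableZ; [exact: bmf_indic|exact: approximable_indic].
Qed.

End density.

(** * Recovering a weighted square norm from test functions *)

Section truncation.
Context {R : realType} {n : nat}.
Local Notation mu := (@lebesgue_rV R n).
Variables (g w : 'rV[R]_n -> R).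
Hypotheses (mg : measurable_fun setT g) (mw : measurable_fun setT w) (w0 : forall x, 0 <= w x)
  (wi : mu.-integrable setT (EFin \o w)) (wgi : mu.-integrable setT (EFin \o (fun x => w x * g x))).

(** Large values are replaced by 0 rather than clipped, which gives both [trunc * g = trunc^2] and
    [|g - trunc| <= |g|]. *)
Definition trunc (N : R) x := if `|g x| <= N then g x else 0.

Lemma bmf_trunc N : bmf (trunc N).
Proof.
split; last first.
  by exists `|N| => x; rewrite /trunc; case: ifP => [/le_trans->//|]; rewrite ?normr0// ler_norm.
apply: measurable_fun_ifT => //; apply: measurable_fun_ler => //.
exact: measurableT_comp mg.
Qed.

(* For fixed g the quadratic functional psi |-> 2 g psi - psi^2 is maximal at psi = g, *)
(* so that its supremum over the span recovers the weighted square norm of g.          *)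
Lemma span_quadratic_ge (N d : R) : 0 < d -> exists2 psi, span psi &
  \int[mu]_x (w x * trunc N x ^+ 2) - d <= \int[mu]_x (w x * (2 * g x * psi x - psi x ^+ 2)).
Proof.
(* The summand 1 of the weight controls the square of [trunc - psi]; the summand [|g|] controls its
   product with [g], which need not be square integrable. *)
move=> d0; pose m x := w x * (1 + `|g x|).
have wgi' : mu.-integrable setT (EFin \o (fun x => w x * `|g x|)).
  apply: eq_integrable (integrable_norm wgi) => // x _ /=.
  by rewrite normrM (ger0_norm (w0 x)).
have m0 x : 0 <= m x by rewrite mulr_ge0// addr_ge0.
have mi : mu.-integrable setT (EFin \o m).
  by apply: eq_integrable (intgD wi wgi') => // x _; rewrite /m /= mulrDr mulr1.
set A := \int[mu]_x (w x * `|g x|).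
have A0 : 0 <= A by apply: Rintegral_ge0 => x _; rewrite mulr_ge0.
(* Chosen so that [th * A <= d / 2]; the approximation error in the weight [m] takes the other
   half. *)
pose th := d / (2 * (A + 1)).
have th0 : 0 < th by rewrite divr_gt0// mulr_gt0// ltr_wpDl.
have c0 : 0 < 1 + th^-1 by rewrite addr_gt0// invr_gt0.
have e0 : 0 < d / (2 * (1 + th^-1)) by rewrite divr_gt0// mulr_gt0.
have bt := bmf_trunc N; have [psi sp] := approximable_bmf m0 mi bt e0.
set D := \int[mu]_x _ => hD; exists psi => //.
have bp := bmf_span sp; have bd := bmfB bt bp.
have bd2 := bmf_sqr bd.
have i1 := bmf_weight_integrable m0 mi bd2.
have iw f : bmf f -> mu.-integrable setT (EFin \o (fun x => w x * f x)).
  move=> bf; apply: eq_integrable (bmf_weight_integrable w0 wi bf) => // x _ /=.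
  by rewrite mulrC.
have iwg f : bmf f -> mu.-integrable setT (EFin \o (fun x => w x * (2 * g x * f x))).
  move=> [mf [C fC]]; apply: (le_intg _ (intgZ (2 * C) wgi')).
    apply: measurable_funM => //; apply: measurable_funM => //; exact: measurable_funM.
  move=> x; rewrite !normrM (ger0_norm (w0 x)) (ger0_norm (ler0n _ _)).
  rewrite (_ : _ * (_ * _ * _) = 2 * `|f x| * (w x * `|g x|)); last by ring.
  by rewrite ler_wpM2r ?mulr_ge0// ler_wpM2l.
have it2 : mu.-integrable setT (EFin \o (fun x => w x * trunc N x ^+ 2)).
  by apply: (iw (fun x => trunc N x ^+ 2)); exact: bmf_sqr.
have ip : mu.-integrable setT (EFin \o (fun x => w x * (2 * g x * psi x - psi x ^+ 2))).
  by apply: eq_integrable (intgB (iwg _ bp) (iw _ (bmf_sqr bp))) => // x _ /=; rewrite mulrBr.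
have le1 x : w x * trunc N x ^+ 2 - w x * (2 * g x * psi x - psi x ^+ 2) <=
   th * (w x * `|g x|) + (1 + th^-1) * ((trunc N x - psi x) ^+ 2 * m x).
  set f := trunc N x; set p := psi x.
  have fg : f * g x = f ^+ 2 by rewrite /f /trunc; case: ifP; rewrite ?expr2 ?mul0r.
  have gf : `|g x - f| <= `|g x|.
    by rewrite /f /trunc; case: ifP; rewrite ?subrr ?normr0 ?subr0.
  (* Young's inequality with parameter [th] for [2 |f - p|], multiplied by [|g - f| <= |g|]. *)
  have key : 2 * (g x - f) * (f - p) <= `|g x| * (th + th^-1 * (f - p) ^+ 2).
    apply: le_trans (ler_norm _) _; rewrite -mulrA mulrCA normrM.
    apply: ler_pM => //; rewrite normrM (ger0_norm (ler0n _ _)) -(real_normK (num_real (f - p))).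
    rewrite -(ler_pM2l th0) mulrDr [th * (th^-1 * _)]mulrA divff ?gt_eqF// mul1r.
    by have := sqr_ge0 (th - `|f - p|); rewrite !expr2; nra.
  have -> : w x * f ^+ 2 - w x * (2 * g x * p - p ^+ 2) =
      w x * (2 * (g x - f) * (f - p) + (f - p) ^+ 2).
    by rewrite -mulrBr; congr (_ * _); have := fg; rewrite !expr2 => E; ring: E.
  rewrite /m; apply: le_trans (ler_wpM2l (w0 x) (lerD key (lexx _))) _.
  have -> : w x * (`|g x| * (th + th^-1 * (f - p) ^+ 2) + (f - p) ^+ 2) =
     th * (w x * `|g x|) + w x * (f - p) ^+ 2 * (th^-1 * `|g x| + 1) by ring.
  rewrite lerD2l (_ : (1 + th^-1) * _ = w x * (f - p) ^+ 2 * ((1 + th^-1) * (1 + `|g x|))); last by ring.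
  apply: ler_wpM2l; first exact: mulr_ge0 (w0 x) (sqr_ge0 _).
  have ti : 0 <= th^-1 by rewrite invr_ge0 ltW.
  by have := normr_ge0 (g x); nra.
have : \int[mu]_x (w x * trunc N x ^+ 2 - w x * (2 * g x * psi x - psi x ^+ 2)) <=
    th * A + (1 + th^-1) * D.
  rewrite /A /D -!RintegralZl// -RintegralD//; [|exact: intgZ..].
  apply: le_Rintegral => //; [exact: intgB|by apply: intgD; exact: intgZ].
rewrite RintegralB// => h.
have h1 : th * A <= d / 2.
  have : th * (2 * (A + 1)) = d by rewrite /th divfK// gt_eqF// mulr_gt0// ltr_wpDl.
  lra.
have h2 : (1 + th^-1) * D <= d / 2.
  by move: hD; rewrite invfM mulrA ler_pdivlMr// mulrC.
lra.
Qed.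

End truncation.

Lemma RintegralN {R : realType} d {T : measurableType d} (m : {measure set T -> \bar R})
    (f : T -> R) : \int[m]_x (- f x) = - \int[m]_x f x.
Proof.
rewrite /Rintegral integralE [in RHS]integralE.
have -> : (fun x => (- f x)%:E) = (\- (fun x => (f x)%:E))%E by [].
rewrite funeposN funenegN.
by case: (\int[m]_x _)%E => [a| |]; case: (\int[m]_x _)%E => [b| |] //=; rewrite ?oppr0 ?opprB.
Qed.

(** * Weak derivatives tested on tensor products *)

Section weak_derivative.
Context {R : realType} {n : nat}.
Local Notation leb := (@lebesgue_measure R).
Local Notation mu := (@lebesgue_rV R n).
Local Notation RV := (measurableTypeR R * 'rV[R]_n)%type.
Implicit Types (f g phi : 'rV[R]_n -> R) (B : 'I_n -> R -> R).

Definition locint g := measurable_fun setT g /\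
  forall r, mu.-integrable setT (EFin \o (fun x => g x * \1_(box r) x)).

(* Products of one-variable functions suffice as test functions, since only mollifiers *)
(* and elements of the span are ever tested.                                           *)
Definition rwd j f g := forall B, testB B ->
  \int[mu]_x (f x * tensor (upd B j (derive1 (B j))) x) = - \int[mu]_x (g x * tensor B x).

Definition rwd2 j f g := forall B, testB B ->
  \int[mu]_x (f x * tensor (upd B j (derive1 (derive1 (B j)))) x) = \int[mu]_x (g x * tensor B x).

Lemma bmf_locint f : bmf f -> locint f.
Proof.
move=> [mf [C fC]]; split => // r; apply: (le_intg _ (intgZ C (integrable_box r))).
  by apply: measurable_funM => //; apply: measurable_indic; exact: measurable_box.
by move=> x; rewrite normrM indicE normr_nat; apply: ler_wpM2r.
Qed.

Lemma locint_mul g phi r : locint g -> bmf phi -> boxed r phi ->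
  mu.-integrable setT (EFin \o (fun x => g x * phi x)).
Proof.
move=> [mg gi] [mp [C pC]] bp; have gr := integrable_norm (gi r).
have gr' : mu.-integrable setT (EFin \o (fun x => `|g x * \1_(box r) x|)) by [].
apply: (le_intg _ (intgZ C gr')); first exact: measurable_funM.
move=> x; rewrite !normrM mulrCA ler_wpM2l// indicE normr_nat -indicE.
exact: boxed_le_indic.
Qed.

Let sub_test B (x : 'rV[R]_n) : testB B -> testB (fun i t => B i (x 0 i - t)).
Proof. by move=> tB i; exact: test1_shift. Qed.

Lemma derive1_sub (h : R -> R) (c t : R) : smooth1 h ->
  derive1 (fun t => h (c - t)) t = - derive1 h (c - t).
Proof.
move=> sh; have := @derive1_affine _ h 1 (-1) c t sh.
rewrite (_ : (fun y => 1 * h (-1 * y + c)) = fun t => h (c - t)); last first.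
  by apply/funext => y; rewrite mul1r mulN1r addrC.
by move=> ->; rewrite mul1r !mulN1r addrC.
Qed.

Lemma derive2_sub (h : R -> R) (c : R) : smooth1 h ->
  derive1 (derive1 (fun t => h (c - t))) = fun t => derive1 (derive1 h) (c - t).
Proof.
move=> sh; have -> : derive1 (fun t => h (c - t)) = fun t => - derive1 h (c - t).
  by apply/funext => t; exact: derive1_sub.
apply/funext => t; have sh' := smooth1_derive sh.
have d : is_derive t 1 (fun t => derive1 h (c - t)) (- derive1 (derive1 h) (c - t)).
  rewrite -(@derive1_sub (derive1 h) c t sh'); apply: smooth1_is_derive.
  have := @smooth1_affine _ _ 1 (-1) c sh'; congr smooth1.
  by apply/funext => y; rewrite mul1r mulN1r addrC.
by rewrite derive1E -[RHS]opprK; exact: (@derive_val _ _ _ _ _ _ _ (is_deriveN d)).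
Qed.

Let updE B j (h : R -> R) (x y : 'rV[R]_n) : tensor (upd B j h) (x - y) =
  tensor (upd (fun i t => B i (x 0 i - t)) j (fun t => h (x 0 j - t))) y.
Proof.
rewrite tensor_subE; apply: eq_bigr => i _; rewrite /upd.
by case: eqP => [->|].
Qed.

Lemma tensor_updN B j (h : R -> R) (x : 'rV[R]_n) :
  tensor (upd B j (fun t => - h t)) x = - tensor (upd B j h) x.
Proof. by rewrite !tensor_upd mulNr. Qed.

Let derive1_subE B (x : 'rV[R]_n) j : smooth1 (B j) ->
  derive1 ((fun i t => B i (x 0 i - t)) j) = fun t => - derive1 (B j) (x 0 j - t).
Proof. by move=> sB; apply/funext => t; exact: derive1_sub. Qed.

(** The reflection in [y |-> B (x - y)] changes the sign of the derivative and cancels the sign of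
    the weak derivative: differentiating the mollifier amounts to mollifying the weak derivative. *)
Lemma sconv_rwd (F : R -> 'rV[R]_n -> R) B j s x g : testB B -> rwd j (F s) g ->
  sconv F (upd B j (derive1 (B j))) s x = \int[mu]_y (g y * tensor B (x - y)).
Proof.
move=> tB wg; have := wg _ (sub_test x tB); rewrite derive1_subE; last exact: (tB j).1.
under eq_Rintegral => y _ do rewrite tensor_updN -updE mulrN.
under [X in _ = - X -> _]eq_Rintegral => y _ do rewrite -tensor_subE.
by rewrite RintegralN => /oppr_inj <-.
Qed.

Lemma sconv_rwd2 (F : R -> 'rV[R]_n -> R) B j s x g : testB B -> rwd2 j (F s) g ->
  sconv F (upd B j (derive1 (derive1 (B j)))) s x = \int[mu]_y (g y * tensor B (x - y)).
Proof.
move=> tB wg; have := wg _ (sub_test x tB); rewrite (derive2_sub (x 0 j) (tB j).1).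
under eq_Rintegral => y _ do rewrite -updE.
by under [X in _ = X -> _]eq_Rintegral => y _ do rewrite -tensor_subE.
Qed.

(** Linearity extends [rwd] from tensors to the span, local integrability making the integrals
    additive. The classical derivative and a support radius are recorded for the integration by
    parts in [moll_j_lower]. *)
Lemma span_derivable j phi : span phi -> exists dphi r, [/\ bmf dphi, boxed r phi, boxed r dphi,
  forall x, is_derive x (ebase j) phi (dphi x) &
  forall f g, locint f -> locint g -> rwd j f g ->
    \int[mu]_x (f x * dphi x) = - \int[mu]_x (g x * phi x)].
Proof.
elim=> {phi} [B tB||f g sf [df [r [bdf bf bf' ff' Hf]]] sg [dg [s [bdg bg bg' gg' Hg]]]|c f sf [df [r [bdf bf bf' ff' Hf]]]].
- have tB' := testB_updd j tB; have [r1 h1] := boxed_tensor tB; have [r2 h2] := boxed_tensor tB'.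
  exists (tensor (upd B j (derive1 (B j)))), (Num.max r1 r2); split.
  + exact: bmf_tensor.
  + by apply: boxed_leW h1; rewrite le_max lexx.
  + by apply: boxed_leW h2; rewrite le_max lexx orbT.
  + by move=> x; apply: tensor_is_derive; exact: (tB j).1.
  + by move=> f g _ _ H; exact: H.
- exists (fun=> 0), 0; split => //; first exact: bmf_cst.
    by move=> x; exact: is_derive_cst.
  move=> f g _ _ _; under eq_Rintegral do rewrite mulr0.
  by under [X in _ = - X]eq_Rintegral do rewrite mulr0; rewrite /Rintegral integral0 oppr0.
- have [rm sm] : r <= Num.max r s /\ s <= Num.max r s by rewrite !le_max !lexx orbT.
  have bf1 := boxed_leW rm bf; have bf2 := boxed_leW rm bf'.
  have bg1 := boxed_leW sm bg; have bg2 := boxed_leW sm bg'.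
  exists (fun x => df x + dg x), (Num.max r s); split.
  + exact: bmfD.
  + by move=> x nx; rewrite bf1// bg1// addr0.
  + by move=> x nx; rewrite bf2// bg2// addr0.
  + by move=> x; exact: is_deriveD.
  + move=> u v lu lv uv; under eq_Rintegral => x _ do rewrite mulrDr.
    under [X in _ = - X]eq_Rintegral => x _ do rewrite mulrDr.
    have i1 := locint_mul lu bdf bf'; have i2 := locint_mul lu bdg bg'.
    have i3 := locint_mul lv (bmf_span sf) bf; have i4 := locint_mul lv (bmf_span sg) bg.
    by rewrite !RintegralD// (Hf _ _ lu lv uv) (Hg _ _ lu lv uv) opprD.
- exists (fun x => c * df x), r; split.
  + exact: bmfZ.
  + by move=> x nx; rewrite bf// mulr0.
  + by move=> x nx; rewrite bf'// mulr0.
  + by move=> x; exact: is_deriveZ.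
  + move=> u v lu lv uv; under eq_Rintegral => x _ do rewrite mulrCA.
    under [X in _ = - X]eq_Rintegral => x _ do rewrite mulrCA.
    have i1 := locint_mul lu bdf bf'; have i3 := locint_mul lv (bmf_span sf) bf.
    by rewrite !RintegralZl// (Hf _ _ lu lv uv) mulrN.
Qed.

End weak_derivative.

(** * The mollified functions and their derivatives *)

Section conv_jet.
Context {R : realType} {n : nat}.
Local Notation leb := (@lebesgue_measure R).
Local Notation mu := (@lebesgue_rV R n).
Local Notation RV := (measurableTypeR R * 'rV[R]_n)%type.
Variables (F : R -> 'rV[R]_n -> R) (M : R).
Hypothesis mF : measurable_fun setT (fun z : RV => F z.1 z.2).
Hypothesis FM : forall t x, `|F t x| <= M.

Definition moll e := conv F (kap e) (kaps e).
Definition moll_t e := conv F (derive1 (kap e)) (kaps e).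
Definition moll_j e j := conv F (kap e) (upd (kaps e) j (derive1 (kap e))).
Definition moll_jj e j := conv F (kap e) (upd (kaps e) j (derive1 (derive1 (kap e)))).
Definition moll_tj e j := conv F (derive1 (kap e)) (upd (kaps e) j (derive1 (kap e))).

Lemma conv_ubm a B : test1 a -> testB B -> ubm (conv F a B).
Proof.
move=> ta tB; split; first by move=> t; exact: (measurable_conv mF FM).
by have [C [_ H]] := conv_bounded mF FM ta tB; exists C.
Qed.

Lemma moll_jet e : jet (moll e) (moll_t e) (moll_j e) (moll_jj e) (moll_tj e).
Proof.
have k1 := kap_test1 e; have k2 := test1_derive k1; have k3 := test1_derive k2.
have t0 : testB (kaps e : 'I_n -> R -> R) by exact: kaps_testB.
have t1 j : testB (upd (kaps e : 'I_n -> R -> R) j (derive1 (kap e))) by exact: testB_upd.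
have t2 j : testB (upd (kaps e : 'I_n -> R -> R) j (derive1 (derive1 (kap e)))) by exact: testB_upd.
have djj j (t : R) x : is_derive x (ebase j) (moll_j e j t) (moll_jj e j t x).
  have := conv_is_derive_x mF FM t x j k1 (t1 j).
  rewrite /moll_jj (_ : upd (upd _ _ _) _ _ = upd (kaps e) j (derive1 (derive1 (kap e))))//.
  by apply/funext => i; rewrite /upd eqxx; case: eqP.
split=> *; try exact: conv_ubm.
- exact: (conv_is_derive_t mF FM).
- exact: (conv_is_derive_t mF FM).
- exact: (conv_is_derive_x mF FM).
- exact: djj.
- exact: (conv_is_derive_x mF FM).
Qed.

End conv_jet.

(** * Smooth cutoffs at scale [N] *)

Section cutoff.
Context {R : realType} {n : nat}.

(** Normalised by its maximum, at 0. It is not constant near 0, so [eta N] tends to 1 pointwise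
    without being 1 on a box. *)
Definition cut1 (t : R) : R := (bump 1 0)^-1 * bump 1 t.

Lemma cut1_ge0 t : 0 <= cut1 t.
Proof. by rewrite mulr_ge0 ?invr_ge0 ?bump_ge0. Qed.

Lemma cut1_0 : cut1 0 = 1.
Proof. by rewrite /cut1 mulVf// gt_eqF// bump_gt0 normr0. Qed.

(** On []-1, 1[] the claim amounts to [1/(1+t) + 1/(1-t) >= 2]. *)
Lemma cut1_le1 t : cut1 t <= 1.
Proof.
rewrite /cut1 mulrC ler_pdivrMr ?mul1r; last by rewrite bump_gt0 normr0.
have [t1|t1] := leP 1 `|t|; first by rewrite bump_eq0// bump_ge0.
move: t1; rewrite ltr_norml => /andP[ta tb].
have p : 0 < 1 + t by lra. have q : 0 < 1 - t by lra.
rewrite /bump addr0 subr0 !flat1E p q ltr01 -!expRD ler_expR.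
have := invr_gt0 (1 + t); have := invr_gt0 (1 - t); rewrite p q => q' p'.
have E1 : (1 + t) * (1 + t)^-1 = 1 by rewrite divff// gt_eqF.
have E2 : (1 - t) * (1 - t)^-1 = 1 by rewrite divff// gt_eqF.
rewrite invr1; nra.
Qed.

Lemma cut1_test1 : test1 cut1.
Proof. exact/test1Z/bump_test1. Qed.

Definition cuts (N : R) : 'I_n -> R -> R := fun _ t => cut1 (N^-1 * t).

Lemma cuts_testB N : 0 < N -> testB (cuts N).
Proof.
move=> N0 i; have := @test1_affine _ _ 1 N^-1 0 _ cut1_test1.
rewrite gt_eqF ?invr_gt0// => /(_ isT); congr test1.
by apply/funext => t; rewrite mul1r addr0.
Qed.

Definition eta N : 'rV[R]_n -> R := tensor (cuts N).
Definition eta_j N j : 'rV[R]_n -> R := tensor (upd (cuts N) j (derive1 (cuts N j))).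

Lemma eta01 N x : 0 <= eta N x <= 1.
Proof.
rewrite /eta /tensor prodr_ge0 => [|i _]; last exact: cut1_ge0.
by rewrite prodr_ile1// => i _; rewrite cut1_ge0 cut1_le1.
Qed.

Lemma eta_bmf N : 0 < N -> bmf (eta N).
Proof. by move=> N0; apply: bmf_tensor; exact: cuts_testB. Qed.

Lemma eta_j_bmf N j : 0 < N -> bmf (eta_j N j).
Proof. by move=> N0; apply: bmf_tensor; apply: testB_updd; exact: cuts_testB. Qed.

Lemma eta_span N : 0 < N -> span (eta N).
Proof. by move=> N0; apply: span_tensor; exact: cuts_testB. Qed.

Lemma eta_boxed N : 0 < N -> boxed N (eta N).
Proof.
move=> N0 x /existsNP[i /negP]; rewrite -ltNge => Ni.
rewrite /eta /tensor (bigD1 i)//= /cuts /cut1 (@bump_eq0 _ 1 (N^-1 * x 0 i)) ?mulr0 ?mul0r//.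
by rewrite normrM normfV (gtr0_norm N0) mulrC ler_pdivlMr// mul1r ltW.
Qed.

Lemma eta_is_derive N j x : 0 < N -> is_derive x (ebase j) (eta N) (eta_j N j x).
Proof. by move=> N0; apply: tensor_is_derive; exact: (cuts_testB N0 j).1. Qed.

(** The chain rule produces [1/N] and the other factors are at most 1. This is the smallness that
    makes the energy flux disappear in the limit. *)
Lemma eta_j_le : exists C : R, 0 <= C /\ forall N j x, 0 < N -> `|eta_j N j x| <= C / N.
Proof.
have [C [C0 HC]] := test1_bounded (test1_derive cut1_test1); exists C; split => // N j x N0.
rewrite /eta_j tensor_upd normrM.
have -> : derive1 (cuts N j) = fun t => N^-1 * derive1 cut1 (N^-1 * t).
  apply/funext => t; have := @derive1_affine _ cut1 1 N^-1 0 t cut1_test1.1.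
  rewrite mul1r addr0 => <-; congr (derive1 _ t).
  by apply/funext => y; rewrite mul1r addr0.
rewrite -[leRHS]mulr1; apply: ler_pM => //.
  by rewrite normrM gtr0_norm ?invr_gt0// mulrC ler_wpM2r// ltW// invr_gt0.
rewrite normr_prod prodr_ile1// => i _; rewrite normr_ge0/= ger0_norm ?cut1_ge0//.
exact: cut1_le1.
Qed.

Lemma eta_cvg (x : 'rV[R]_n) : (fun k : nat => eta k.+1%:R x) @ \oo --> (1 : R).
Proof.
have h i : (fun k : nat => cuts k.+1%:R i (x 0 i)) @ \oo --> (1 : R).
  rewrite -[X in _ --> X]cut1_0; apply: (@cvg_comp _ _ _ (fun k : nat => k.+1%:R^-1 * x 0 i) cut1 _ (nbhs (0 : R))).
    by rewrite -(mul0r (x 0 i)); apply: cvgMl; exact: cvg_harmonic.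
  exact: (smooth1_continuous cut1_test1.1).
rewrite /eta /tensor; elim: (index_enum _) => [|i s IH].
  by under eq_fun do rewrite big_nil; exact: cvg_cst.
under eq_fun do rewrite big_cons.
have H := cvgM (h i) IH; rewrite mulr1 in H; exact: H.
Qed.

End cutoff.

(** * Removing the mollification and the cutoff *)

Section square_integrable.
Context {R : realType} {n : nat}.
Local Notation mu := (@lebesgue_rV R n).
Implicit Types (f g : 'rV[R]_n -> R) (K : R).

(** The integral is taken in the extended reals, so that the bound contains the integrability of
    [g^2]. *)
Definition sqr_int g K := measurable_fun setT g /\ (\int[mu]_x (g x ^+ 2)%:E <= K%:E)%E.

Lemma sqr_intP g K : sqr_int g K ->
  mu.-integrable setT (EFin \o (fun x => g x ^+ 2)) /\ \int[mu]_x (g x ^+ 2) <= K.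
Proof.
move=> [mg gK]; have gi : mu.-integrable setT (EFin \o (fun x => g x ^+ 2)).
  apply/integrableP; split; first by apply/measurable_EFinP; exact: measurable_funX.
  rewrite (@eq_integral _ _ _ mu setT (fun x => (g x ^+ 2)%:E)); last first.
    by move=> x _; rewrite /= ger0_norm ?sqr_ge0.
  exact: le_lt_trans gK (ltry _).
by split => //; rewrite -lee_fin EFin_Rintegral.
Qed.

Lemma sqr_int_of g K : measurable_fun setT g ->
  mu.-integrable setT (EFin \o (fun x => g x ^+ 2)) -> \int[mu]_x (g x ^+ 2) <= K -> sqr_int g K.
Proof. by move=> mg gi gK; split => //; rewrite -EFin_Rintegral// lee_fin. Qed.

Lemma sqr_int_locint g K : sqr_int g K -> locint g.
Proof.
move=> gK; have [gi _] := sqr_intP gK; split; first by case: gK.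
move=> r; apply: (le_intg _ (intgD gi (integrable_box r))).
  by apply: measurable_funM; [case: gK|apply: measurable_indic; exact: measurable_box].
move=> x; rewrite normrM indicE; case: (x \in _) => /=; last by rewrite normr0 mulr0 addr0 sqr_ge0.
rewrite normr1 mulr1 -(real_normK (num_real (g x))).
by have := sqr_ge0 (`|g x| - 2^-1); rewrite !expr2; lra.
Qed.

(* (a + b)^2 <= (1 + th) a^2 + (1 + 1/th) b^2 makes the square norm of a sum close to that of a. *)
Lemma sqr_intD_close f (A d : R) : 0 < d -> sqr_int f A -> exists2 th, 0 < th &
  forall g, sqr_int g th -> sqr_int (fun x => f x + g x) (A + d).
Proof.
move=> d0 fA; have [fi fA'] := sqr_intP fA.
have A0 : 0 <= A.
  apply: le_trans fA'; apply: Rintegral_ge0 => x _; exact: sqr_ge0.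
pose u := d / (2 * (A + 1)).
have u0 : 0 < u by rewrite divr_gt0// mulr_gt0// ltr_wpDl.
have ui : 0 < u^-1 by rewrite invr_gt0.
have c0 : 0 < 2 * (1 + u^-1) by rewrite mulr_gt0// addr_gt0.
exists (d / (2 * (1 + u^-1))); first exact: divr_gt0.
move=> g gt; have [gi gt'] := sqr_intP gt.
have mfg : measurable_fun setT (fun x => f x + g x).
  by apply: measurable_funD; [case: fA|case: gt].
have le1 x : (f x + g x) ^+ 2 <= (1 + u) * f x ^+ 2 + (1 + u^-1) * g x ^+ 2.
  rewrite -subr_ge0 (_ : _ - _ = u^-1 * (u * f x - g x) ^+ 2); last by field; rewrite gt_eqF.
  by rewrite mulr_ge0 ?sqr_ge0// ltW.
have i1 : mu.-integrable setT (EFin \o (fun x => (1 + u) * f x ^+ 2 + (1 + u^-1) * g x ^+ 2)).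
  by apply: intgD; exact: intgZ.
have i2 : mu.-integrable setT (EFin \o (fun x => (f x + g x) ^+ 2)).
  apply: (le_intg _ i1); first exact: measurable_funX.
  by move=> x; rewrite ger0_norm ?sqr_ge0.
apply: sqr_int_of => //; apply: le_trans (le_Rintegral measurableT i2 i1 (fun x _ => le1 x)) _.
rewrite RintegralD//; [|exact: intgZ..]; rewrite !RintegralZl//.
have h1 : u * (2 * (A + 1)) = d by rewrite /u divfK// gt_eqF// mulr_gt0// ltr_wpDl.
have h2 : d / (2 * (1 + u^-1)) * (2 * (1 + u^-1)) = d by rewrite divfK// gt_eqF.
have u1 : 0 <= 1 + u^-1 by rewrite ltW// addr_gt0.
have h3 := ler_wpM2l (ltW u0) fA'; have h4 := ler_wpM2l u1 gt'.
lra.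
Qed.

Lemma rwdD j f1 f2 g1 g2 : locint f1 -> locint f2 -> locint g1 -> locint g2 ->
  rwd j f1 g1 -> rwd j f2 g2 -> rwd j (fun x => f1 x + f2 x) (fun x => g1 x + g2 x).
Proof.
move=> lf1 lf2 lg1 lg2 h1 h2 B tB.
have tB' := testB_updd j tB; have [r1 b1] := boxed_tensor tB; have [r2 b2] := boxed_tensor tB'.
under eq_Rintegral => x _ do rewrite mulrDl.
under [X in _ = - X]eq_Rintegral => x _ do rewrite mulrDl.
rewrite !RintegralD// ?(h1 _ tB) ?(h2 _ tB) ?opprD//.
- by apply: (@locint_mul _ _ _ _ r1) => //; exact: bmf_tensor.
- by apply: (@locint_mul _ _ _ _ r1) => //; exact: bmf_tensor.
- by apply: (@locint_mul _ _ _ _ r2) => //; exact: bmf_tensor.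
- by apply: (@locint_mul _ _ _ _ r2) => //; exact: bmf_tensor.
Qed.

End square_integrable.

Section moll_estimates.
Context {R : realType} {n : nat}.
Local Notation leb := (@lebesgue_measure R).
Local Notation mu := (@lebesgue_rV R n).
Local Notation RV := (measurableTypeR R * 'rV[R]_n)%type.
Variables (F : R -> 'rV[R]_n -> R) (M : R).
Hypothesis mF : measurable_fun setT (fun z : RV => F z.1 z.2).
Hypothesis FM : forall t x, `|F t x| <= M.

Let mFt t : measurable_fun setT (F t).
Proof. exact: (measurableT_comp mF (measurable_pair1 t)). Qed.

Lemma locint_slice t : locint (F t).
Proof. by apply: bmf_locint; split => //; exists M => x; exact: FM. Qed.

(** By [sconv_rwd] this is a mollification of weak derivatives, and mollifying increases the square
    norm neither in space nor in time. *)
Lemma moll_j_sqr_le e j t K : 0 < e -> 0 <= K ->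
  (forall s, `|s - t| < e -> exists2 g, sqr_int g K & rwd j (F s) g) ->
  (\int[mu]_x ((moll_j F e j t x) ^+ 2)%:E <= K%:E)%E.
Proof.
move=> e0 K0 H; have t0 : testB (kaps e : 'I_n -> R -> R) by exact: kaps_testB.
apply: (sqr_conv_le mF FM) => //; first exact: (testB_upd _ t0 (test1_derive (kap_test1 e))).
move=> s /H [g [mg gK] wg]; apply: le_trans gK.
rewrite (eq_integral (fun x : 'rV[R]_n => ((\int[mu]_y (g y * tensor (kaps e) (x - y))) ^+ 2)%:E)).
  exact: sqr_sconv_le.
by move=> x _; rewrite (sconv_rwd _ t0 wg).
Qed.

Lemma moll_jj_sqr_le e j t K : 0 < e -> 0 <= K ->
  (forall s, `|s - t| < e -> exists2 g, sqr_int g K & rwd2 j (F s) g) ->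
  (\int[mu]_x ((moll_jj F e j t x) ^+ 2)%:E <= K%:E)%E.
Proof.
move=> e0 K0 H; have t0 : testB (kaps e : 'I_n -> R -> R) by exact: kaps_testB.
apply: (sqr_conv_le mF FM) => //.
  exact: (testB_upd _ t0 (test1_derive (test1_derive (kap_test1 e)))).
move=> s /H [g [mg gK] wg]; apply: le_trans gK.
rewrite (eq_integral (fun x : 'rV[R]_n => ((\int[mu]_y (g y * tensor (kaps e) (x - y))) ^+ 2)%:E)).
  exact: sqr_sconv_le.
by move=> x _; rewrite (sconv_rwd2 _ t0 wg).
Qed.

Lemma moll_le e t x : 0 < e -> `|moll F e t x| <= M.
Proof.
move=> e0; have := @conv_approx _ _ F M mF FM e t x 0 M e0.
by rewrite subr0; apply => s y _ _; rewrite subr0.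
Qed.

Lemma moll_approx e t (x : 'rV[R]_n) w : 0 < e ->
  (forall s (y : 'rV[R]_n), `|s - t| < e -> (forall i, `|y 0 i - x 0 i| < e) -> `|F s y - F t x| <= w) ->
  `|moll F e t x - F t x| <= w.
Proof. by move=> e0 H; exact: (conv_approx mF FM). Qed.

(* No strong convergence of the gradients is needed: the weak derivative is approximated by *)
(* a test function psi, and 2 G psi - psi^2 only involves F, which converges uniformly.     *)
Lemma moll_j_lower (w : 'rV[R]_n -> R) j t G N (d : R) : 0 < d ->
  (forall s : R, 0 < s -> exists2 e, 0 < e & forall e', 0 < e' <= e -> forall x, `|moll F e' t x - F t x| <= s) ->
  span w -> (forall x, 0 <= w x) -> locint G -> rwd j (F t) G ->
  exists2 e, 0 < e & forall e', 0 < e' <= e ->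
    \int[mu]_x (w x * trunc G N x ^+ 2) - d <= \int[mu]_x (w x * moll_j F e' j t x ^+ 2).
Proof.
move=> d0 unif sw w0 lG wG; have [mG _] := lG.
have [_ [rw [_ bw _ _ _]]] := span_derivable j sw.
have bmw := bmf_span sw.
have wi : mu.-integrable setT (EFin \o w).
  have := locint_mul (bmf_locint (bmf_cst (1 : R))) bmw bw.
  by under eq_fun do rewrite mul1r.
have wGi : mu.-integrable setT (EFin \o (fun x => w x * G x)).
  by have := locint_mul lG bmw bw; under eq_fun do rewrite mulrC.
have d2 : 0 < d / 2 by lra.
have [psi sp hpsi] := span_quadratic_ge mG bmw.1 w0 wi wGi N d2.
have sphi := spanM sw sp; have [dphi [r [bdphi bx bdx phid Hphi]]] := span_derivable j sphi.
set phi := (fun x => w x * psi x) in sphi bx phid Hphi.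
set I := \int[mu]_x `|dphi x|.
have di : mu.-integrable setT (EFin \o dphi).
  have := locint_mul (bmf_locint (bmf_cst (1 : R))) bdphi bdx.
  by under eq_fun do rewrite mul1r.
have I0 : 0 <= I by apply: Rintegral_ge0.
(* At this uniform accuracy the integral against [dphi] changes by at most [d / 4]. It enters twice,
   and the remaining [d / 2] was spent on [psi]. *)
have s0 : 0 < d / (4 * (I + 1)) by rewrite divr_gt0// mulr_gt0// ltr_wpDl.
have [e e0 He] := unif _ s0; exists e => // e' e'e; have [e'0 _] := andP e'e.
have jF := moll_jet mF FM e'.
have [mP [C PC]] := jet_b jF; have [mPj [Cj PjC]] := jet_jb jF j.
have bP : bmf (moll F e' t) by split => //; exists C.
have bPj : bmf (moll_j F e' j t) by split => //; exists Cj.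
have bphi := bmf_span sphi.
have E1 : \int[mu]_x (moll_j F e' j t x * phi x) = - \int[mu]_x (moll F e' t x * dphi x).
  have i1 := locint_mul (bmf_locint bPj) bphi bx.
  have i2 := locint_mul (bmf_locint bP) bdphi bdx.
  apply/eqP; rewrite -addr_eq0 -RintegralD//; apply/eqP.
  have bf := bmfM bP bphi; have bf' := bmfD (bmfM bPj bphi) (bmfM bP bdphi).
  have [mf [C1 fC1]] := bf; have [mf' [C2 fC2]] := bf'.
  apply: (integral_pderiv_eq0 (f := fun x => moll F e' t x * phi x) (j := j) (r := r) mf mf' _ _ _ fC1 fC2).
  + move=> x; have h1 := jet_j jF j t x; have h2 := phid x.
    have -> : (fun x => moll F e' t x * phi x) = moll F e' t \* phi by [].
    by apply: is_derive_eq; rewrite /GRing.scale/=; ring.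
  + by move=> x nx; rewrite bx// mulr0.
  + by move=> x nx; rewrite bx// bdx// !mulr0 addr0.
have E2 := Hphi _ _ (locint_slice t) lG wG.
have lP := locint_mul (bmf_locint bP) bdphi bdx.
have lF := locint_mul (locint_slice t) bdphi bdx.
have E3 : `|\int[mu]_x (moll F e' t x * dphi x) - \int[mu]_x (F t x * dphi x)| <= d / 4.
  rewrite -RintegralB//; apply: le_trans (le_normr_Rintegral _ _) _ => //; first exact: intgB.
  apply: (@le_trans _ _ (d / (4 * (I + 1)) * I)).
    rewrite /I -RintegralZl//; last exact: integrable_norm.
    apply: le_Rintegral => //.
    - exact: (integrable_norm (intgB lP lF)).
    - by apply: intgZ; exact: integrable_norm.
    by move=> x _; rewrite -mulrBl normrM ler_wpM2r// He.
  have h1 : d / (4 * (I + 1)) * (4 * (I + 1)) = d by rewrite divfK// gt_eqF// mulr_gt0// ltr_wpDl.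
  by have := ltW s0; lra.
have bpsi := bmf_span sp.
have iPP : mu.-integrable setT (EFin \o (fun x => w x * moll_j F e' j t x ^+ 2)).
  have := locint_mul (bmf_locint (bmfM bPj bPj)) bmw bw.
  by under eq_fun do rewrite mulrC -expr2.
have ipp : mu.-integrable setT (EFin \o (fun x => w x * psi x ^+ 2)).
  have := locint_mul (bmf_locint (bmfM bpsi bpsi)) bmw bw.
  by under eq_fun do rewrite mulrC -expr2.
have iPp := locint_mul (bmf_locint bPj) bphi bx.
have iGp := locint_mul lG bphi bx.
(* The integral of [w (moll_j - psi)^2] is nonnegative. *)
have E4 : 2 * \int[mu]_x (moll_j F e' j t x * phi x) - \int[mu]_x (w x * psi x ^+ 2) <=
    \int[mu]_x (w x * moll_j F e' j t x ^+ 2).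
  rewrite -RintegralZl// -RintegralB//; last exact: intgZ.
  apply: le_Rintegral => //; first by apply: intgB => //; exact: intgZ.
  move=> x _; rewrite -subr_ge0 /phi.
  rewrite (_ : _ - _ = w x * (moll_j F e' j t x - psi x) ^+ 2); last by ring.
  by rewrite mulr_ge0// sqr_ge0.
have E5 : \int[mu]_x (w x * (2 * G x * psi x - psi x ^+ 2)) =
    2 * \int[mu]_x (G x * phi x) - \int[mu]_x (w x * psi x ^+ 2).
  rewrite -RintegralZl// -RintegralB//; last exact: intgZ.
  by apply: eq_Rintegral => x _; rewrite /phi; ring.
move: E3; rewrite ler_norml => /andP[E3 E3'].
rewrite E5 in hpsi; lra.
Qed.

End moll_estimates.

Lemma fatou_le {R : realType} d {T : measurableType d} (m : {measure set T -> \bar R})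
    (f_ : nat -> T -> R) (f : T -> R) (l : nat -> R) (L : R) :
  (forall k, measurable_fun setT (f_ k)) -> (forall k x, 0 <= f_ k x) ->
  (forall x, f_ ^~ x @ \oo --> f x) ->
  (\forall k \near \oo, (\int[m]_x (f_ k x)%:E <= (l k)%:E)%E) -> l @ \oo --> L ->
  (\int[m]_x (f x)%:E <= L%:E)%E.
Proof.
move=> mf f0 ff fl lL; apply/lee_addgt0Pr => e e0.
have : (\int[m]_x limn_einf (fun k => (f_ k x)%:E) <= limn_einf (fun k => \int[m]_x (f_ k x)%:E))%E.
  apply: (@fatou _ _ _ m setT measurableT (fun k x => (f_ k x)%:E)).
    by move=> k; exact/measurable_EFinP.
  by move=> k x _; rewrite lee_fin.
rewrite (eq_integral (fun x => (f x)%:E)); last first.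
  move=> x _; have h : (fun k => (f_ k x)%:E) @ \oo --> (f x)%:E.
    by apply: cvg_EFin; [exact: nearW|exact: ff].
  by have [] := cvg_limn_einf_sup h.
move=> /le_trans; apply; rewrite limn_einf_lim.
apply: lime_le; first exact: is_cvg_einfs.
have Le : \forall k \near \oo, l k <= L + e.
  by apply: (cvgr_le L lL); rewrite ltrDl.
near=> k; apply: (@le_trans _ _ (\int[m]_x (f_ k x)%:E)%E).
  by apply: ereal_inf_lbound; exists k => /=.
apply: (@le_trans _ _ (l k)%:E); first by near: k.
by rewrite -EFinD lee_fin; near: k.
Unshelve. all: by end_near. Qed.

(** Each term may err by [d / (n + 1)]: after halving, the [n] pairs of gradients cost [n] shares,
    and the potential at most one more. *)
Lemma quad_le {R : realFieldType} (n : nat) (S1 S2 X Y d : R) :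
  S1 <= S2 + n%:R * (2 * (d / n.+1%:R)) -> X - Y <= d / n.+1%:R -> 0 < d ->
  2^-1 * S1 + 4^-1 * X <= 2^-1 * S2 + 4^-1 * Y + d.
Proof.
move=> h1 h2 d0; have d'0 : 0 < d / n.+1%:R by rewrite divr_gt0.
have E : d / n.+1%:R * (n%:R + 1) = d by rewrite natr1 divfK.
move: h1 h2 d'0 E; set d' := d / _ => h1 h2 d'0 E.
have h6 : 2^-1 * (n%:R * (2 * d')) = n%:R * d' by field.
lra.
Qed.

(** * The energy inequality on a time slab *)

Section slab.
Context {R : realType} {n : nat}.
Local Notation leb := (@lebesgue_measure R).
Local Notation mu := (@lebesgue_rV R n).
Local Notation RV := (measurableTypeR R * 'rV[R]_n)%type.
Variables (p q : R -> 'rV[R]_n -> R) (a b M K : R).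

(* Real and imaginary parts of a solution on ]a, b[, extended to all times by its values at *)
(* the end points; the last two fields are the equation tested against mollifiers.          *)
Record slab : Prop := Slab {
  slab_m1 : measurable_fun setT (fun z : RV => p z.1 z.2);
  slab_m2 : measurable_fun setT (fun z : RV => q z.1 z.2);
  slab_b1 : forall t x, `|p t x| <= M;
  slab_b2 : forall t x, `|q t x| <= M;
  slab_uc : forall w : R, 0 < w -> exists2 e : R, 0 < e & forall s t (x y : 'rV[R]_n),
    `|s - t| < e -> (forall i, `|y 0 i - x 0 i| < e) ->
    `|p s y - p t x| <= w /\ `|q s y - q t x| <= w;
  slab_K : 0 <= K;
  slab_g1 : forall s j, exists2 g, sqr_int g K & rwd j (p s) g;
  slab_g2 : forall s j, exists2 g, sqr_int g K & rwd j (q s) g;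
  slab_h1 : forall s j, exists2 g, sqr_int g K & rwd2 j (p s) g;
  slab_h2 : forall s j, exists2 g, sqr_int g K & rwd2 j (q s) g;
  slab_eq1 : forall e t x, 0 < e -> a + e <= t <= b - e ->
    moll_t p e t x = - (\sum_(j < n) moll_jj q e j t x +
      moll (fun s y => q s y * defect p q s y) e t x);
  slab_eq2 : forall e t x, 0 < e -> a + e <= t <= b - e ->
    moll_t q e t x = \sum_(j < n) moll_jj p e j t x +
      moll (fun s y => p s y * defect p q s y) e t x }.

Hypothesis S : slab.

Let M0 : 0 <= M.
Proof. exact: le_trans (normr_ge0 _) (slab_b1 S 0 0). Qed.

Let near0 (P : R -> Prop) : (exists2 e, 0 < e & forall e', 0 < e' <= e -> P e') ->
  \forall e \near (0 : R)^'+, P e.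
Proof.
move=> [e e0 H]; near=> e'; apply: H; apply/andP; split; near: e'.
  exact: nbhs_right_gt.
exact: nbhs_right_le.
Unshelve. all: by end_near. Qed.

(** The difference telescopes into one linear and six cubic terms, each containing a difference of
    size [w]. *)
Let cubic_lip x y x' y' w : `|x| <= M -> `|y| <= M -> `|x'| <= M -> `|y'| <= M ->
  `|x - x'| <= w -> `|y - y'| <= w ->
  `|x * (1 - x * x - y * y) - x' * (1 - x' * x' - y' * y')| <= (1 + 6 * M ^+ 2) * w.
Proof.
move=> hx hy hx' hy' hw hw'.
have w0 : 0 <= w by exact: le_trans hw.
have -> : x * (1 - x * x - y * y) - x' * (1 - x' * x' - y' * y') =
  (x - x') - (x - x') * (x * x) - (x - x') * (y * y) -
  x' * x * (x - x') - x' * x' * (x - x') - x' * y * (y - y') - x' * y' * (y - y') by ring.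
have m2 u v : `|u| <= M -> `|v| <= M -> `|u * v| <= M ^+ 2.
  by move=> hu hv; rewrite normrM expr2 ler_pM.
have m3 d u v : `|d| <= w -> `|u| <= M -> `|v| <= M -> `|d * (u * v)| <= w * M ^+ 2.
  by move=> hd hu hv; rewrite normrM ler_pM// m2.
have m3' d u v : `|d| <= w -> `|u| <= M -> `|v| <= M -> `|u * v * d| <= w * M ^+ 2.
  by move=> hd hu hv; rewrite mulrC m3.
have t1 := m3 _ _ _ hw hx hx; have t2 := m3 _ _ _ hw hy hy.
have t3 := m3' _ _ _ hw hx' hx; have t4 := m3' _ _ _ hw hx' hx'.
have t5 := m3' _ _ _ hw' hx' hy; have t6 := m3' _ _ _ hw' hx' hy'.
move: hw; rewrite (_ : (1 + _) * w = w + 6 * (w * M ^+ 2)); last by ring.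
by move: t1 t2 t3 t4 t5 t6; rewrite !ler_norml => /andP[? ?] /andP[? ?] /andP[? ?] /andP[? ?] /andP[? ?] /andP[? ?] /andP[? ?]; apply/andP; split; lra.
Qed.

Let cubic_lip2 x y x' y' w : `|x| <= M -> `|y| <= M -> `|x'| <= M -> `|y'| <= M ->
  `|x - x'| <= w -> `|y - y'| <= w ->
  `|y * (1 - x * x - y * y) - y' * (1 - x' * x' - y' * y')| <= (1 + 6 * M ^+ 2) * w.
Proof.
move=> hx hy hx' hy' hw hw'.
rewrite [X in `|X|](_ : _ = y * (1 - y * y - x * x) - y' * (1 - y' * y' - x' * x')); last by ring.
exact: cubic_lip.
Qed.

Let defect_le x y x' y' w : `|x| <= M -> `|y| <= M -> `|x'| <= M -> `|y'| <= M ->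
  `|x - x'| <= w -> `|y - y'| <= w ->
  `|(1 - x * x - y * y) * (1 - x * x - y * y) - (1 - x' * x' - y' * y') * (1 - x' * x' - y' * y')|
    <= 8 * M * (1 + 2 * M ^+ 2) * w.
Proof.
move=> hx hy hx' hy' hw hw'.
have w0 : 0 <= w by exact: le_trans hw.
rewrite (_ : _ - _ = - ((x - x') * (x + x') + (y - y') * (y + y')) *
  ((1 - x * x - y * y) + (1 - x' * x' - y' * y'))); last by ring.
have m2 u v : `|u| <= M -> `|v| <= M -> `|u * v| <= M ^+ 2.
  by move=> hu hv; rewrite normrM expr2 ler_pM.
have m1 d u v : `|d| <= w -> `|u| <= M -> `|v| <= M -> `|d * (u + v)| <= w * (2 * M).
  by move=> hd hu hv; rewrite normrM ler_pM//; apply: le_trans (ler_normD _ _) _; lra.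
rewrite (_ : _ * w = (4 * M * w) * (2 * (1 + 2 * M ^+ 2))); last by ring.
rewrite normrM; apply: ler_pM => //.
  rewrite normrN; apply: le_trans (ler_normD _ _) _.
  by have := m1 _ _ _ hw hx hx'; have := m1 _ _ _ hw' hy hy'; lra.
move: (m2 _ _ hx hx) (m2 _ _ hy hy) (m2 _ _ hx' hx') (m2 _ _ hy' hy').
by rewrite !ler_norml => /andP[? ?] /andP[? ?] /andP[? ?] /andP[? ?]; apply/andP; split; lra.
Qed.

Let F1 s y := p s y * defect p q s y.
Let F2 s y := q s y * defect p q s y.

Let mdef : measurable_fun setT (fun z : RV => defect p q z.1 z.2).
Proof.
have m1 := slab_m1 S; have m2 := slab_m2 S.
by apply: measurable_funB; [apply: measurable_funB => //|]; exact: measurable_funM.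
Qed.

Let mF1 : measurable_fun setT (fun z : RV => F1 z.1 z.2).
Proof. by apply: measurable_funM; [exact: slab_m1 S|exact: mdef]. Qed.

Let mF2 : measurable_fun setT (fun z : RV => F2 z.1 z.2).
Proof. by apply: measurable_funM; [exact: slab_m2 S|exact: mdef]. Qed.

Let defb t x : `|defect p q t x| <= 1 + 2 * M ^+ 2.
Proof.
have m2 (u v : R) : `|u| <= M -> `|v| <= M -> `|u * v| <= M ^+ 2.
  by move=> hu hv; rewrite normrM expr2 ler_pM.
move: (m2 _ _ (slab_b1 S t x) (slab_b1 S t x)) (m2 _ _ (slab_b2 S t x) (slab_b2 S t x)).
by rewrite /defect !ler_norml => /andP[? ?] /andP[? ?]; apply/andP; split; lra.
Qed.

Let F1b t x : `|F1 t x| <= M * (1 + 2 * M ^+ 2).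
Proof. by rewrite normrM ler_pM// (slab_b1 S). Qed.

Let F2b t x : `|F2 t x| <= M * (1 + 2 * M ^+ 2).
Proof. by rewrite normrM ler_pM// (slab_b2 S). Qed.

(** Uniform continuity gives uniform convergence; it is used at [w / (1 + 6 M^2)] so that the
    nonlinear terms also come within [w]. *)
Lemma slab_approx w : 0 < w -> \forall e \near (0 : R)^'+, forall t x,
  [/\ `|moll p e t x - p t x| <= w, `|moll q e t x - q t x| <= w,
      `|moll F1 e t x - F1 t x| <= w & `|moll F2 e t x - F2 t x| <= w].
Proof.
move=> w0; have L1 : 1 <= 1 + 6 * M ^+ 2 by rewrite lerDl mulr_ge0// sqr_ge0.
have L0 : 0 < 1 + 6 * M ^+ 2 by exact: lt_le_trans L1.
have [e e0 He] := slab_uc S (divr_gt0 w0 L0).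
have wL : (1 + 6 * M ^+ 2) * (w / (1 + 6 * M ^+ 2)) = w by rewrite mulrC divfK// gt_eqF.
have ww : w / (1 + 6 * M ^+ 2) <= w by rewrite ler_pdivrMr// ler_peMr// ltW.
apply: near0; exists e => // e' /andP[e'0 e'e] t x.
have P s (y : 'rV[R]_n) : `|s - t| < e' -> (forall i, `|y 0 i - x 0 i| < e') ->
    `|p s y - p t x| <= w / (1 + 6 * M ^+ 2) /\ `|q s y - q t x| <= w / (1 + 6 * M ^+ 2).
  move=> st xy; apply: He; first exact: lt_le_trans e'e.
  by move=> i; apply: lt_le_trans e'e.
split.
- apply: (moll_approx (slab_m1 S) (slab_b1 S)) => // s y st xy.
  by apply: le_trans ww; case: (P s y).
- apply: (moll_approx (slab_m2 S) (slab_b2 S)) => // s y st xy.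
  by apply: le_trans ww; case: (P s y).
- apply: (moll_approx mF1 F1b) => // s y st xy; have [h1 h2] := P s y st xy.
  have := cubic_lip (slab_b1 S s y) (slab_b2 S s y) (slab_b1 S t x) (slab_b2 S t x) h1 h2.
  by rewrite wL.
- apply: (moll_approx mF2 F2b) => // s y st xy; have [h1 h2] := P s y st xy.
  have := cubic_lip2 (slab_b1 S s y) (slab_b2 S s y) (slab_b1 S t x) (slab_b2 S t x) h1 h2.
  by rewrite wL.
Qed.

Let Mp e : 0 < e -> forall t x, `|moll p e t x| <= M.
Proof. by move=> e0 t x; exact: (moll_le (slab_m1 S) (slab_b1 S)). Qed.

Let Mq e : 0 < e -> forall t x, `|moll q e t x| <= M.
Proof. by move=> e0 t x; exact: (moll_le (slab_m2 S) (slab_b2 S)). Qed.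

(** The mollified functions solve the equation with mollified nonlinearity, so each residual is the
    commutator of mollification and nonlinearity. Both orders of composition are uniformly close to
    the nonlinearity of the original functions. *)
Lemma rem_small w : 0 < w -> \forall e \near (0 : R)^'+, forall t x, a + e <= t <= b - e ->
  `|rem1 (moll p e) (moll q e) (moll_t q e) (moll_jj p e) t x| <= w /\
  `|rem2 (moll p e) (moll_t p e) (moll q e) (moll_jj q e) t x| <= w.
Proof.
move=> w0; have L0 : 0 < 2 + 6 * M ^+ 2 by rewrite ltr_wpDr// mulr_ge0// sqr_ge0.
have w'0 := divr_gt0 w0 L0; set w' := w / _ in w'0.
near=> e => t x tab; have e0 : 0 < e by near: e; exact: nbhs_right_gt.
have [h1 h2 h3 h4] : [/\ `|moll p e t x - p t x| <= w', `|moll q e t x - q t x| <= w',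
      `|moll F1 e t x - F1 t x| <= w' & `|moll F2 e t x - F2 t x| <= w'].
  by move: t x {tab}; near: e; exact: slab_approx.
have wE : w' + (1 + 6 * M ^+ 2) * w' = w.
  rewrite (_ : _ + _ = w' * (2 + 6 * M ^+ 2)); last by ring.
  by rewrite /w' divfK// gt_eqF.
have c1 := cubic_lip (Mp e0 t x) (Mq e0 t x) (slab_b1 S t x) (slab_b2 S t x) h1 h2.
have c2 := cubic_lip2 (Mp e0 t x) (Mq e0 t x) (slab_b1 S t x) (slab_b2 S t x) h1 h2.
rewrite -wE; split.
  rewrite /rem1 (slab_eq2 S)// -/F1 [\sum_(j < n) _ + _]addrC addrK.
  rewrite -(subrKA (F1 t x)); apply: le_trans (ler_normD _ _) _; apply: lerD => //.
  by rewrite distrC.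
rewrite /rem2 (slab_eq1 S)// -/F2 opprK [\sum_(j < n) _ + _]addrC addrK.
rewrite -(subrKA (F2 t x)); apply: le_trans (ler_normD _ _) _; apply: lerD => //.
by rewrite distrC.
Unshelve. all: by end_near. Qed.

Definition menergy (N : R) e := loc_energy (moll p e) (moll q e) (moll_j p e) (moll_j q e) (eta N).

Let bmf_ubm (f : 'rV[R]_n -> R) : bmf f -> ubm (fun _ : R => f).
Proof. by move=> [mf [C fC]]; split => //; exists C. Qed.

(** The order of the choices matters: [C] and [L] precede [N], while [e] comes last and makes the
    residuals negligible even against the integral of [eta^2]. *)
Lemma menergy_growth : exists C L : R, [/\ 0 < C, 0 <= L & forall N s t : R,
  C <= N -> a < s < b -> a < t < b -> \forall e \near (0 : R)^'+,
  1 + menergy N e t <= (1 + menergy N e s) * expR (C / N * L * `|t - s|)].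
Proof.
have [C0 [C00 HC]] := @eta_j_le R n; pose C := C0 + 1.
have C0' : 0 < C by rewrite ltr_wpDl.
have L0 : 0 <= @rate_const R n M K.
  have K0 := slab_K S.
  by rewrite /rate_const !addr_ge0// ?mulr_ge0// ?addr_ge0// ?mulr_ge0// ?sqr_ge0.
exists C, (@rate_const R n M K); split => // N s t CN /andP[sa sb] /andP[ta tb].
have N0 : 0 < N by exact: lt_le_trans CN.
pose c := C / N; have c0 : 0 < c by exact: divr_gt0.
pose V := \int[mu]_x (eta N x * eta N x).
have V0 : 0 <= V by apply: Rintegral_ge0 => x _; rewrite -expr2 sqr_ge0.
(* This size of the residuals yields both [w <= c] and [w * V <= c]. *)
have w0 : 0 < c / (1 + V) by rewrite divr_gt0// ltr_wpDr.
have wE : c / (1 + V) * (1 + V) = c by rewrite divfK// gt_eqF// ltr_wpDr.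
near=> e; have e0 : 0 < e by near: e; exact: nbhs_right_gt.
have jp := moll_jet (slab_m1 S) (slab_b1 S) e; have jq := moll_jet (slab_m2 S) (slab_b2 S) e.
have ed (t : R) := loc_energy_is_derive jp jq (bmf_ubm (eta_bmf N0)) (fun j => bmf_ubm (eta_j_bmf j N0))
   (eta_boxed N0) (fun j x => eta_is_derive j x N0) t.
apply: (@exp_bound_sym R (fun t => 1 + menergy N e t) (fun t => \int[mu]_x
  loc_rate (moll p e) (moll_t p e) (moll q e) (moll_t q e) (moll_j p e) (moll_jj p e)
    (moll_j q e) (moll_jj q e) (eta N) (eta_j N) t x) (c * rate_const M K) s t).
- by rewrite mulr_ge0// ltW.
- by move=> u; rewrite -[X in is_derive _ _ _ X]add0r; exact: is_deriveD.
- move=> u su.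
  (* The mollified equation is available only at distance [e] from the ends of the slab; all times
     between [s] and [t] must qualify. *)
  have tab : a + e <= u <= b - e.
    have [h1 [h2 [h3 h4]]] : e <= s - a /\ e <= t - a /\ e <= b - s /\ e <= b - t.
      by do !split; near: e; apply: nbhs_right_le; rewrite subr_gt0.
    move: su; case: (leP s t) => st /andP[su ut]; apply/andP; split; lra.
  have [hr1 hr2] : (forall x, `|rem1 (moll p e) (moll q e) (moll_t q e) (moll_jj p e) u x| <= c / (1 + V)) /\
      (forall x, `|rem2 (moll p e) (moll_t p e) (moll q e) (moll_jj q e) u x| <= c / (1 + V)).
    suff H : forall t x, a + e <= t <= b - e ->
        `|rem1 (moll p e) (moll q e) (moll_t q e) (moll_jj p e) t x| <= c / (1 + V) /\
        `|rem2 (moll p e) (moll_t p e) (moll q e) (moll_jj q e) t x| <= c / (1 + V).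
      by split => x; case: (H u x tab).
    by near: e; exact: rem_small.
  apply: (loc_rate_bound jp jq (bmf_ubm (eta_bmf N0)) (fun j => bmf_ubm (eta_j_bmf j N0)) (eta_boxed N0)
    (c := c) (w := c / (1 + V))) => //.
  + by move=> x; exact: eta01.
  + move=> j x; apply: le_trans (HC _ _ _ N0) _; rewrite ler_wpM2r// ?invr_ge0 ?ltW//.
    by rewrite ltrDl.
  + exact: Mp.
  + exact: Mq.
  + by rewrite ler_pdivrMr ?ltr_wpDr// ler_peMr ?lerDl// ltW.
  + by rewrite ler_pdivrMr// mul1r.
  + by have := ltW w0; rewrite -/V; lra.
  + move=> j; apply: (moll_j_sqr_le (slab_m1 S) (slab_b1 S)) => //; first exact: slab_K S.
    by move=> s' _; exact: slab_g1 S s' j.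
  + move=> j; apply: (moll_j_sqr_le (slab_m2 S) (slab_b2 S)) => //; first exact: slab_K S.
    by move=> s' _; exact: slab_g2 S s' j.
  + move=> j; apply: (moll_jj_sqr_le (slab_m1 S) (slab_b1 S)) => //; first exact: slab_K S.
    by move=> s' _; exact: slab_h1 S s' j.
  + move=> j; apply: (moll_jj_sqr_le (slab_m2 S) (slab_b2 S)) => //; first exact: slab_K S.
    by move=> s' _; exact: slab_h2 S s' j.
Unshelve. all: by end_near. Qed.

Let iw N (f : 'rV[R]_n -> R) : 0 < N -> locint f ->
  mu.-integrable setT (EFin \o (fun x => eta N x * eta N x * f x)).
Proof.
move=> N0 lf; have be : bmf (eta N : 'rV[R]_n -> R) by exact: eta_bmf.
rewrite (_ : (fun x => _) = fun x => f x * (eta N x * eta N x)).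
  by apply: (@locint_mul _ _ f _ N lf (bmfM be be)); exact/boxedM/eta_boxed.
by apply/funext => x; rewrite mulrC.
Qed.

Let ubm_bmf (f : R -> 'rV[R]_n -> R) t : ubm f -> bmf (f t).
Proof. by move=> [mf [C fC]]; split => //; exists C. Qed.

Let bj1 e j t : bmf (moll_j p e j t).
Proof. exact: (ubm_bmf _ (jet_jb (moll_jet (slab_m1 S) (slab_b1 S) e) j)). Qed.

Let bj2 e j t : bmf (moll_j q e j t).
Proof. exact: (ubm_bmf _ (jet_jb (moll_jet (slab_m2 S) (slab_b2 S) e) j)). Qed.

Let bW e t : bmf (defect (moll p e) (moll q e) t).
Proof.
have b1 := ubm_bmf t (jet_b (moll_jet (slab_m1 S) (slab_b1 S) e)).
have b2 := ubm_bmf t (jet_b (moll_jet (slab_m2 S) (slab_b2 S) e)).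
exact: bmfB (bmfB (bmf_cst 1) (bmfM b1 b1)) (bmfM b2 b2).
Qed.

Let bW0 t : bmf (defect p q t).
Proof.
split; first exact: (measurableT_comp mdef (measurable_pair1 t)).
by exists (1 + 2 * M ^+ 2) => x; exact: defb.
Qed.

Let wint N f := \int[mu]_x (eta N x * eta N x * f x).

Let wint_quad N (G H : 'I_n -> 'rV[R]_n -> R) (W : 'rV[R]_n -> R) : 0 < N ->
  (forall j, locint (fun x => G j x ^+ 2)) -> (forall j, locint (fun x => H j x ^+ 2)) ->
  locint (fun x => W x ^+ 2) ->
  wint N (fun x => 2^-1 * (\sum_(j < n) (G j x ^+ 2 + H j x ^+ 2)) + 4^-1 * W x ^+ 2) =
  2^-1 * (\sum_(j < n) (wint N (fun x => G j x ^+ 2) + wint N (fun x => H j x ^+ 2))) +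
    4^-1 * wint N (fun x => W x ^+ 2).
Proof.
move=> N0 lG lH lW.
pose h j x := eta N x * eta N x * G j x ^+ 2 + eta N x * eta N x * H j x ^+ 2.
have hi j : mu.-integrable setT (EFin \o h j) by apply: intgD; exact: iw.
have Wi := iw N0 lW.
rewrite /wint; transitivity (\int[mu]_x (2^-1 * (\sum_(j < n) h j x) +
    4^-1 * (eta N x * eta N x * W x ^+ 2))).
  apply: eq_Rintegral => x _; rewrite mulrDr mulrCA mulr_sumr; congr (_ + _); last by rewrite mulrCA.
  by congr (_ * _); apply: eq_bigr => j _; rewrite mulrDr.
have si := @intg_sum _ _ _ mu 'I_n (index_enum _) h hi.
rewrite RintegralD//; [|exact: intgZ..].
rewrite !RintegralZl// Rintegral_sumf//; congr (_ * _ + _); apply: eq_bigr => j _.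
by rewrite RintegralD//; exact: iw.
Qed.

Lemma menergyE N e t : 0 < N -> menergy N e t =
  2^-1 * (\sum_(j < n) (wint N (fun x => moll_j p e j t x ^+ 2) + wint N (fun x => moll_j q e j t x ^+ 2))) +
    4^-1 * wint N (fun x => defect (moll p e) (moll q e) t x ^+ 2).
Proof.
move=> N0; rewrite -wint_quad//; first last.
- by apply: bmf_locint; apply: bmf_sqr.
- by move=> j; apply: bmf_locint; apply: bmf_sqr.
- by move=> j; apply: bmf_locint; apply: bmf_sqr.
Qed.

(** Uniform convergence suffices: [eta] has compact support and the squared defect is Lipschitz by
    [defect_le]. *)
Let wint_pot N d : 0 < N -> 0 < d -> \forall e \near (0 : R)^'+, forall t,
  `|wint N (fun x => defect (moll p e) (moll q e) t x ^+ 2) - wint N (fun x => defect p q t x ^+ 2)| <= d.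
Proof.
move=> N0 d0; pose V := wint N (fun=> 1).
have V0 : 0 <= V by apply: Rintegral_ge0 => x _; rewrite mulr1 -expr2 sqr_ge0.
pose L := 8 * M * (1 + 2 * M ^+ 2) * V.
have L0 : 0 <= L by rewrite !mulr_ge0// addr_ge0// mulr_ge0// sqr_ge0.
have w0 : 0 < d / (1 + L) by rewrite divr_gt0// ltr_wpDr.
near=> e => t; have e0 : 0 < e by near: e; exact: nbhs_right_gt.
have hw x : `|moll p e t x - p t x| <= d / (1 + L) /\ `|moll q e t x - q t x| <= d / (1 + L).
  suff [] : [/\ `|moll p e t x - p t x| <= d / (1 + L), `|moll q e t x - q t x| <= d / (1 + L),
      `|moll F1 e t x - F1 t x| <= d / (1 + L) & `|moll F2 e t x - F2 t x| <= d / (1 + L)] by [].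
  by move: t x; near: e; exact: slab_approx.
have i1 := iw N0 (bmf_locint (bmf_sqr (bW e t))); have i2 := iw N0 (bmf_locint (bmf_sqr (bW0 t))).
have i0 := iw N0 (bmf_locint (bmf_cst 1)).
rewrite /wint -RintegralB//; apply: le_trans (le_normr_Rintegral _ _) _ => //; first exact: intgB.
apply: (@le_trans _ _ (8 * M * (1 + 2 * M ^+ 2) * (d / (1 + L)) * V)); last first.
  have E : d / (1 + L) * (1 + L) = d by rewrite divfK// gt_eqF// ltr_wpDr.
  rewrite (_ : _ * V = d / (1 + L) * L); last by rewrite /L; ring.
  by have := ltW w0; lra.
rewrite /V /wint -RintegralZl//; apply: le_Rintegral => //.
- exact: (integrable_norm (intgB i1 i2)).
- exact: intgZ.
move=> x _; have [h1 h2] := hw x.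
have := defect_le (Mp e0 t x) (Mq e0 t x) (slab_b1 S t x) (slab_b2 S t x) h1 h2.
rewrite -!expr2 => h; rewrite -mulrBr normrM mulr1 ger0_norm -?expr2 ?sqr_ge0// mulrC.
by rewrite ler_wpM2r// sqr_ge0.
Unshelve. all: by end_near. Qed.

Section time_slices.
Variables (N : R) (N0 : 0 < N).

(* Stated with increments because weak gradients are only defined up to null sets. *)
Definition grad_cont (f : R -> 'rV[R]_n -> R) s := forall th : R, 0 < th -> exists2 r : R, 0 < r &
  forall tau, `|tau - s| < r -> forall j,
    exists2 g, sqr_int g th & rwd j (fun x => f tau x - f s x) g.

(** Mollifying averages the gradients at times within [e] of [s]. By [grad_cont] each of them is [G]
    plus an error of small square norm, and [sqr_intD_close] bounds its square norm by [A + d]. *)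
Let grad_upper (f : R -> 'rV[R]_n -> R) Mf s j G A d :
  measurable_fun setT (fun z : RV => f z.1 z.2) -> (forall t x, `|f t x| <= Mf) ->
  0 < d -> sqr_int G A -> rwd j (f s) G -> grad_cont f s ->
  \forall e \near (0 : R)^'+, wint N (fun x => moll_j f e j s x ^+ 2) <= A + d.
Proof.
move=> mf fM d0 GA wG cf; have [th th0 Hth] := sqr_intD_close d0 GA.
have [r r0 Hr] := cf _ th0; have [_ GA'] := sqr_intP GA.
have A0 : 0 <= A by apply: le_trans GA'; apply: Rintegral_ge0 => x _; exact: sqr_ge0.
near=> e; have e0 : 0 < e by near: e; exact: nbhs_right_gt.
have er : e < r by near: e; exact: nbhs_right_lt.
have bmj := ubm_bmf s (jet_jb (moll_jet mf fM e) j).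
have [|i1 i2] := @sqr_intP _ _ (moll_j f e j s) (A + d).
  split; first exact: bmj.1.
  apply: (moll_j_sqr_le mf fM) => //; first by rewrite addr_ge0// ltW.
  move=> tau ts; have [|g gth wg] := Hr tau _ j; first exact: lt_trans er.
  exists (fun x => G x + g x); first exact: Hth.
  have -> : f tau = fun x => f s x + (f tau x - f s x).
    by apply/funext => x; rewrite addrC subrK.
  apply: rwdD => //; [exact: (locint_slice mf fM)| |exact: (sqr_int_locint GA)|exact: (sqr_int_locint gth)].
  have bf t : bmf (f t).
    by split; [exact: (measurableT_comp mf (measurable_pair1 t))|exists Mf].
  exact: bmf_locint (bmfB (bf _) (bf _)).
apply: le_trans i2; apply: le_Rintegral => //; first exact: (iw N0 (bmf_locint (bmf_sqr bmj))).
move=> x _; rewrite ler_piMl ?sqr_ge0//; have /andP[h1 h2] := eta01 N x.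
by rewrite mulr_ile1.
Unshelve. all: by end_near. Qed.

Lemma menergy_upper s (G H : 'I_n -> 'rV[R]_n -> R) (A B : 'I_n -> R) W d : 0 < d ->
  (forall j, sqr_int (G j) (A j)) -> (forall j, sqr_int (H j) (B j)) ->
  (forall j, rwd j (p s) (G j)) -> (forall j, rwd j (q s) (H j)) ->
  grad_cont p s -> grad_cont q s -> sqr_int (defect p q s) W ->
  \forall e \near (0 : R)^'+,
    menergy N e s <= 2^-1 * (\sum_(j < n) (A j + B j)) + 4^-1 * W + d.
Proof.
move=> d0 GA HB wG wH cp cq sW; pose d' := d / n.+1%:R.
have d'0 : 0 < d' by rewrite divr_gt0.
have [Wi W'] := sqr_intP sW.
near=> e; rewrite menergyE//.
have h1 : forall j, wint N (fun x => moll_j p e j s x ^+ 2) <= A j + d'.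
  near: e; apply: filter_forall => j.
  exact: (grad_upper (slab_m1 S) (slab_b1 S) d'0 (GA j) (wG j)).
have h2 : forall j, wint N (fun x => moll_j q e j s x ^+ 2) <= B j + d'.
  near: e; apply: filter_forall => j.
  exact: (grad_upper (slab_m2 S) (slab_b2 S) d'0 (HB j) (wH j)).
have h3 : `|wint N (fun x => defect (moll p e) (moll q e) s x ^+ 2) - wint N (fun x => defect p q s x ^+ 2)| <= d'.
  suff h t : `|wint N (fun x => defect (moll p e) (moll q e) t x ^+ 2) - wint N (fun x => defect p q t x ^+ 2)| <= d'.
    exact: h.
  by move: t; near: e; exact: wint_pot.
have h4 : wint N (fun x => defect p q s x ^+ 2) <= W.
  apply: le_trans W'; apply: le_Rintegral => //; first exact: (iw N0 (bmf_locint (bmf_sqr (bW0 s)))).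
  move=> x _; rewrite ler_piMl ?sqr_ge0//; have /andP[? ?] := eta01 N x.
  by rewrite mulr_ile1.
have h5 : \sum_(j < n) (wint N (fun x => moll_j p e j s x ^+ 2) + wint N (fun x => moll_j q e j s x ^+ 2)) <=
    \sum_(j < n) (A j + B j) + n%:R * (2 * d').
  rewrite mulr_natl -[X in _ *+ X](card_ord n) -sumr_const -big_split/=.
  apply: ler_sum => j _; apply: le_trans (lerD (h1 j) (h2 j)) _.
  by rewrite addrACA mulr_natl mulr2n.
move: h3; rewrite ler_norml => /andP[_ h3].
apply: le_trans (quad_le h5 h3 d0) _.
by rewrite lerD2r lerD2l ler_wpM2l.
Unshelve. all: by end_near. Qed.

Let grad_lower (f : R -> 'rV[R]_n -> R) Mf t j G k d :
  measurable_fun setT (fun z : RV => f z.1 z.2) -> (forall t x, `|f t x| <= Mf) -> 0 < d ->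
  (forall s : R, 0 < s -> exists2 e, 0 < e & forall e', 0 < e' <= e -> forall x, `|moll f e' t x - f t x| <= s) ->
  locint G -> rwd j (f t) G ->
  \forall e \near (0 : R)^'+, wint N (fun x => trunc G k x ^+ 2) - d <= wint N (fun x => moll_j f e j t x ^+ 2).
Proof.
move=> mf fM d0 unif GK wG; apply: near0.
apply: (moll_j_lower mf fM k d0 unif _ _ GK wG); first by apply: spanM; exact: eta_span.
by move=> x; rewrite -expr2 sqr_ge0.
Qed.

(** The gradient terms come from [moll_j_lower] with the weight [eta^2], an element of the span; the
    potential term converges by [wint_pot]. *)
Lemma menergy_lower t (G H : 'I_n -> 'rV[R]_n -> R) k d : 0 < d ->
  (forall j, locint (G j)) -> (forall j, locint (H j)) ->
  (forall j, rwd j (p t) (G j)) -> (forall j, rwd j (q t) (H j)) ->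
  \forall e \near (0 : R)^'+,
    wint N (fun x => 2^-1 * (\sum_(j < n) (trunc (G j) k x ^+ 2 + trunc (H j) k x ^+ 2)) +
       4^-1 * defect p q t x ^+ 2) - d <= menergy N e t.
Proof.
move=> d0 GK HK wG wH; pose d' := d / n.+1%:R.
have d'0 : 0 < d' by rewrite divr_gt0.
have lt (f : 'rV[R]_n -> R) : locint f -> locint (fun x => trunc f k x ^+ 2).
  by move=> [mf _]; apply: bmf_locint; apply: bmf_sqr; exact: bmf_trunc.
rewrite wint_quad//; first last.
- by apply: bmf_locint; exact: bmf_sqr.
- by move=> j; exact: lt.
- by move=> j; exact: lt.
have apx : forall s : R, 0 < s -> exists2 e, 0 < e & forall e', 0 < e' <= e -> forall t x,
    `|moll p e' t x - p t x| <= s /\ `|moll q e' t x - q t x| <= s.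
  move=> s s0; have := slab_approx s0; rewrite near_withinE => /nbhs_ballP[r /= r0 Hr].
  exists (r / 2); first exact: divr_gt0.
  move=> e' /andP[e'0 e'r] t' x; have [] := Hr e' _ e'0 t' x; last by [].
  by rewrite /ball/= sub0r normrN gtr0_norm//; lra.
have low1 j := grad_lower k (slab_m1 S) (slab_b1 S) d'0
  (fun s s0 => let: ex_intro2 e e0 He := apx s s0 in ex_intro2 _ _ e e0 (fun e' h x => (He e' h t x).1)) (GK j) (wG j).
have low2 j := grad_lower k (slab_m2 S) (slab_b2 S) d'0
  (fun s s0 => let: ex_intro2 e e0 He := apx s s0 in ex_intro2 _ _ e e0 (fun e' h x => (He e' h t x).2)) (HK j) (wH j).
near=> e; rewrite menergyE//.
have h12 : forall j,
    wint N (fun x => trunc (G j) k x ^+ 2) - d' <= wint N (fun x => moll_j p e j t x ^+ 2) /\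
    wint N (fun x => trunc (H j) k x ^+ 2) - d' <= wint N (fun x => moll_j q e j t x ^+ 2).
  near: e; apply: filter_forall => j; apply: filterS2 (low1 j) (low2 j) => e u v; exact (conj u v).
have h3 : `|wint N (fun x => defect (moll p e) (moll q e) t x ^+ 2) - wint N (fun x => defect p q t x ^+ 2)| <= d'.
  suff h t' : `|wint N (fun x => defect (moll p e) (moll q e) t' x ^+ 2) - wint N (fun x => defect p q t' x ^+ 2)| <= d'.
    exact: h.
  by move: t'; near: e; exact: wint_pot.
have h5 : \sum_(j < n) (wint N (fun x => trunc (G j) k x ^+ 2) + wint N (fun x => trunc (H j) k x ^+ 2)) <=
  \sum_(j < n) (wint N (fun x => moll_j p e j t x ^+ 2) + wint N (fun x => moll_j q e j t x ^+ 2)) + n%:R * (2 * d').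
  rewrite mulr_natl -[X in _ *+ X](card_ord n) -sumr_const -big_split/=.
  apply: ler_sum => j _; rewrite mulr_natl mulr2n addrACA; apply: lerD.
    rewrite -lerBlDr; exact (h12 j).1.
  rewrite -lerBlDr; exact (h12 j).2.
move: h3; rewrite ler_norml => /andP[h3 _].
by rewrite lerNl opprB in h3; rewrite lerBlDr; exact: quad_le h5 h3 d0.
Unshelve. all: by end_near. Qed.

End time_slices.

(* The mollification parameter tends to 0 first; the cutoff is removed by Fatou's lemma. *)
Lemma energy_le s t (G H G' H' : 'I_n -> 'rV[R]_n -> R) (A B : 'I_n -> R) W :
  a < s < b -> a < t < b ->
  (forall j, sqr_int (G j) (A j)) -> (forall j, sqr_int (H j) (B j)) ->
  (forall j, rwd j (p s) (G j)) -> (forall j, rwd j (q s) (H j)) ->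
  grad_cont p s -> grad_cont q s -> sqr_int (defect p q s) W ->
  (forall j, locint (G' j)) -> (forall j, locint (H' j)) ->
  (forall j, rwd j (p t) (G' j)) -> (forall j, rwd j (q t) (H' j)) ->
  (\int[mu]_x (2^-1 * (\sum_(j < n) (G' j x ^+ 2 + H' j x ^+ 2)) + 4^-1 * defect p q t x ^+ 2)%:E
    <= (2^-1 * (\sum_(j < n) (A j + B j)) + 4^-1 * W)%:E)%E.
Proof.
move=> sab tab GA HB wG wH cp cq sW GK HK wG' wH'.
set ES := _ + _; have [C [L [C0 L0 HC]]] := menergy_growth.
(* One index drives both the cutoff scale and the truncation level, so a single limit removes
   both. *)
pose f k x := 2^-1 * (\sum_(j < n) (trunc (G' j) k.+1%:R x ^+ 2 + trunc (H' j) k.+1%:R x ^+ 2)) +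
  4^-1 * defect p q t x ^+ 2.
have bf k : bmf (f k).
  have bt (g : 'I_n -> 'rV[R]_n -> R) : (forall j, locint (g j)) ->
      forall j, bmf (fun x => trunc (g j) k.+1%:R x ^+ 2).
    by move=> gK j; apply: bmf_sqr; apply: bmf_trunc; case: (gK j).
  apply: bmfD; apply: bmfZ; last exact: bmf_sqr.
  elim: (index_enum _) => [|j r IH].
    by under eq_fun do rewrite big_nil; exact: bmf_cst.
  by under eq_fun do rewrite big_cons; apply: bmfD => //; apply: bmfD; exact: bt.
have f0 k x : 0 <= f k x.
  by rewrite addr_ge0// mulr_ge0// ?sumr_ge0 ?sqr_ge0// => j _; rewrite addr_ge0 ?sqr_ge0.
pose X (k : nat) := expR (C / k.+1%:R * L * `|t - s|).
pose l (k : nat) := (1 + ES) * X k - 1.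
have fl k : C <= k.+1%:R -> wint k.+1%:R (f k) <= l k.
  move=> Ck; have N0 : 0 < k.+1%:R :> R by [].
  rewrite lerBrDl; apply/ler_addgt0Pr => d d0.
  (* The error of the upper bound is multiplied by [X k] and that of the lower bound counts once,
     hence the share [d / (X k + 1)]. *)
  have X0 : 0 < X k + 1 by rewrite addr_gt0// expR_gt0.
  have d'0 := divr_gt0 d0 X0; set d' := d / _ in d'0.
  have : \forall e \near (0 : R)^'+, 1 + wint k.+1%:R (f k) <= (1 + ES) * X k + d.
    near=> e.
    have h1 : 1 + menergy k.+1%:R e t <= (1 + menergy k.+1%:R e s) * X k.
      by near: e; exact: HC.
    have h2 : menergy k.+1%:R e s <= ES + d'.
      by near: e; exact: (menergy_upper N0 d'0 GA HB wG wH cp cq sW).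
    have h3 : wint k.+1%:R (f k) - d' <= menergy k.+1%:R e t.
      by near: e; exact: (menergy_lower N0 k.+1%:R d'0 GK HK wG' wH').
    have E : d' * (X k + 1) = d by rewrite /d' divfK// gt_eqF.
    have h4 := ler_wpM2r (expR_ge0 (C / k.+1%:R * L * `|t - s|)) h2.
    move: h1 h3 h4 E; rewrite -/(X k).
    move: (menergy _ _ _) (menergy _ _ _) (wint _ _) => e1 e2 e3; lra.
  by move=> /filter_ex[].
have Nt : measurable_fun setT (fun x : 'rV[R]_n => x) by [].
apply: (@fatou_le _ _ _ mu (fun k x => eta k.+1%:R x * eta k.+1%:R x * f k x) _ l ES).
- move=> k; have be : bmf (eta k.+1%:R : 'rV[R]_n -> R) by exact: eta_bmf.
  exact: (bmfM (bmfM be be) (bf k)).1.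
- by move=> k x; rewrite mulr_ge0// -expr2 sqr_ge0.
- move=> x; have he := @eta_cvg R n x.
  have h : f ^~ x @ \oo --> 2^-1 * (\sum_(j < n) (G' j x ^+ 2 + H' j x ^+ 2)) + 4^-1 * defect p q t x ^+ 2.
    (* Once the level exceeds [T] no truncation acts at [x], so the sequence is eventually
       constant. *)
    pose T := \sum_(j < n) (`|G' j x| + `|H' j x|).
    have hT j : `|G' j x| <= T /\ `|H' j x| <= T.
      have : `|G' j x| + `|H' j x| <= T.
        by rewrite /T (bigD1 j)//= lerDl sumr_ge0// => i _; rewrite addr_ge0.
      by have := normr_ge0 (G' j x); have := normr_ge0 (H' j x); move: T => T; split; lra.
    apply: cvg_near_cst; exists (Num.truncn T).+1 => // k /= Tk.
    have Tk' : T <= k.+1%:R.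
      apply: le_trans (ltW (truncnS_gt T)) _; rewrite ler_nat; exact: leqW.
    rewrite /f; congr (_ * _ + _); apply: eq_bigr => j _; have [h1 h2] := hT j.
    by rewrite /trunc (le_trans h1 Tk') (le_trans h2 Tk').
  have := cvgM (cvgM he he) h; rewrite !mul1r; exact.
- exists (Num.truncn C) => // k /= Ck; rewrite -EFin_Rintegral; last first.
    by apply: iw => //; exact: bmf_locint.
  rewrite lee_fin; apply: fl; apply: le_trans (ltW (truncnS_gt C)) _.
  by rewrite ler_nat.
- rewrite (_ : ES = (1 + ES) * 1 - 1); last by rewrite mulr1 addrC addKr.
  apply: cvgB; last exact: cvg_cst.
  apply: cvgMr; rewrite -expR0.
  apply: (@cvg_comp _ _ _ (fun k : nat => C / k.+1%:R * L * `|t - s|) expR _ (nbhs (0 : R))).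
    rewrite -(mul0r `|t - s|) -(mul0r L) -(mulr0 C).
    by do 2 apply: cvgMl; apply: cvgMr; exact: cvg_harmonic.
  exact: continuous_expR.
Unshelve. all: by end_near. Qed.

End slab.

Import ComplexField.Normc.

(** * From the Sobolev formulation to real weak derivatives *)

Section complex_modulus.
Context {R : realType}.
Implicit Types z : R[i].

Lemma sqr_normcE z : normc z ^+ 2 = complex.Re z ^+ 2 + complex.Im z ^+ 2.
Proof. by case: z => a b /=; rewrite sqr_sqrtr// addr_ge0// sqr_ge0. Qed.

Lemma normc_nneg z : 0 <= normc z.
Proof. by case: z => a b; exact: sqrtr_ge0. Qed.

Lemma normr_Re_le z : `|complex.Re z| <= normc z.
Proof.
rewrite -ler_sqr ?nnegrE ?normc_nneg// sqr_normcE real_normK ?num_real//.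
by rewrite lerDl sqr_ge0.
Qed.

Lemma normr_Im_le z : `|complex.Im z| <= normc z.
Proof.
rewrite -ler_sqr ?nnegrE ?normc_nneg// sqr_normcE real_normK ?num_real//.
by rewrite lerDr sqr_ge0.
Qed.

Lemma normc_distC (x y : R[i]) : normc (x - y) = normc (y - x).
Proof. by rewrite -opprB normcN. Qed.

Lemma normc_dist3 (x y z : R[i]) : normc (x - z) <= normc (x - y) + normc (y - z).
Proof. by rewrite -(subrKA y); exact: le_normcD. Qed.

Lemma Re_mulC (z : R[i]) (c : R) : complex.Re (z * c%:C%C) = complex.Re z * c.
Proof. by case: z => x y /=; rewrite mulr0 subr0. Qed.

Lemma Im_mulC (z : R[i]) (c : R) : complex.Im (z * c%:C%C) = complex.Im z * c.
Proof. by case: z => x y /=; rewrite mulr0 add0r. Qed.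

End complex_modulus.

Section lebesgue_norms.
Context {R : realType} {n : nat}.
Local Notation mu := (@lebesgue_rV R n).
Implicit Types (f g : 'rV[R]_n -> R[i]).

Definition Cuc f := forall w : R, 0 < w -> exists2 e : R, 0 < e &
  forall x y : 'rV[R]_n, (forall i, `|y 0 i - x 0 i| < e) -> normc (f y - f x) <= w.

Lemma unif_continuous_Cuc f : unif_continuous (f : 'rV[R]_n -> R[i]^o) -> Cuc f.
Proof.
move=> uf w w0; have w0' : 0 < w%:C%C by rewrite ltcR.
have := uf _ (@entourage_ball _ R[i]^o (PosNum w0')); rewrite nbhs_simpl/= -entourage_from_ballE.
move=> [e /= e0 He]; exists e => // x y xy.
have /He /= : [set xy : 'rV[R]_n * 'rV[R]_n | ball xy.1 e xy.2] (x, y).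
  by split => // i j; rewrite ord1 /ball/= distrC.
rewrite /ball/= normc_def => /ltW; rewrite lecR => h; rewrite normc_distC.
apply: le_trans h; case: (f x - f y) => a b /=; exact: lexx.
Qed.

(** The essential supremum norm unfolds to a test on the measure of the whole space, which this
    settles. *)
Lemma mu_setT_gt0 : (0 < mu setT)%E.
Proof.
rewrite lt0e measure_ge0 andbT; apply/negP => /eqP mu0.
have : {ae mu, forall x, (fun=> 1) x <= (0 : R)} by exists setT; split.
have c1 : continuous (fun _ : 'rV[R]_n => 1 : R) by exact: cst_continuous.
by move/(@ae_le_continuous R n (fun=> 1) 0 c1)/(_ 0); rewrite ler10.
Qed.

(** Continuity upgrades the almost everywhere bound through [ae_le_continuous]. *)
Lemma Lpnorm_y f r : continuous (fun x => normc (f x)) -> (Lpnorm +oo%E f <= r%:E)%E ->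
  forall x, normc (f x) <= r.
Proof.
move=> cf; rewrite /Lpnorm unlock mu_setT_gt0 => /ess_sup_inf.ess_supP H.
apply: ae_le_continuous => //; apply: filterS H => x /=; rewrite lee_fin ger0_norm//.
exact: normc_nneg.
Qed.

Lemma poweR_half_le (A : \bar R) r : (0 <= A)%E -> (A `^ 2^-1 <= r%:E)%E -> (A <= (r ^+ 2)%:E)%E.
Proof.
move=> A0 h; have r0 : 0 <= r by rewrite -lee_fin; apply: le_trans h; exact: poweR_ge0.
have := @gt0_ler_poweR R 2 ltac:(by []) (A `^ 2^-1)%E r%:E.
rewrite !in_itv/= !leey !andbT poweR_ge0 lee_fin r0 => /(_ isT isT h).
rewrite -poweRrM mulVf ?pnatr_eq0// poweRe1//.
by rewrite (powR_mulrn 2).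
Qed.

Lemma Lpnorm2E f : (Lpnorm 2%:E f = (\int[mu]_x (normc (f x) ^+ 2)%:E) `^ 2^-1)%E.
Proof.
rewrite /Lpnorm unlock; congr (_ `^ _)%E; apply: eq_integral => x _ /=.
by rewrite (powR_mulrn 2)// ger0_norm// normc_nneg.
Qed.

Lemma Lpnorm2_sqr f r : (Lpnorm 2%:E f <= r%:E)%E ->
  (\int[mu]_x (normc (f x) ^+ 2)%:E <= (r ^+ 2)%:E)%E.
Proof.
rewrite Lpnorm2E; apply: poweR_half_le; apply: integral_ge0 => x _.
by rewrite lee_fin sqr_ge0.
Qed.

Lemma measurable_sqr_normc f : cmeasurable f -> measurable_fun setT (fun x => normc (f x) ^+ 2).
Proof.
move=> [m1 m2]; under eq_fun do rewrite sqr_normcE.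
by apply: measurable_funD; apply: measurable_funX.
Qed.

Lemma measurable_normc f : cmeasurable f -> measurable_fun setT (fun x => normc (f x)).
Proof.
move=> mf; rewrite (_ : (fun x => _) = fun x => Num.sqrt (normc (f x) ^+ 2)).
  apply: (measurableT_comp (@continuous_measurable_fun _ _ (@sqrt_continuous R))).
  exact: measurable_sqr_normc.
by apply/funext => x; rewrite sqrtr_sqr ger0_norm// normc_nneg.
Qed.

Lemma cmeasurableB f g : cmeasurable f -> cmeasurable g -> cmeasurable (fun x => f x - g x).
Proof.
move=> [m1 m2] [m3 m4]; split.
  by under eq_fun do rewrite raddfB; exact: measurable_funB.
by under eq_fun do rewrite raddfB; exact: measurable_funB.
Qed.

Lemma sqr_int_ReIm f K : cmeasurable f -> (\int[mu]_x (normc (f x) ^+ 2)%:E <= K%:E)%E ->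
  sqr_int (fun x => complex.Re (f x)) K /\ sqr_int (fun x => complex.Im (f x)) K.
Proof.
move=> mf fK; have mn := measurable_sqr_normc mf; have [m1 m2] := mf.
split; split => //; apply: le_trans fK; apply: ge0_le_integral => //.
- by move=> x _; rewrite lee_fin sqr_ge0.
- by apply/measurable_EFinP; exact: measurable_funX.
- by apply/measurable_EFinP.
- by move=> x _; rewrite lee_fin sqr_normcE lerDl sqr_ge0.
- by move=> x _; rewrite lee_fin sqr_ge0.
- by apply/measurable_EFinP; exact: measurable_funX.
- by apply/measurable_EFinP.
- by move=> x _; rewrite lee_fin sqr_normcE lerDr sqr_ge0.
Qed.

Lemma L1loc_locint f : L1loc f -> locint (fun x => complex.Re (f x)) /\ locint (fun x => complex.Im (f x)).
Proof.
move=> [mf H]; have mn := measurable_normc mf; have [m1 m2] := mf.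
have bi r : mu.-integrable setT (EFin \o (fun x => normc (f x) * \1_(box r) x)).
  apply/integrableP; split.
    by apply/measurable_EFinP; apply: measurable_funM => //; apply: measurable_indic; exact: measurable_box.
  have cb : compact (box r : set 'rV[R]_n).
    rewrite (_ : box r = [set x : 'rV[R]_n | forall i, - r <= x 0 i <= r]); first exact: compact_closed_box.
    by apply/seteqP; split => x /= h i; have := h i; rewrite ler_norml.
  apply: le_lt_trans (H _ cb); rewrite [leRHS]integral_mkcond.
  apply: ge0_le_integral => //.
  - by apply: measurableT_comp => //; apply/measurable_EFinP; apply: measurable_funM => //; apply: measurable_indic; exact: measurable_box.
  - apply/(measurable_restrictT _ _).1; first exact: measurable_box.
    by apply: measurable_funTS; apply/measurable_EFinP.
  - move=> x _; rewrite patchE /= indicE; case: ifP => _; rewrite ?mulr1 ?mulr0 ?normr0//.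
    by rewrite ger0_norm// normc_nneg.
split; split => // r; apply: (le_intg _ (bi r)).
- by apply: measurable_funM => //; apply: measurable_indic; exact: measurable_box.
- by move=> x; rewrite normrM indicE normr_nat ler_wpM2r// normr_Re_le.
- by apply: measurable_funM => //; apply: measurable_indic; exact: measurable_box.
- by move=> x; rewrite normrM indicE normr_nat ler_wpM2r// normr_Im_le.
Qed.

Lemma testB_test_function B : testB B -> test_function setT (tensor B : 'rV[R]_n -> R).
Proof.
move=> tB; have /choice[r Hr] : forall i, exists r, forall x, r <= `|x| -> B i x = 0 by move=> i; case: (tB i).
apply: (@tensor_test_function R n B (fun i => - r i) r); first by move=> i; case: (tB i).
  move=> i t /negP Bt; rewrite -ler_norml leNgt; apply/negP => /ltW /Hr h; apply: Bt; exact/eqP.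
by [].
Qed.

Lemma is_wderiv_rwd j f g : is_wderiv [:: j] f g ->
  rwd j (fun x => complex.Re (f x)) (fun x => complex.Re (g x)) /\
  rwd j (fun x => complex.Im (f x)) (fun x => complex.Im (g x)).
Proof.
move=> [_ _ H].
have E B : testB B ->
  (\int[mu]_x (complex.Re (f x) * tensor (upd B j (derive1 (B j))) x) = - \int[mu]_x (complex.Re (g x) * tensor B x)) /\
  \int[mu]_x (complex.Im (f x) * tensor (upd B j (derive1 (B j))) x) = - \int[mu]_x (complex.Im (g x) * tensor B x).
  move=> tB; have := H _ (testB_test_function tB).
  rewrite /= pderiv_tensor; last by case: (tB j).
  rewrite /cintegral expr1 mulN1r => -[h1 h2].
  move: h1; under eq_Rintegral => x _ do rewrite Re_mulC.
  under [X in _ = - X -> _]eq_Rintegral => x _ do rewrite Re_mulC.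
  move=> ->; split => //; move: h2; under eq_Rintegral => x _ do rewrite Im_mulC.
  by under [X in _ = - X -> _]eq_Rintegral => x _ do rewrite Im_mulC.
by split => B /E[].
Qed.

End lebesgue_norms.

(** * Borel measurability of continuous functions *)

Section continuous_measurable.
Context {R : realType} {n : nat}.
Local Notation mu := (@lebesgue_rV R n).

Lemma nbhs_rV_box (x : 'rV[R]_n) (A : set 'rV[R]_n) : nbhs x A -> exists2 e : R, 0 < e &
  forall y : 'rV[R]_n, (forall i, `|y 0 i - x 0 i| < e) -> A y.
Proof.
move=> /nbhs_ballP[e /= e0 eA]; exists e => // y xy; apply: eA; split => // i j.
by rewrite ord1 /ball/= distrC.
Qed.

(** An open set is the countable union of the rational open boxes that it contains. *)
Lemma open_measurable_rV (A : set 'rV[R]_n) : open A -> measurable A.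
Proof.
move=> oA.
pose bx (lh : 'rV[rat]_n * 'rV[rat]_n) := open_box (fun i => ratr (lh.1 0 i) : R) (fun i => ratr (lh.2 0 i) : R).
rewrite (_ : A = \bigcup_(lh in [set lh | bx lh `<=` A]) bx lh).
  rewrite bigcup_mkcond; apply: countable_bigcupT_measurable; first exact: countableP.
  by move=> lh; case: ifP => _ //; exact: measurable_open_box.
apply/seteqP; split => x; last by move=> [lh /= + xlh]; apply.
move=> Ax; have [e e0 He] := nbhs_rV_box (oA _ Ax).
have hl i : exists r : rat, x 0 i - e < ratr r < x 0 i.
  by have [|r] := @rat_in_itvoo R (x 0 i - e) (x 0 i); [rewrite ltrBlDr ltrDl|rewrite in_itv/=; exists r].
have hr i : exists r : rat, x 0 i < ratr r < x 0 i + e.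
  by have [|r] := @rat_in_itvoo R (x 0 i) (x 0 i + e); [rewrite ltrDl|rewrite in_itv/=; exists r].
have [l Hl] := choice hl; have [h Hh] := choice hr.
exists (\row_i l i, \row_i h i) => [y /= yb|i /=].
  apply: He => i; have := yb i; rewrite /= !mxE => /andP[h1 h2].
  have /andP[h3 _] := Hl i; have /andP[_ h4] := Hh i.
  by rewrite ltr_norml; apply/andP; split; lra.
by rewrite !mxE; have /andP[_ ->] := Hl i; have /andP[-> _] := Hh i.
Qed.

Lemma continuous_measurable_rV (f : 'rV[R]_n -> R) : continuous f -> measurable_fun setT f.
Proof.
move=> cf; apply: (measurability (@RGenOpens.G R)); first exact: RGenOpens.measurableE.
move=> _ [_ [a [b ->] <-]]; rewrite setTI; apply: open_measurable_rV.
by apply: open_comp => //; exact: interval_open.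
Qed.

Lemma test_function_bmf (phi : 'rV[R]_n -> R) : test_function setT phi ->
  bmf phi /\ exists r, boxed r phi.
Proof.
move=> [sphi cphi _].
have cont : continuous phi by move=> x; apply: differentiable_continuous; exact: (sphi [::] x).
have zero x : ~ closure [set x | phi x != 0] x -> phi x = 0.
  move=> nx; apply/eqP/negPn/negP => px; apply: nx; exact: subset_closure.
have bd (g : 'rV[R]_n -> R) : continuous g -> exists r, forall x, closure [set x | phi x != 0] x -> `|g x| <= r.
  move=> cg; have : compact (g @` closure [set x | phi x != 0]).
    by apply: continuous_compact => //; exact: continuous_subspaceT.
  move=> /compact_bounded; rewrite /bounded_set/= => -[r [_ Hr]].
  exists (r + 1) => x sx; apply: (Hr (r + 1)); first by rewrite ltrDl.
  by exists x.
split; first split.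
- exact: continuous_measurable_rV.
- have [r Hr] := bd _ cont; exists (Num.max r 0) => x.
  have [/Hr h|/zero ->] := pselect (closure [set x | phi x != 0] x).
    by apply: le_trans h _; rewrite le_max lexx.
  by rewrite normr0 le_max lexx orbT.
have cc i : continuous (fun x : 'rV[R]_n => x 0 i) by move=> x; exact: coord_continuous.
have [r Hr] := choice (fun i => bd _ (cc i)).
exists (\sum_i `|r i|) => x nx; apply: zero => sx; apply: nx => i.
apply: le_trans (Hr i x sx) _; apply: le_trans (ler_norm _) _.
by rewrite (bigD1 i)//= lerDl sumr_ge0.
Qed.

End continuous_measurable.

(** * Calculus of complex weak derivatives *)

Section weak_derivative_calculus.
Context {R : realType} {n : nat}.
Local Notation mu := (@lebesgue_rV R n).
Implicit Types (f g : 'rV[R]_n -> R[i]) (phi : 'rV[R]_n -> R).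

(** The derivative vanishes wherever [phi] vanishes on a neighbourhood, so the support does not
    grow. *)
Lemma test_function_pderiv j phi : test_function setT phi -> test_function setT (pderiv j phi).
Proof.
move=> [sphi cphi _].
have sub : [set x | pderiv j phi x != 0] `<=` closure [set x | phi x != 0].
  move=> x /= dx; apply: contrapT => nx; move/negP: dx; apply; apply/eqP.
  have nz : \forall y \near x, phi y = 0.
    have : open (~` closure [set x | phi x != 0]) by apply: closed_openC; exact: closed_closure.
    move=> /(_ x nx); apply: filterS => y ny; apply/eqP/negPn/negP => py; apply: ny.
    exact: subset_closure.
  by rewrite /pderiv (near_eq_derive (delta_mx 0 j) (nz : \near x, phi x = cst 0 x)) derive_cst.
split=> //.
  by move=> s x; have := sphi (s ++ [:: j]) x; rewrite /mderiv foldr_cat.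
apply: subclosed_compact cphi _; first exact: closed_closure.
by rewrite closureE; apply: smallest_sub => //; exact: closed_closure.
Qed.

Lemma L1loc_mul f phi : L1loc f -> test_function setT phi ->
  mu.-integrable setT (EFin \o (fun x => complex.Re (f x) * phi x)) /\
  mu.-integrable setT (EFin \o (fun x => complex.Im (f x) * phi x)).
Proof.
move=> /L1loc_locint[l1 l2] /test_function_bmf[bp [r br]].
by split; [exact: locint_mul l1 bp br|exact: locint_mul l2 bp br].
Qed.

Lemma L1locB f g : L1loc f -> L1loc g -> L1loc (fun x => f x - g x).
Proof.
have mnorm (h : 'rV[R]_n -> R[i]) : cmeasurable h -> measurable_fun setT (fun x => (normc (h x))%:E).
  by move=> /measurable_normc mh; exact/measurable_EFinP.
move=> [mf F] [mg G]; have mB := cmeasurableB mf mg.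
split => // K cK.
have mK : measurable K.
  rewrite -[K]setCK; apply: measurableC; apply: open_measurable_rV; apply: closed_openC.
  by apply: compact_closed => //; exact: norm_hausdorff.
apply: (@le_lt_trans _ _ (\int[mu]_(x in K) ((normc (f x))%:E + (normc (g x))%:E))%E).
  apply: ge0_le_integral => //.
  - by move=> x _; rewrite lee_fin normc_nneg.
  - by apply: measurable_funTS; exact: mnorm.
  - by apply: measurable_funTS; apply: emeasurable_funD; exact: mnorm.
  - by move=> x _; rewrite -EFinD lee_fin; have := normc_dist3 (f x) 0 (g x); rewrite subr0 sub0r normcN.
rewrite ge0_integralD//.
- by rewrite lte_add_pinfty ?F ?G.
- by move=> x _; rewrite lee_fin normc_nneg.
- by apply: measurable_funTS; exact: mnorm.
- by move=> x _; rewrite lee_fin normc_nneg.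
- by apply: measurable_funTS; exact: mnorm.
Qed.

Lemma cintegralB f g phi : L1loc f -> L1loc g -> test_function setT phi ->
  cintegral setT (fun x => (f x - g x) * (phi x)%:C%C) =
  cintegral setT (fun x => f x * (phi x)%:C%C) - cintegral setT (fun x => g x * (phi x)%:C%C).
Proof.
move=> lf lg tp; have [f1 f2] := L1loc_mul lf tp; have [g1 g2] := L1loc_mul lg tp.
have RE (h : 'rV[R]_n -> R[i]) : \int[mu]_x complex.Re (h x * (phi x)%:C%C) =
    \int[mu]_x (complex.Re (h x) * phi x) by apply: eq_Rintegral => x _; exact: Re_mulC.
have IE (h : 'rV[R]_n -> R[i]) : \int[mu]_x complex.Im (h x * (phi x)%:C%C) =
    \int[mu]_x (complex.Im (h x) * phi x) by apply: eq_Rintegral => x _; exact: Im_mulC.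
rewrite /cintegral !RE !IE; apply/eqP; rewrite eq_complex/=; apply/andP; split; apply/eqP.
  by rewrite -RintegralB//; apply: eq_Rintegral => x _; rewrite raddfB mulrBl.
by rewrite -RintegralB//; apply: eq_Rintegral => x _; rewrite raddfB mulrBl.
Qed.

Lemma test_function_mderiv s phi : test_function setT phi -> test_function setT (mderiv s phi).
Proof. by move=> tp; elim: s => //= j s IH; exact: test_function_pderiv. Qed.

Lemma is_wderivB s f1 f2 g1 g2 : is_wderiv s f1 g1 -> is_wderiv s f2 g2 ->
  is_wderiv s (fun x => f1 x - f2 x) (fun x => g1 x - g2 x).
Proof.
move=> [lf1 lg1 H1] [lf2 lg2 H2]; split; [exact: L1locB|exact: L1locB|].
move=> phi tp; rewrite !cintegralB//; last exact: test_function_mderiv.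
by rewrite H1// H2// mulrBr.
Qed.

Lemma is_wderiv_nil f : L1loc f -> is_wderiv [::] f f.
Proof. by move=> lf; split => // phi _; rewrite expr0 mul1r. Qed.

Lemma is_wderiv_nil_trans s f g h : is_wderiv s f g -> is_wderiv [::] g h -> is_wderiv s f h.
Proof.
move=> [lf lg H1] [_ lh H2]; split => // phi tp.
by rewrite H1// -[in RHS](mul1r (cintegral _ _)) -(expr0 (-1)) -H2.
Qed.

(** Two weak derivatives of one function have equal integrals against every test function, hence the
    same weak derivatives. This stands in for almost everywhere uniqueness when [wderiv] picks
    another representative. *)
Lemma is_wderiv_eq s s' f g g' h : is_wderiv s f g -> is_wderiv s f g' ->
  is_wderiv s' g h -> is_wderiv s' g' h.
Proof.
move=> [_ lg H1] [_ lg' H2] [_ lh H3]; split => // phi tp; rewrite -H3//.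
have tp' := test_function_mderiv s' tp.
have := H1 _ tp'; rewrite H2// => /(congr1 ( *%R ((-1) ^+ size s))).
by rewrite !mulrA -expr2 -exprM mulnC exprM sqrrN expr1n expr1n !mul1r.
Qed.

Lemma wderivP s f : (exists g, is_wderiv s f g) -> is_wderiv s f (wderiv s f).
Proof. by move=> h; exact: (xgetPex (cst 0) h). Qed.

Lemma rwd_rwd2 j (f g h : 'rV[R]_n -> R) : rwd j f g -> rwd j g h -> rwd2 j f h.
Proof.
move=> fg gh B tB; have := fg _ (testB_updd j tB).
rewrite (gh _ tB) opprK => <-; apply: eq_Rintegral => x _; congr (_ * tensor _ x).
by apply/funext => i; rewrite /upd eqxx; case: eqP.
Qed.

Definition word1 m (j : 'I_n) : {ffun 'I_n -> 'I_m.+1} := [ffun i => if i == j then inord 1 else ord0].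
Definition word0 m : {ffun 'I_n -> 'I_m.+1} := [ffun i => ord0].

Lemma word_of0 m : word_of (word0 m) = [::].
Proof.
by rewrite /word_of; elim: (enum _) => //= i s ->; rewrite ffunE.
Qed.

Lemma mindex_le0 m : mindex_le (word0 m).
Proof. by rewrite /mindex_le big1// => i _; rewrite ffunE. Qed.

Lemma word_of1 m j : (0 < m)%N -> word_of (word1 m j) = [:: j].
Proof.
move=> m0; rewrite -(filter_pred1_uniq (enum_uniq 'I_n) (mem_enum _ j)) /word_of.
elim: (enum _) => //= i s ->; rewrite ffunE; case: eqP => //= _.
by rewrite inordK.
Qed.

Lemma mindex_le1 m j : (0 < m)%N -> mindex_le (word1 m j).
Proof.
move=> m0; rewrite /mindex_le (bigD1 j)//= ffunE eqxx inordK// big1 ?addn0// => i ij.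
by rewrite ffunE (negPf ij).
Qed.

End weak_derivative_calculus.

(** * What the Zhidkov norm controls *)

Section small_norm.
Context {R : realType} {n : nat}.
Local Notation mu := (@lebesgue_rV R n).
Implicit Types (f g : 'rV[R]_n -> R[i]).

Lemma sqr_poweR_half (A : \bar R) : (0 <= A)%E -> ((A `^ 2^-1) ^+ 2 = A)%E.
Proof.
move=> A0; rewrite expe2; case: A A0 => [a| |]//=.
  by rewrite lee_fin => a0; rewrite -EFinM -expr2 powR12_sqrt// sqr_sqrtr.
by move=> _; rewrite invr_eq0 pnatr_eq0/= mulyy.
Qed.

Let sqr_norm f := (\int[mu]_x (normc (f x) ^+ 2)%:E)%E.

Let sqr_norm_ge0 f : (0 <= sqr_norm f)%E.
Proof. by apply: integral_ge0 => x _; rewrite lee_fin sqr_ge0. Qed.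

Lemma Xnorm_le k f r : (Xnorm k f <= r%:E)%E -> (Lpnorm +oo%E f <= r%:E)%E /\
  forall j (alpha : {ffun 'I_n -> 'I_k.-1.+1}), mindex_le alpha ->
    (\int[mu]_x (normc (wderiv (word_of alpha) (wgrad f j) x) ^+ 2)%:E <= (r ^+ 2)%:E)%E.
Proof.
have Hn g : (Hnorm k.-1 g ^+ 2 = \sum_(alpha : {ffun 'I_n -> 'I_k.-1.+1} | mindex_le alpha)
    sqr_norm (wderiv (word_of alpha) g))%E.
  rewrite sqr_poweR_half; last first.
    by apply: sume_ge0 => a _; rewrite expe2 mule_ge0// Lnorm_ge0.
  by apply: eq_bigr => a _; rewrite Lpnorm2E; exact: sqr_poweR_half (sqr_norm_ge0 _).
have H0 g : (0 <= Hnorm k.-1 g ^+ 2)%E by rewrite Hn; apply: sume_ge0.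
move=> h; split; first by apply: le_trans h; rewrite leeDl// poweR_ge0.
have : ((\sum_(j < n) Hnorm k.-1 (wgrad f j) ^+ 2) `^ 2^-1 <= r%:E)%E.
  by apply: le_trans h; rewrite leeDr// Lnorm_ge0.
move=> /poweR_half_le -/(_ (sume_ge0 (fun _ _ => H0 _) _)) hs j alpha ha; apply: le_trans hs.
rewrite (bigD1 j)//=; apply: (@le_trans _ _ (Hnorm k.-1 (wgrad f j) ^+ 2)%E); last first.
  by apply: leeDl; apply: sume_ge0 => i _; exact: H0.
by rewrite Hn (bigD1 alpha)//= leeDl//; apply: sume_ge0.
Qed.

(** A first and a pure second derivative with a common bound, held existentially so that no
    representative is singled out. *)
Definition good_derivs f j K := exists g h : 'rV[R]_n -> R[i],
  [/\ cmeasurable g, cmeasurable h, (sqr_norm g <= K%:E)%E & (sqr_norm h <= K%:E)%E] /\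
  [/\ is_wderiv [:: j] f g & is_wderiv [:: j] g h].

Lemma Xspace_derivs k f j : (1 < k)%N -> Xspace k f -> exists g h : 'rV[R]_n -> R[i],
  [/\ is_wderiv [:: j] f g, is_wderiv [:: j] g h, L2 g & L2 h].
Proof.
move=> k1 [_ _ /(_ j) [g fg [g2 H]]]; have k10 : (0 < k.-1)%N by rewrite -subn1 subn_gt0.
have [h gh h2] := H _ (mindex_le1 j k10); rewrite word_of1// in gh.
by exists g, h.
Qed.

Lemma L2_sqr f : L2 f -> exists K : R, (sqr_norm f <= K%:E)%E.
Proof.
move=> [_ h]; exists (fine (Lpnorm 2%:E f) ^+ 2); apply: Lpnorm2_sqr; rewrite fineK//.
by rewrite ge0_fin_numE// Lnorm_ge0.
Qed.

Lemma Xspace_good k f : (1 < k)%N -> Xspace k f -> exists K : R, forall j, good_derivs f j K.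
Proof.
move=> k1 Xf; have /choice[K HK] : forall j, exists K : R, good_derivs f j K.
  move=> j; have [g [h [fg gh g2 h2]]] := Xspace_derivs j k1 Xf.
  have [K1 g1] := L2_sqr g2; have [K2 h1] := L2_sqr h2.
  exists (Num.max K1 K2), g, h; split; split => //; [by case: g2|by case: h2| |].
    by apply: le_trans g1 _; rewrite lee_fin le_max lexx.
  by apply: le_trans h1 _; rewrite lee_fin le_max lexx orbT.
exists (\sum_j `|K j|) => j; have [g [h [[m1 m2 g1 h1] [fg gh]]]] := HK j.
have le : K j <= \sum_j `|K j|.
  by apply: le_trans (ler_norm _) _; rewrite (bigD1 j)//= lerDl sumr_ge0.
by exists g, h; split; split => //; [apply: le_trans g1 _|apply: le_trans h1 _]; rewrite lee_fin.
Qed.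

(** The norm speaks of representatives chosen by [wderiv], so these are the witnesses. Even its
    order-0 term is [wderiv [::]] of the gradient; [is_wderiv_eq] transfers the second derivative to
    it. *)
Lemma Xnorm_good k (f1 f2 : 'rV[R]_n -> R[i]) r j : (1 < k)%N -> Xspace k f1 -> Xspace k f2 ->
  (Xnorm k (fun x : 'rV[R]_n => (f1 x - f2 x)%R) <= r%:E)%E -> good_derivs (fun x => f1 x - f2 x) j (r ^+ 2).
Proof.
move=> k1 X1 X2 /Xnorm_le[_ H]; pose f x := f1 x - f2 x; rewrite -/f in H *.
have [g1 [h1 [fg1 gh1 _ _]]] := Xspace_derivs j k1 X1.
have [g2 [h2 [fg2 gh2 _ _]]] := Xspace_derivs j k1 X2.
have fg := is_wderivB fg1 fg2; have gh := is_wderivB gh1 gh2; rewrite -/f in fg.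
have k10 : (0 < k.-1)%N by rewrite -subn1 subn_gt0.
have fw : is_wderiv [:: j] f (wgrad f j) by apply: wderivP; eexists; exact: fg.
have wh := is_wderiv_eq fg fw gh.
have lw : L1loc (wgrad f j) by case: fw.
have ww : is_wderiv [::] (wgrad f j) (wderiv [::] (wgrad f j)).
  by apply: wderivP; exists (wgrad f j); exact: is_wderiv_nil.
have ww' : is_wderiv [:: j] (wgrad f j) (wderiv [:: j] (wgrad f j)).
  by apply: wderivP; eexists; exact: wh.
have fw' := is_wderiv_nil_trans fw ww.
exists (wderiv [::] (wgrad f j)), (wderiv [:: j] (wgrad f j)); split; split.
- by case: ww => _ [].
- by case: ww' => _ [].
- by have := H j _ (mindex_le0 k.-1); rewrite word_of0.
- by have := H j _ (mindex_le1 j k10); rewrite word_of1.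
- exact: fw'.
- exact: is_wderiv_eq fw fw' ww'.
Qed.

Lemma Xnorm_sup k (f1 f2 : 'rV[R]_n -> R[i]) r : Xspace k f1 -> Xspace k f2 ->
  (Xnorm k (fun x : 'rV[R]_n => (f1 x - f2 x)%R) <= r%:E)%E -> forall x, normc (f1 x - f2 x) <= r.
Proof.
move=> [_ /unif_continuous_Cuc u1 _] [_ /unif_continuous_Cuc u2 _] /Xnorm_le[+ _].
apply: Lpnorm_y => x; apply/(@cvgrPdist_le _ _ _ (nbhs x)) => e e0.
have e2 : 0 < e / 2 by lra.
have [d1 d10 H1] := u1 _ e2; have [d2 d20 H2] := u2 _ e2.
have : nbhs x (ball x (Num.min d1 d2)) by apply: nbhsx_ballx; rewrite lt_min d10.
apply: filterS => y [_ xy].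
have xy' i : `|y 0 i - x 0 i| < d1 /\ `|y 0 i - x 0 i| < d2.
  by have := xy 0 i; rewrite /ball/= distrC lt_min => /andP[].
have h1 := H1 x y (fun i => (xy' i).1); have h2 := H2 x y (fun i => (xy' i).2).
have tri (a b : R[i]) : `|normc a - normc b| <= normc (a - b).
  have := normc_dist3 a b 0; have := normc_dist3 b a 0; rewrite !subr0 (normc_distC b a).
  by move=> ? ?; rewrite ler_norml; apply/andP; split; lra.
apply: le_trans (tri _ _) _.
rewrite (_ : f1 x - f2 x - (f1 y - f2 y) = (f1 x - f1 y) - (f2 x - f2 y)); last by ring.
apply: le_trans (le_normcD _ _) _; rewrite normcN (normc_distC (f1 x)) (normc_distC (f2 x)).
lra.
Qed.

End small_norm.

Section derivative_bounds.
Context {R : realType} {n : nat}.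
Local Notation mu := (@lebesgue_rV R n).
Implicit Types (f g : 'rV[R]_n -> R[i]) (K : R).

Let sqrB f g K L : cmeasurable f -> cmeasurable g ->
  (\int[mu]_x (normc (f x) ^+ 2)%:E <= K%:E)%E -> (\int[mu]_x (normc (g x) ^+ 2)%:E <= L%:E)%E ->
  (\int[mu]_x (normc (f x - g x) ^+ 2)%:E <= (2 * K + 2 * L)%:E)%E.
Proof.
move=> mf mg fK gL; have mE (h : 'rV[R]_n -> R[i]) : cmeasurable h -> measurable_fun setT (fun x => (normc (h x) ^+ 2)%:E).
  by move=> mh; apply/measurable_EFinP; exact: measurable_sqr_normc.
have m1 : measurable_fun setT (fun x => (normc (f x) ^+ 2)%:E) by exact: mE.
have m2 : measurable_fun setT (fun x => (normc (g x) ^+ 2)%:E) by exact: mE.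
apply: (@le_trans _ _ (\int[mu]_x (2%:E * (normc (f x) ^+ 2)%:E + 2%:E * (normc (g x) ^+ 2)%:E))%E).
  apply: ge0_le_integral => //.
  - by move=> x _; rewrite lee_fin sqr_ge0.
  - by apply: mE; exact: cmeasurableB.
  - by apply: emeasurable_funD; apply: measurable_funeM.
  - move=> x _; rewrite -!EFinM -EFinD lee_fin.
    have := le_normcD (f x) (- g x); rewrite normcN.
    have := normc_nneg (f x - g x); have := normc_nneg (f x); have := normc_nneg (g x).
    set a := normc _; set b := normc _; set c := normc _ => a0 b0 c0 h.
    have := sqr_ge0 (a - b); have : c ^+ 2 <= (b + a) ^+ 2 by rewrite ler_sqr ?nnegrE ?addr_ge0.
    by rewrite !expr2; lra.
rewrite ge0_integralD//.
- have -> : (2 * K + 2 * L)%:E = (2%:E * K%:E + 2%:E * L%:E)%E by [].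
  rewrite !ge0_integralZl//.
  + by apply: leeD; apply: lee_wpmul2l.
  + by move=> x _; rewrite lee_fin sqr_ge0.
  + by move=> x _; rewrite lee_fin sqr_ge0.
- by move=> x _; rewrite -EFinM lee_fin mulr_ge0 ?sqr_ge0.
- exact: measurable_funeM.
- by move=> x _; rewrite -EFinM lee_fin mulr_ge0 ?sqr_ge0.
- exact: measurable_funeM.
Qed.

Lemma good_derivsB f g j K L : good_derivs f j K -> good_derivs g j L ->
  good_derivs (fun x => f x - g x) j (2 * K + 2 * L).
Proof.
move=> [f1 [f2 [[m1 m2 b1 b2] [d1 d2]]]] [g1 [g2 [[m3 m4 b3 b4] [d3 d4]]]].
exists (fun x => f1 x - g1 x), (fun x => f2 x - g2 x); split; split.
- exact: cmeasurableB.
- exact: cmeasurableB.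
- exact: sqrB.
- exact: sqrB.
- exact: is_wderivB.
- exact: is_wderivB.
Qed.

Lemma good_derivs0 j : good_derivs (fun _ : 'rV[R]_n => 0 : R[i]) j 0.
Proof.
have m0 : cmeasurable (fun _ : 'rV[R]_n => 0 : R[i]) by split; exact: measurable_cst.
have n0 : normc (0 : R[i]) = 0 by rewrite normc0.
have l0 : L1loc (fun _ : 'rV[R]_n => 0 : R[i]).
  split => // A _; under eq_integral do rewrite n0; by rewrite integral0 ltry.
have i0 : (\int[mu]_x (normc (0 : R[i]) ^+ 2)%:E <= 0%:E)%E.
  by under eq_integral do rewrite n0 expr0n; rewrite integral0.
have w0 : is_wderiv [:: j] (fun _ : 'rV[R]_n => 0 : R[i]) (fun=> 0).
  split => // phi _.
  have c0 (h : 'rV[R]_n -> R) : cintegral setT (fun x => (0 : R[i]) * (h x)%:C%C) = 0.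
    rewrite /cintegral; under eq_Rintegral do rewrite mul0r.
    under [X in Complex _ X]eq_Rintegral do rewrite mul0r.
    by rewrite /Rintegral integral0.
  by rewrite !c0 mulr0.
by exists (fun=> 0), (fun=> 0).
Qed.

Lemma good_derivs_le f j K L : K <= L -> good_derivs f j K -> good_derivs f j L.
Proof.
move=> KL [f1 [f2 [[m1 m2 b1 b2] d]]]; exists f1, f2; split => //; split => //.
  by apply: le_trans b1 _; rewrite lee_fin.
by apply: le_trans b2 _; rewrite lee_fin.
Qed.

(** Write [f = (f - g) - (0 - g)] and use [good_derivsB] twice, whence the constant. *)
Lemma good_derivsD f g j K L : good_derivs (fun x => f x - g x) j K -> good_derivs g j L ->
  good_derivs f j (2 * K + 4 * L).
Proof.
move=> dfg dg; have := good_derivsB dfg (good_derivsB (good_derivs0 j) dg).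
rewrite (_ : (fun x => _) = f); last by apply/funext => x; rewrite sub0r opprK subrK.
by apply: good_derivs_le; lra.
Qed.

Lemma good_derivs_rwd f j K : good_derivs f j K ->
  (exists2 g, sqr_int g K & rwd j (fun x => complex.Re (f x)) g) /\
  (exists2 g, sqr_int g K & rwd j (fun x => complex.Im (f x)) g) /\
  (exists2 g, sqr_int g K & rwd2 j (fun x => complex.Re (f x)) g) /\
  (exists2 g, sqr_int g K & rwd2 j (fun x => complex.Im (f x)) g).
Proof.
move=> [f1 [f2 [[m1 m2 b1 b2] [d1 d2]]]].
have [s1 s2] := sqr_int_ReIm m1 b1; have [s3 s4] := sqr_int_ReIm m2 b2.
have [r1 r2] := is_wderiv_rwd d1; have [r3 r4] := is_wderiv_rwd d2.
by do !split; [exists (fun x => complex.Re (f1 x))|exists (fun x => complex.Im (f1 x))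
  |exists (fun x => complex.Re (f2 x))|exists (fun x => complex.Im (f2 x))] => //;
  [exact: rwd_rwd2 r1 r3|exact: rwd_rwd2 r2 r4].
Qed.

End derivative_bounds.

(** Compactness of [[a, b]]: a threshold on [e] valid near each time yields one valid on the whole
    segment. Bounds are obtained by taking [e^-1] as the bound, moduli of continuity by taking [e]
    as the modulus. *)
Lemma segment_uniform {R : realType} (a b : R) (P : R -> R -> Prop) :
  (forall t, a <= t <= b -> exists2 d, 0 < d & forall e t', 0 < e < d -> `|t' - t| < d ->
     a <= t' <= b -> P e t') ->
  exists2 d, 0 < d & forall e t, 0 < e < d -> a <= t <= b -> P e t.
Proof.
move=> H.
have : \forall e \near (0 : R)^'+, `[a, b] `<=` (fun t => a <= t <= b -> P e t).
  apply: ((compact_near_coveringP _).1 (@segment_compact R a b)) => t; rewrite /= in_itv/= => tab; have [d d0 Hd] := H t tab.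
  exists (ball t d, [set e | 0 < e < d]); first split => /=.
  - exact: nbhsx_ballx.
  - near=> e => /=; apply/andP; split; near: e; [exact: nbhs_right_gt|exact: nbhs_right_lt].
  - move=> [t' e] [/= tt' ed] tab'; apply: Hd => //.
    by move: tt'; rewrite /ball/= distrC.
rewrite near_withinE => /nbhs_ballP[d /= d0 Hd]; exists d => // e t /andP[e0 ed] tab.
by apply: (Hd e) => //=; rewrite /ball/= sub0r normrN gtr0_norm.
Unshelve. all: by end_near. Qed.

(** * Extension in time beyond a compact interval *)

Section time_clamp.
Context {R : realType}.
Variables (a b : R).
Hypothesis ab : a <= b.

(** Composition with this 1-Lipschitz projection on [[a, b]] extends a function of time to the whole
    line and keeps its modulus of continuity. *)
Definition clamp t := Num.max a (Num.min b t).

Lemma clamp_itv t : a <= clamp t <= b.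
Proof. by rewrite /clamp le_max lexx/= ge_max ab/= ge_min lexx. Qed.

Lemma clamp_id t : a <= t <= b -> clamp t = t.
Proof. by move=> /andP[h1 h2]; rewrite /clamp (min_r h2) (max_r h1). Qed.

Lemma clamp_lip s t : `|clamp s - clamp t| <= `|s - t|.
Proof.
have lip (f : R -> R) : (forall x y, x <= y -> f x <= f y <= f x + (y - x)) ->
    forall x y, `|f x - f y| <= `|x - y|.
  move=> H x y; wlog xy : x y / x <= y => [W|].
    by have [/W//|/ltW/W] := leP x y; rewrite distrC (distrC y).
  by have /andP[? ?] := H _ _ xy; rewrite distrC (distrC x) !ger0_norm ?subr_ge0//; lra.
have hmax : forall x y, `|Num.max a x - Num.max a y| <= `|x - y|.
  by apply: lip => x y xy; case: (leP a x) => ?; case: (leP a y) => ?; apply/andP; split; lra.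
have hmin : forall x y, `|Num.min b x - Num.min b y| <= `|x - y|.
  by apply: lip => x y xy; case: (leP b x) => ?; case: (leP b y) => ?; apply/andP; split; lra.
exact: le_trans (hmax _ _) (hmin _ _).
Qed.

End time_clamp.

(** * Solutions on a compact time interval *)

Section uniform_estimates.
Context {R : realType} {n : nat}.
Local Notation mu := (@lebesgue_rV R n).
Local Notation RV := (measurableTypeR R * 'rV[R]_n)%type.
Variables (k : nat) (I : set R) (u : R -> 'rV[R]_n -> R[i]) (a b : R).
Hypotheses (k1 : (1 < k)%N) (cu : Xcontinuous k I u) (ab : a <= b)
  (abI : forall t, a <= t <= b -> I t).

(** Continuity in the [X^k] norm, split into the two forms in which it is used: pointwise closeness
    and smallness of derivatives. *)
Let near_diff t r : a <= t <= b -> 0 < r -> exists2 d, 0 < d & forall tau, a <= tau <= b ->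
  `|tau - t| < d -> (forall x, normc (u tau x - u t x) <= r) /\
  forall j, good_derivs (fun x => u tau x - u t x) j (r ^+ 2).
Proof.
move=> tab r0; have [X C] := cu.
have n0r : nbhs (0%E : \bar R) [set y | (y < r%:E)%E].
  by apply: open_nbhs_nbhs; split; [exact: open_ereal_lt_ereal|rewrite /= lte_fin].
have : \forall s \near within I (nbhs t), (Xnorm k (fun x => (u s x - u t x)%R) < r%:E)%E.
  exact: (C t (abI tab) _ n0r).
rewrite near_withinE => /nbhs_ballP[d /= d0 Hd].
exists d => // tau tauab tt; have tI := abI tauab.
have h : (Xnorm k (fun x => (u tau x - u t x)%R) <= r%:E)%E.
  by apply: ltW; apply: Hd => //=; rewrite /ball/= distrC.
split; first exact: Xnorm_sup (X _ tI) (X _ (abI tab)) h.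
by move=> j; exact: Xnorm_good k1 (X _ tI) (X _ (abI tab)) h.
Qed.

Let Cuc_u t : a <= t <= b -> Cuc (u t).
Proof. by move=> /abI It; have [X _] := cu; have [_ /unif_continuous_Cuc + _] := X _ It. Qed.

Lemma Cuc_continuous_normc (f : 'rV[R]_n -> R[i]) : Cuc f -> continuous (fun x => normc (f x)).
Proof.
move=> uf x; apply/(@cvgrPdist_le _ _ _ (nbhs x)) => e e0; have [d d0 H] := uf _ e0.
have : nbhs x (ball x d) by exact: nbhsx_ballx.
apply: filterS => y [_ xy].
have h : normc (f y - f x) <= e.
  by apply: H => i; have := xy 0 i; rewrite /ball/= distrC.
have := normc_dist3 (f x) (f y) 0; have := normc_dist3 (f y) (f x) 0; rewrite !subr0 (normc_distC (f x)).
by move=> ? ?; rewrite ler_norml; apply/andP; split; lra.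
Qed.

Lemma sup_bound : exists M : R, forall t x, a <= t <= b -> normc (u t x) <= M.
Proof.
case: (@segment_uniform R a b (fun e t => forall x, normc (u t x) <= e^-1)) => [|d d0 H]; last first.
  exists (d / 2)^-1 => t x tab; apply: H => //; lra.
move=> t tab; have [d d0 H] := near_diff tab ltr01.
have [X _] := cu; have [Lf _ _] := X _ (abI tab).
pose M := fine (Lpnorm +oo%E (u t)).
have HM x : normc (u t x) <= M.
  apply: (Lpnorm_y (Cuc_continuous_normc (Cuc_u tab))); rewrite /M fineK//.
  by rewrite ge0_fin_numE// Lnorm_ge0.
have M0 : 0 <= M := le_trans (normc_nneg _) (HM 0).
(* For [e] below [(1 + M)^-1] the bound [e^-1] exceeds [1 + M]. *)
exists (Num.min d (1 + M)^-1) => [|e t' /andP[e0 ed] tt' tab' x].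
  by rewrite lt_min d0/= invr_gt0 ltr_wpDr.
move: ed tt'; rewrite !lt_min => /andP[_ ed] /andP[tt' _].
have [h _] := H t' tab' tt'.
apply: (@le_trans _ _ (1 + M)).
  by have := normc_dist3 (u t' x) (u t x) 0; rewrite !subr0; have := h x; have := HM x; lra.
rewrite -[leLHS]invrK lef_pV2 ?posrE//; first exact: ltW.
by rewrite invr_gt0 ltr_wpDr.
Qed.

Lemma derivs_bound : exists K : R, 0 <= K /\ forall t j, a <= t <= b -> good_derivs (u t) j K.
Proof.
case: (@segment_uniform R a b (fun e t => forall j, good_derivs (u t) j e^-1)) => [|d d0 H]; last first.
  exists (d / 2)^-1; split; first by rewrite invr_ge0; lra.
  move=> t j tab; apply: H => //; lra.
move=> t tab; have [d d0 H] := near_diff tab ltr01.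
have [X _] := cu; have [K HK] := Xspace_good k1 (X _ (abI tab)).
have K0 : 0 < 2 + 4 * `|K| by rewrite ltr_wpDr// mulr_ge0.
exists (Num.min d (2 + 4 * `|K|)^-1) => [|e t' /andP[e0 ed] tt' tab' j].
  by rewrite lt_min d0/= invr_gt0.
move: ed tt'; rewrite !lt_min => /andP[_ ed] /andP[tt' _].
have [_ h] := H t' tab' tt'.
apply: good_derivs_le (good_derivsD (h j) (HK j)).
apply: (@le_trans _ _ (2 + 4 * `|K|)).
  by rewrite expr1n mulr1; have := ler_norm K; lra.
by rewrite -[leLHS]invrK lef_pV2 ?posrE ?invr_gt0// ltW.
Qed.

Let time_uc w : 0 < w -> exists2 e, 0 < e & forall s t x, a <= s <= b -> a <= t <= b ->
  `|s - t| < e -> normc (u s x - u t x) <= w.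
Proof.
move=> w0.
case: (@segment_uniform R a b (fun e t => forall s, a <= s <= b -> `|s - t| < e ->
  forall x, normc (u s x - u t x) <= w)) => [|d d0 H]; last first.
  exists (d / 2) => [|s t x sab tab st]; first lra.
  by apply: (H (d / 2)) => //; lra.
move=> t tab; have w2 : 0 < w / 2 by lra.
have [d d0 H] := near_diff tab w2.
exists (d / 2) => [|e t' /andP[e0 ed] tt' tab' s sab st x]; first lra.
have [h1 _] := H t' tab' ltac:(lra).
have [|h2 _] := H s sab.
  by rewrite -(subrKA t'); apply: le_lt_trans (ler_normD _ _) _; lra.
apply: le_trans (normc_dist3 _ (u t x) _) _.
by have := h1 x; have := h2 x; rewrite (normc_distC (u t x)); lra.
Qed.

Let space_uc w : 0 < w -> exists2 e, 0 < e & forall t (x y : 'rV[R]_n), a <= t <= b ->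
  (forall i, `|y 0 i - x 0 i| < e) -> normc (u t y - u t x) <= w.
Proof.
move=> w0.
case: (@segment_uniform R a b (fun e t => forall x y : 'rV[R]_n,
  (forall i, `|y 0 i - x 0 i| < e) -> normc (u t y - u t x) <= w)) => [|d d0 H]; last first.
  exists (d / 2) => [|t x y tab xy]; first lra.
  by apply: (H (d / 2)) => //; lra.
move=> t tab; have w3 : 0 < w / 3 by lra.
have [d1 d10 H1] := near_diff tab w3; have [d2 d20 H2] := Cuc_u tab w3.
exists (Num.min d1 d2) => [|e t' /andP[e0 ed] tt' tab' x y xy]; first by rewrite lt_min d10.
move: ed tt'; rewrite !lt_min => /andP[_ ed] /andP[tt' _].
have [h _] := H1 t' tab' tt'.
have h2 : normc (u t y - u t x) <= w / 3.
  by apply: H2 => i; apply: lt_trans ed.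
apply: le_trans (normc_dist3 _ (u t y) _) _.
have := normc_dist3 (u t y) (u t x) (u t' x).
by have := h x; have := h y; rewrite (normc_distC (u t x)); lra.
Qed.

Definition clamped t := u (clamp a b t).

(** Continuity in time is uniform in space and conversely; the triangle inequality through [(t, y)]
    joins them. *)
Lemma clamped_uc w : 0 < w -> exists2 e : R, 0 < e & forall s t (x y : 'rV[R]_n),
  `|s - t| < e -> (forall i, `|y 0 i - x 0 i| < e) -> normc (clamped s y - clamped t x) <= w.
Proof.
move=> w0; have w2 : 0 < w / 2 by lra.
have [d1 d10 H1] := time_uc w2; have [d2 d20 H2] := space_uc w2.
exists (Num.min d1 d2) => [|s t x y]; first by rewrite lt_min d10.
rewrite lt_min => /andP[st _] xy.
apply: le_trans (normc_dist3 _ (clamped t y) _) _.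
have h1 : normc (clamped s y - clamped t y) <= w / 2.
  by apply: H1; [exact: clamp_itv|exact: clamp_itv|apply: le_lt_trans st; exact: clamp_lip].
have h2 : normc (clamped t y - clamped t x) <= w / 2.
  by apply: H2; rewrite ?clamp_itv// => i; have := xy i; rewrite lt_min => /andP[].
lra.
Qed.

Lemma clamped_grad_cont s th : a <= s <= b -> 0 < th -> exists2 r : R, 0 < r & forall tau,
  `|tau - s| < r -> forall j, good_derivs (fun x => clamped tau x - clamped s x) j th.
Proof.
move=> sab th0; have q0 : 0 < Num.sqrt th by rewrite sqrtr_gt0.
have [r r0 H] := near_diff sab q0.
exists r => // tau ts j; have [|_ h] := H (clamp a b tau) (clamp_itv ab tau).
  by apply: le_lt_trans ts; rewrite -{1}(clamp_id sab); exact: clamp_lip.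
by have := h j; rewrite sqr_sqrtr ?ltW// /clamped (clamp_id sab).
Qed.

(** Joint continuity gives Borel measurability on [R^(n+1)], which [rV_cons] carries to the product.
    The map [h] stands for the real or the imaginary part. *)
Lemma measurable_clamped (h : R[i] -> R) : (forall z w, `|h z - h w| <= normc (z - w)) ->
  measurable_fun setT (fun z : RV => h (clamped z.1 z.2)).
Proof.
move=> hl; pose P (w : 'rV[R]_n.+1) := h (clamped (rV_uncons w).1 (rV_uncons w).2).
have cP : continuous P.
  move=> w; apply/(@cvgrPdist_le _ _ _ (nbhs w)) => e e0; have [d d0 H] := clamped_uc e0.
  have : nbhs w (ball w d) by exact: nbhsx_ballx.
  apply: filterS => y [_ wy]; apply: le_trans (hl _ _) _; rewrite normc_distC; apply: H.
    by have := wy 0 ord0; rewrite /ball/= distrC.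
  by move=> i; rewrite !mxE; have := wy 0 (lift ord0 i); rewrite /ball/= distrC.
have := measurableT_comp (continuous_measurable_rV cP) (@measurable_rV_cons R n).
by congr measurable_fun; apply/funext => z; rewrite /P /comp rV_consK.
Qed.

End uniform_estimates.

(** * The equation tested against the mollifier *)

Section mollified_equation.
Context {R : realType} {n : nat}.
Local Notation leb := (@lebesgue_measure R).
Local Notation mu := (@lebesgue_rV R n).
Local Notation RV := (measurableTypeR R * 'rV[R]_n)%type.

Lemma Rintegral_rV_cons (f : 'rV[R]_n.+1 -> R) : measurable_fun setT f ->
  \int[lebesgue_rV n.+1]_w f w = \int[(leb \x mu)%E]_z f (rV_cons z).
Proof.
move=> mf; have mE : measurable_fun setT (EFin \o f) by exact/measurable_EFinP.
rewrite /Rintegral integralE [in RHS]integralE; congr (fine (_ - _)%E).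
  apply: eq_trans (integral_rV_cons (measurable_funepos mE) (fun w => funepos_ge0 _ w)) _.
  by apply: eq_integral => z _; rewrite !funeposE.
apply: eq_trans (integral_rV_cons (measurable_funeneg mE) (fun w => funeneg_ge0 _ w)) _.
by apply: eq_integral => z _; rewrite !funenegE.
Qed.

Lemma kap_derive_eq0 (e x : R) : e < `|x| -> derive1 (kap e) x = 0.
Proof.
move=> ex; rewrite derive1E.
have nz : \near x, kap e x = cst 0 x.
  have : nbhs x [set y | e < `|y|].
    by apply: (cvgr_gt (`|x|) (@norm_continuous _ R x)).
  by apply: filterS => y /ltW /kap_eq0.
have -> : 'D_1 (kap e) x = 'D_1 (cst 0 : R -> R) x by exact: near_eq_derive.
by rewrite derive_cst.
Qed.

Variables (e t : R) (x : 'rV[R]_n).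

(** The factors of the mollifier centred at [(t, x)], as a tensor on [R^(n+1)] with time as
    coordinate 0, the form in which [GP_equation] takes its test functions. *)
Definition st_factor (i : 'I_n.+1) : R -> R :=
  if unlift ord0 i is Some j then fun y => kap e (x 0 j - y) else fun s => kap e (t - s).

Let st_factorS j : st_factor (lift ord0 j) = fun y => kap e (x 0 j - y).
Proof. by rewrite /st_factor liftK. Qed.

Let st_factor0 : st_factor ord0 = fun s => kap e (t - s).
Proof. by rewrite /st_factor unlift_none. Qed.

Let st_test i : test1 (st_factor i).
Proof. by rewrite /st_factor; case: unlift => [j|]; apply: test1_shift; exact: kap_test1. Qed.

Let st_smooth i : smooth1 (st_factor i).
Proof. by case: (st_test i). Qed.

Definition st_kernel : 'rV[R]_n.+1 -> R := tensor st_factor.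

Lemma st_kernel_test (J : set R) : (forall s, t - e <= s <= t + e -> J s) ->
  test_function [set z : 'rV[R]_n.+1 | J (z 0 ord0)] st_kernel.
Proof.
move=> teJ; pose c (i : 'I_n.+1) := if unlift ord0 i is Some j then x 0 j else t.
apply: (@tensor_test_function R n.+1 _ (fun i => c i - e) (fun i => c i + e)) => //.
  have key (d y : R) : kap e (d - y) != 0 -> d - e <= y <= d + e.
    move=> /eqP h; suff : `|d - y| <= e.
      by rewrite ler_norml => /andP[? ?]; apply/andP; split; lra.
    by rewrite leNgt; apply/negP => /ltW /kap_eq0.
  by move=> i y; rewrite /st_factor /c; case: (unlift ord0 i) => [j|]; exact: key.
by move=> w /(_ ord0); rewrite /c unlift_none => /teJ.
Qed.

Lemma st_kernelE (z : RV) : st_kernel (rV_cons z) = cker (kap e) (kaps e) t x z.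
Proof.
case: z => s y; rewrite /st_kernel tensor_cons st_factor0 /cker tensor_subE/=.
by congr (_ * _); apply: eq_bigr => j _; rewrite st_factorS.
Qed.

(** The kernel depends on [t - s], so one derivative in [s] changes the sign; for two space
    derivatives the signs cancel. *)
Lemma st_kernel_tE (z : RV) : pderiv ord0 st_kernel (rV_cons z) = - cker (derive1 (kap e)) (kaps e) t x z.
Proof.
case: z => s y; rewrite /st_kernel pderiv_tensor// tensor_cons /upd eqxx st_factor0.
rewrite derive1_sub; last exact: (kap_test1 e).1.
rewrite /cker tensor_subE/= mulNr; congr (- (_ * _)); apply: eq_bigr => j _.
by rewrite st_factorS.
Qed.

Lemma st_kernel_jjE j (z : RV) : mderiv [:: lift ord0 j; lift ord0 j] st_kernel (rV_cons z) =
  cker (kap e) (upd (kaps e) j (derive1 (derive1 (kap e)))) t x z.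
Proof.
have sl : smooth1 (st_factor (lift ord0 j)) by exact: st_smooth.
rewrite /mderiv /st_kernel /= pderiv_tensor// pderiv_tensor; last first.
  by rewrite /upd eqxx; exact: smooth1_derive.
case: z => s y; rewrite tensor_cons /cker tensor_subE /upd /= st_factor0; congr (_ * _).
apply: eq_bigr => i _; rewrite (inj_eq lift_inj) eqxx !st_factorS.
by case: (i =P j) => [->|_]; rewrite ?derive2_sub//; exact: (kap_test1 e).1.
Qed.

Section equation.
Variables (I : set R) (u : R -> 'rV[R]_n -> R[i]) (a b M : R).
Hypotheses (oI : open I) (abI : forall s, a <= s <= b -> I s) (tab : a + e <= t <= b - e)
  (GP : GP_equation I u).
Let p s y := complex.Re (clamped u a b s y).
Let q s y := complex.Im (clamped u a b s y).
Hypotheses (mp : measurable_fun setT (fun z : RV => p z.1 z.2))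
  (mq : measurable_fun setT (fun z : RV => q z.1 z.2))
  (pM : forall s y, `|p s y| <= M) (qM : forall s y, `|q s y| <= M).

Let W s y := defect p q s y.
Let k0 := cker (kap e) (kaps e) t x.
Let k1 := cker (derive1 (kap e)) (kaps e) t x.
Let k2 j := cker (kap e) (upd (kaps e) j (derive1 (derive1 (kap e)))) t x.

(* Real and imaginary parts of the bracket in GP_equation tested with st_kernel. *)
Let Hre (z : RV) := - (q z.1 z.2 * k1 z) + \sum_(j < n) p z.1 z.2 * k2 j z + p z.1 z.2 * W z.1 z.2 * k0 z.
Let Him (z : RV) := p z.1 z.2 * k1 z + \sum_(j < n) q z.1 z.2 * k2 j z + q z.1 z.2 * W z.1 z.2 * k0 z.

(** At times outside [[a, b]] the kernels vanish, so that [clamped] may replace the solution and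
    integrals over [Q] may be extended to the whole space. *)
Let far (z : RV) : ~ (a <= z.1 <= b) -> [/\ k0 z = 0, k1 z = 0 & forall j, k2 j z = 0].
Proof.
move=> nz; have ez : e < `|t - z.1|.
  rewrite ltNge; apply/negP; rewrite ler_norml => /andP[h1 h2]; apply: nz.
  by case/andP: tab => h3 h4; apply/andP; split; lra.
by rewrite /k0 /k1 /k2 /cker kap_derive_eq0// kap_eq0 ?ltW//; split=> [||j]; rewrite mul0r.
Qed.

Let bracket (z : RV) :
  let w := u z.1 z.2 in
  (- ('i%C * w * (pderiv ord0 st_kernel (rV_cons z))%:C%C)
   + w * (\sum_(j < n) mderiv [:: lift ord0 j; lift ord0 j] st_kernel (rV_cons z))%:C%C
   + w * (1 - normc w ^+ 2)%:C%C * (st_kernel (rV_cons z))%:C%C) = Complex (Hre z) (Him z).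
Proof.
move=> w; rewrite st_kernel_tE st_kernelE /w {w}.
have -> : \sum_(j < n) mderiv [:: lift ord0 j; lift ord0 j] st_kernel (rV_cons z) = \sum_(j < n) k2 j z.
  by apply: eq_bigr => j _; exact: st_kernel_jjE.
rewrite sqr_normcE -/k0 -/k1.
have [zab|/far[h0 h1 h2]] := pselect (a <= z.1 <= b); last first.
  have s0 (c : R) : \sum_(j < n) c * k2 j z = 0 by rewrite big1 => // j _; rewrite h2 mulr0.
  have s1 : \sum_(j < n) k2 j z = 0 by exact: big1.
  rewrite /Hre /Him h0 h1 !s0 s1.
  by rewrite !mulr0 oppr0 !rmorph0 !mulr0 !addr0 oppr0.
rewrite /Hre /Him -!mulr_sumr /W /defect /p /q /clamped clamp_id//.
case: (u z.1 z.2) => c d; apply/eqP; rewrite eq_complex /=; apply/andP; split; apply/eqP.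
  by rewrite -/(k2 _); ring.
by ring.
Qed.

Let mk0 : measurable_fun setT k0.
Proof.
apply: (@measurable_cker R n _ RV (kap e) (kaps e) (cst t) (cst x) id);
  [exact: kap_measurable|move=> i; exact: kap_measurable|exact: measurable_cst|exact: measurable_cst|exact: measurable_id].
Qed.

Let mk1 : measurable_fun setT k1.
Proof.
apply: (@measurable_cker R n _ RV (derive1 (kap e)) (kaps e) (cst t) (cst x) id);
  [exact: smooth1_measurable (test1_derive (kap_test1 e)).1|move=> i; exact: kap_measurable|exact: measurable_cst|exact: measurable_cst|exact: measurable_id].
Qed.

Let mk2 j : measurable_fun setT (k2 j).
Proof.
apply: (@measurable_cker R n _ RV (kap e) (upd (kaps e) j (derive1 (derive1 (kap e)))) (cst t) (cst x) id);
  [exact: kap_measurable|move=> i; rewrite /upd; case: eqP => _|exact: measurable_cst|exact: measurable_cst|exact: measurable_id].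
  exact: smooth1_measurable (test1_derive (test1_derive (kap_test1 e))).1.
exact: kap_measurable.
Qed.

Let mW : measurable_fun setT (fun z : RV => W z.1 z.2).
Proof. by apply: measurable_funB; [apply: measurable_funB => //|]; exact: measurable_funM. Qed.

Let mHre : measurable_fun setT Hre.
Proof.
apply: measurable_funD; last by do 2 apply: measurable_funM => //.
apply: measurable_funD; first by apply: measurable_funN; exact: measurable_funM.
by apply: measurable_sum => j; exact: measurable_funM.
Qed.

Let mHim : measurable_fun setT Him.
Proof.
apply: measurable_funD; last by do 2 apply: measurable_funM => //.
apply: measurable_funD; first exact: measurable_funM.
by apply: measurable_sum => j; exact: measurable_funM.
Qed.

Let Q := [set z : 'rV[R]_n.+1 | I (z 0 ord0)].

Let zero_outside (z : RV) : ~ Q (rV_cons z) -> Hre z = 0 /\ Him z = 0.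
Proof.
rewrite /Q /= rV_cons0 => nI; have [|h0 h1 h2] := @far z; first by move/abI.
by rewrite /Hre /Him h0 h1 !big1 => [|j _|j _]; rewrite ?h2 ?mulr0 ?oppr0 ?addr0.
Qed.

Let integral_Q (H : RV -> R) (G : 'rV[R]_n.+1 -> R) : measurable_fun setT H ->
  (forall z, G (rV_cons z) = H z) -> (forall z, ~ Q (rV_cons z) -> H z = 0) ->
  \int[lebesgue_rV n.+1]_(w in Q) G w = \int[(leb \x mu)%E]_z H z.
Proof.
move=> mH GH HQ.
have mHu : measurable_fun setT (fun w : 'rV[R]_n.+1 => H (rV_uncons w)).
  exact: (measurableT_comp mH (@measurable_rV_uncons R n)).
transitivity (\int[lebesgue_rV n.+1]_w H (rV_uncons w)); last first.
  by rewrite Rintegral_rV_cons//; apply: eq_Rintegral => z _; rewrite rV_consK.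
rewrite /Rintegral [in LHS]integral_mkcond; congr fine; apply: eq_integral => w _.
rewrite patchE -[w]rV_unconsK GH rV_consK; case: ifPn => // wQ.
have -> : H (rV_uncons w) = 0; last by [].
apply: HQ => Qw; move/negP: wQ; apply; rewrite inE; exact: Qw.
Qed.

Let integrable_k (F : R -> 'rV[R]_n -> R) MF (A : R -> R) (B : 'I_n -> R -> R) :
  measurable_fun setT (fun z : RV => F z.1 z.2) -> (forall s y, `|F s y| <= MF) ->
  test1 A -> testB B ->
  (leb \x mu)%E.-integrable setT (EFin \o (fun z => F z.1 z.2 * cker A B t x z)).
Proof. by move=> mF FM tA tB; apply: (integrable_conv mF FM). Qed.

Let WM s y : `|W s y| <= 1 + 2 * M ^+ 2.
Proof.
have m2 (c d : R) : `|c| <= M -> `|d| <= M -> `|c * d| <= M ^+ 2.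
  by move=> hc hd; rewrite normrM expr2 ler_pM.
move: (m2 _ _ (pM s y) (pM s y)) (m2 _ _ (qM s y) (qM s y)).
by rewrite /W /defect !ler_norml => /andP[? ?] /andP[? ?]; apply/andP; split; lra.
Qed.

(** The first identity is the imaginary part of the equation tested with [st_kernel], the second its
    real part. *)
Lemma moll_equation :
  moll_t p e t x = - (\sum_(j < n) moll_jj q e j t x + moll (fun s y => q s y * defect p q s y) e t x) /\
  moll_t q e t x = \sum_(j < n) moll_jj p e j t x + moll (fun s y => p s y * defect p q s y) e t x.
Proof.
have tk := kap_test1 e; have tk1 := test1_derive tk; have tk2 := test1_derive tk1.
have tks : testB (kaps e : 'I_n -> R -> R) by exact: kaps_testB.
have tks2 j : testB (upd (kaps e : 'I_n -> R -> R) j (derive1 (derive1 (kap e)))) by exact: testB_upd.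
have mpW : measurable_fun setT (fun z : RV => p z.1 z.2 * defect p q z.1 z.2) by exact: measurable_funM.
have mqW : measurable_fun setT (fun z : RV => q z.1 z.2 * defect p q z.1 z.2) by exact: measurable_funM.
have pWM s y : `|p s y * defect p q s y| <= M * (1 + 2 * M ^+ 2).
  by rewrite normrM ler_pM//; exact: WM.
have qWM s y : `|q s y * defect p q s y| <= M * (1 + 2 * M ^+ 2).
  by rewrite normrM ler_pM//; exact: WM.
have ip0 := @integrable_k (fun s y => p s y * defect p q s y) _ _ _ mpW pWM tk tks.
have iq0 := @integrable_k (fun s y => q s y * defect p q s y) _ _ _ mqW qWM tk tks.
have ip1 := integrable_k mp pM tk1 tks; have iq1 := integrable_k mq qM tk1 tks.
have ip2 j := integrable_k mp pM tk (tks2 j); have iq2 j := integrable_k mq qM tk (tks2 j).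
have tf : test_function Q st_kernel.
  apply: st_kernel_test => s sab; apply: abI; case/andP: tab sab => ? ? /andP[? ?]; apply/andP; split; lra.
have := GP; rewrite /GP_equation (interior_id I).1// => /(_ _ tf).
rewrite /cintegral => /eqP; rewrite eq_complex /= => /andP[/eqP h1 /eqP h2].
have E1 := integral_Q (G := fun w => complex.Re (
   - ('i%C * u (rV_uncons w).1 (rV_uncons w).2 * (pderiv ord0 st_kernel w)%:C%C)
   + u (rV_uncons w).1 (rV_uncons w).2 * (\sum_(j < n) mderiv [:: lift ord0 j; lift ord0 j] st_kernel w)%:C%C
   + u (rV_uncons w).1 (rV_uncons w).2 * (1 - normc (u (rV_uncons w).1 (rV_uncons w).2) ^+ 2)%:C%C * (st_kernel w)%:C%C))
   mHre _ (fun z nz => (zero_outside nz).1).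
have E2 := integral_Q (G := fun w => complex.Im (
   - ('i%C * u (rV_uncons w).1 (rV_uncons w).2 * (pderiv ord0 st_kernel w)%:C%C)
   + u (rV_uncons w).1 (rV_uncons w).2 * (\sum_(j < n) mderiv [:: lift ord0 j; lift ord0 j] st_kernel w)%:C%C
   + u (rV_uncons w).1 (rV_uncons w).2 * (1 - normc (u (rV_uncons w).1 (rV_uncons w).2) ^+ 2)%:C%C * (st_kernel w)%:C%C))
   mHim _ (fun z nz => (zero_outside nz).2).
rewrite {}E1 in h1; last by move=> z; rewrite rV_consK bracket.
rewrite {}E2 in h2; last by move=> z; rewrite rV_consK bracket.
have nN (F : RV -> R) : (leb \x mu)%E.-integrable setT (EFin \o F) ->
   (leb \x mu)%E.-integrable setT (EFin \o (fun z => - F z)).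
  by move=> /(intgZ (-1)); congr (integrable _ _ _); apply/funext => z; rewrite /= mulN1r.
split.
  move: h2; rewrite /Him RintegralD//; last first.
    by apply: intgD => //; exact: intg_sum.
  rewrite RintegralD//; last exact: intg_sum.
  rewrite Rintegral_sumf// -addrA => h2; apply/eqP; rewrite -subr_eq0 opprK; apply/eqP.
  exact: h2.
move: h1; rewrite /Hre RintegralD//; last first.
  by apply: intgD; [exact: nN|exact: intg_sum].
rewrite RintegralD//; [|exact: nN|exact: intg_sum].
rewrite RintegralN Rintegral_sumf// -addrA => h1; apply/esym/eqP; rewrite -subr_eq0; apply/eqP.
by rewrite addrC; exact: h1.
Qed.

End equation.

End mollified_equation.

(** * The energy as the integral of a real density *)

Section energy_density.
Context {R : realType} {n : nat}.
Local Notation mu := (@lebesgue_rV R n).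
Implicit Types f : 'rV[R]_n -> R[i].

Definition energy_density f x : R :=
  2^-1 * (\sum_(j < n) (complex.Re (wgrad f j x) ^+ 2 + complex.Im (wgrad f j x) ^+ 2)) +
  4^-1 * (1 - complex.Re (f x) * complex.Re (f x) - complex.Im (f x) * complex.Im (f x)) ^+ 2.

Lemma energy_densityE f : cmeasurable f -> (forall j, cmeasurable (wgrad f j)) ->
  (energy f = \int[mu]_x (energy_density f x)%:E)%E.
Proof.
move=> [m1 m2] mg.
have mG : measurable_fun setT (fun x => (\sum_(j < n)
    (complex.Re (wgrad f j x) ^+ 2 + complex.Im (wgrad f j x) ^+ 2))%:E).
  apply/measurable_EFinP; apply: measurable_sum => j; have [? ?] := mg j.
  by apply: measurable_funD; exact: measurable_funX.
have mW : measurable_fun setT (fun x =>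
    ((1 - complex.Re (f x) * complex.Re (f x) - complex.Im (f x) * complex.Im (f x)) ^+ 2)%:E).
  apply/measurable_EFinP; apply: measurable_funX; apply: measurable_funB; last exact: measurable_funM.
  by apply: measurable_funB => //; exact: measurable_funM.
have G0 x : (0 <= (\sum_(j < n) (complex.Re (wgrad f j x) ^+ 2 + complex.Im (wgrad f j x) ^+ 2))%:E)%E.
  by rewrite lee_fin sumr_ge0// => j _; rewrite addr_ge0 ?sqr_ge0.
rewrite /energy /energy_density; under [RHS]eq_integral => x _ do rewrite EFinD !EFinM.
rewrite ge0_integralD//; last first.
- by apply: measurable_funeM.
- by move=> x _; rewrite -EFinM lee_fin mulr_ge0 ?sqr_ge0.
- by apply: measurable_funeM.
- by move=> x _; rewrite mule_ge0.
rewrite !ge0_integralZl//; last first.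
  by move=> x _; rewrite lee_fin sqr_ge0.
congr (_ * _ + _ * _)%E.
  apply: eq_integral => x _; congr EFin; apply: eq_bigr => j _; exact: sqr_normcE.
by apply: eq_integral => x _; rewrite sqr_normcE !expr2 opprD addrA.
Qed.

Lemma energy_density_integrable f : cmeasurable f -> (forall j, cmeasurable (wgrad f j)) ->
  (energy f < +oo)%E -> mu.-integrable setT (EFin \o energy_density f).
Proof.
move=> mf mg; rewrite energy_densityE// => h.
have e0 x : 0 <= energy_density f x.
  by rewrite addr_ge0// mulr_ge0 ?sqr_ge0// sumr_ge0// => j _; rewrite addr_ge0 ?sqr_ge0.
apply/integrableP; split; last by under eq_integral => x _ do rewrite /= ger0_norm//.
have [m1 m2] := mf; apply/measurable_EFinP; apply: measurable_funD; apply: measurable_funM => //.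
  apply: measurable_sum => j; have [? ?] := mg j.
  by apply: measurable_funD; exact: measurable_funX.
apply: measurable_funX; apply: measurable_funB; last exact: measurable_funM.
by apply: measurable_funB => //; exact: measurable_funM.
Qed.

End energy_density.

(** * Conservation of the energy *)

Section solution.
Context {R : realType} {n : nat}.
Local Notation leb := (@lebesgue_measure R).
Local Notation mu := (@lebesgue_rV R n).
Local Notation RV := (measurableTypeR R * 'rV[R]_n)%type.
Variables (k : nat) (I : set R) (u : R -> 'rV[R]_n -> R[i]).
Hypotheses (k1 : (1 < k)%N) (n0 : (0 < n)%N) (cu : Xcontinuous k I u) (oI : open I)
  (iI : is_interval I) (GP : GP_equation I u).

Let segment_around s t : I s -> I t -> exists a b, [/\ a < s < b, a < t < b & forall r, a <= r <= b -> I r].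
Proof.
have ball_in r : I r -> exists2 d, 0 < d & I (r - d) /\ I (r + d).
  move=> /oI /nbhs_ballP[d /= d0 H]; exists (d / 2); first lra.
  by split; apply: H; rewrite /ball/= ?opprD ?opprK ?addrA ?subrr ?sub0r ?add0r ?normrN gtr0_norm; lra.
move=> /ball_in[d d0 [s1 s2]] /ball_in[e e0 [t1 t2]].
exists (Num.min (s - d) (t - e)), (Num.max (s + d) (t + e)); split.
- by rewrite gt_min lt_max; apply/andP; split; apply/orP; left; lra.
- by rewrite gt_min lt_max; apply/andP; split; apply/orP; right; lra.
- move=> r rab; apply: (iI _ _ rab); [by case: leP|by case: leP].
Qed.

Let wgrad_deriv t j : I t -> is_wderiv [:: j] (u t) (wgrad (u t) j).
Proof.
move=> It; have [X _] := cu; have [g [_ [fg _ _ _]]] := Xspace_derivs j k1 (X _ It).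
by apply: wderivP; exists g.
Qed.

(** A direction in which to differentiate: measurability of [u t] is read off one of its weak
    derivatives. *)
Let j0 : 'I_n := Ordinal n0.

Let u_meas t : I t -> cmeasurable (u t) /\ forall j, cmeasurable (wgrad (u t) j).
Proof.
by move=> It; split; [case: (wgrad_deriv j0 It) => -[]|move=> j; case: (wgrad_deriv j It) => _ -[]].
Qed.

Section on_segment.
Variables (a b : R).
Hypotheses (ab : a <= b) (abI : forall r, a <= r <= b -> I r).
Let p r x := complex.Re (clamped u a b r x).
Let q r x := complex.Im (clamped u a b r x).

Lemma solution_slab : exists M K, slab p q a b M K.
Proof.
have [M HM] := sup_bound k1 cu abI; have [K [K0 HK]] := derivs_bound k1 cu abI.
have cM r x : normc (clamped u a b r x) <= M by apply: HM; exact: clamp_itv.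
have cK r j : good_derivs (clamped u a b r) j K by apply: HK; exact: clamp_itv.
have Rl (z w : R[i]) : `|complex.Re z - complex.Re w| <= normc (z - w).
  by rewrite -raddfB normr_Re_le.
have Il (z w : R[i]) : `|complex.Im z - complex.Im w| <= normc (z - w).
  by rewrite -raddfB normr_Im_le.
have mp : measurable_fun setT (fun z : RV => p z.1 z.2) by exact: (measurable_clamped k1 cu ab abI Rl).
have mq : measurable_fun setT (fun z : RV => q z.1 z.2) by exact: (measurable_clamped k1 cu ab abI Il).
have pM r x : `|p r x| <= M by apply: le_trans (normr_Re_le _) _.
have qM r x : `|q r x| <= M by apply: le_trans (normr_Im_le _) _.
exists M, K; split => //.
- move=> w w0; have [e e0 He] := clamped_uc k1 cu ab abI w0; exists e => // s t x y st xy.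
  by split; [apply: le_trans (Rl _ _) _|apply: le_trans (Il _ _) _]; exact: He.
- by move=> r j; have [? _] := good_derivs_rwd (cK r j).
- by move=> r j; have [_ [? _]] := good_derivs_rwd (cK r j).
- by move=> r j; have [_ [_ [? _]]] := good_derivs_rwd (cK r j).
- by move=> r j; have [_ [_ [_ ?]]] := good_derivs_rwd (cK r j).
- by move=> e t x _ tab; have [] := moll_equation x oI abI tab GP mp mq pM qM.
- by move=> e t x _ tab; have [] := moll_equation x oI abI tab GP mp mq pM qM.
Qed.

Lemma solution_grad_cont s : a <= s <= b -> grad_cont p s /\ grad_cont q s.
Proof.
move=> sab; split => th th0; have [r r0 H] := clamped_grad_cont k1 cu ab abI sab th0;
    exists r => // tau ts j.
  have [[g gK wg] _] := good_derivs_rwd (H tau ts j); exists g => //.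
  by move: wg; congr rwd; apply/funext => x; rewrite raddfB.
have [_ [[g gK wg] _]] := good_derivs_rwd (H tau ts j); exists g => //.
by move: wg; congr rwd; apply/funext => x; rewrite raddfB.
Qed.

End on_segment.

(** Finite energy at [s] supplies the square-integrable data that [energy_le] asks for there.
    Nothing of the kind is assumed at [t], so finiteness at [t] is part of the conclusion. *)
Lemma solution_energy_le s t : I s -> I t -> (energy (u s) < +oo)%E ->
  (energy (u t) <= energy (u s))%E.
Proof.
move=> Is It Es; have [a [b [sab tab abI]]] := segment_around Is It.
have ab : a <= b by case/andP: sab => ? ?; lra.
have sab' : a <= s <= b by case/andP: sab => /ltW -> /ltW ->.
have tab' : a <= t <= b by case/andP: tab => /ltW -> /ltW ->.
have [M [K S]] := solution_slab ab abI; have [cp cq] := solution_grad_cont ab abI sab'.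
have us : clamped u a b s = u s by rewrite /clamped clamp_id.
have ut : clamped u a b t = u t by rewrite /clamped clamp_id.
have [mus mgs] := u_meas Is; have [mut mgt] := u_meas It.
have ei := energy_density_integrable mus mgs Es.
have [m1 m2] := mus.
pose G j x := complex.Re (wgrad (u s) j x); pose H j x := complex.Im (wgrad (u s) j x).
pose W x := 1 - complex.Re (u s x) * complex.Re (u s x) - complex.Im (u s x) * complex.Im (u s x).
(* Four times the energy density dominates each squared derivative and the squared defect. *)
have ei2 := intgZ 4 ei.
have dG j x : G j x ^+ 2 + H j x ^+ 2 <= \sum_(i < n) (G i x ^+ 2 + H i x ^+ 2).
  by rewrite [leRHS](bigD1 j)//= lerDl sumr_ge0// => i _; rewrite addr_ge0 ?sqr_ge0.
have S0 x : 0 <= \sum_(i < n) (G i x ^+ 2 + H i x ^+ 2).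
  by rewrite sumr_ge0// => i _; rewrite addr_ge0 ?sqr_ge0.
have Gi j : mu.-integrable setT (EFin \o (fun x => G j x ^+ 2)).
  apply: (le_intg _ ei2); first by apply: measurable_funX; case: (mgs j).
  move=> x; rewrite ger0_norm ?sqr_ge0// /energy_density -/(G _ _).
  have := dG j x; have := S0 x; have := sqr_ge0 (W x); have := sqr_ge0 (H j x).
  by rewrite /W; lra.
have Hi j : mu.-integrable setT (EFin \o (fun x => H j x ^+ 2)).
  apply: (le_intg _ ei2); first by apply: measurable_funX; case: (mgs j).
  move=> x; rewrite ger0_norm ?sqr_ge0// /energy_density -/(G _ _).
  have := dG j x; have := S0 x; have := sqr_ge0 (W x); have := sqr_ge0 (G j x).
  by rewrite /W; lra.
have Wi : mu.-integrable setT (EFin \o (fun x => W x ^+ 2)).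
  apply: (le_intg _ ei2).
    apply: measurable_funX; apply: measurable_funB; last exact: measurable_funM.
    by apply: measurable_funB => //; exact: measurable_funM.
  move=> x; rewrite ger0_norm ?sqr_ge0// /energy_density -/(G _ _).
  by have := S0 x; rewrite /W; lra.
have GA j : sqr_int (G j) (\int[mu]_x (G j x ^+ 2)) by apply: sqr_int_of => //; case: (mgs j).
have HB j : sqr_int (H j) (\int[mu]_x (H j x ^+ 2)) by apply: sqr_int_of => //; case: (mgs j).
have WC : sqr_int W (\int[mu]_x (W x ^+ 2)).
  apply: sqr_int_of => //; apply: measurable_funB; last exact: measurable_funM.
  by apply: measurable_funB => //; exact: measurable_funM.
have [wG wH] : (forall j, rwd j (fun x => complex.Re (u s x)) (G j)) /\ (forall j, rwd j (fun x => complex.Im (u s x)) (H j)).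
  by split => j; have [? ?] := is_wderiv_rwd (wgrad_deriv j Is).
have := @energy_le R n _ _ a b M K S s t G H (fun j x => complex.Re (wgrad (u t) j x))
  (fun j x => complex.Im (wgrad (u t) j x)) _ _ (\int[mu]_x (W x ^+ 2)) sab tab GA HB _ _ cp cq.
rewrite /defect us ut => /(_ wG wH WC) h.
rewrite (energy_densityE mut mgt) (energy_densityE mus mgs); apply: le_trans (h _ _ _ _) _.
- by move=> j; have [_ lg _] := wgrad_deriv j It; case: (L1loc_locint lg).
- by move=> j; have [_ lg _] := wgrad_deriv j It; case: (L1loc_locint lg).
- by move=> j; have [? ?] := is_wderiv_rwd (wgrad_deriv j It).
- by move=> j; have [? ?] := is_wderiv_rwd (wgrad_deriv j It).
rewrite -EFin_Rintegral// lee_fin.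
have si : mu.-integrable setT (EFin \o (fun x => \sum_(j < n) (G j x ^+ 2 + H j x ^+ 2))).
  by apply: intg_sum => j; exact: intgD.
have -> : \int[mu]_x energy_density (u s) x =
    \int[mu]_x (2^-1 * (\sum_(j < n) (G j x ^+ 2 + H j x ^+ 2)) + 4^-1 * W x ^+ 2) by [].
rewrite RintegralD//; [|exact: intgZ..]; rewrite !RintegralZl//.
rewrite (Rintegral_sumf (fun j => intgD (Gi j) (Hi j))).
by rewrite lerD2r ler_wpM2l//; apply: ler_sum => j _; rewrite RintegralD.
Qed.

End solution.

Theorem proposition1p2 (R : realType) (D k : nat)
    (u0 : 'rV[R]_D -> R[i]) (I : set R) (u : R -> 'rV[R]_D -> R[i]) :
  (2 <= D)%N -> (D < 2 * k)%N ->
  Xspace k u0 -> (energy u0 < +oo)%E ->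
  open I -> maximal_GP_solution k u0 I u ->
  forall t : R, I t ->
    energy (u t) = energy u0 /\ (energy (u t) < +oo)%E.
Proof.
move=> D2 Dk _ Eu0 oI [[iI I0 cu u00 GP] _] t It.
(* From [2 <= D < 2 k] one gets [k >= 2], hence square-integrable second derivatives. *)
have k1 : (1 < k)%N by rewrite -(ltn_pmul2l (isT : 0 < 2)%N) muln1; exact: leq_ltn_trans Dk.
have D0 : (0 < D)%N by exact: leq_trans D2.
have E0 : (energy (u 0%R) < +oo)%E by rewrite u00.
have le1 := solution_energy_le k1 D0 cu oI iI GP I0 It E0.
have Et := le_lt_trans le1 E0; split => //.
apply/eqP; rewrite eq_le -u00 le1/=.
(* The energy at [t] is now known to be finite, so the two times may be exchanged. *)
exact: (solution_energy_le k1 D0 cu oI iI GP It I0 Et).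
Qed.
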